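(* Let $\Omega\subset\mathbb{R}^n$ be a bounded domain of class $C^2$ and $1\le m\le n-1$. If $\Omega$ has no orthogonal $m$-slices, then $\varkappa^{m,p}(\Omega)>0$ for all $p\in[1,\infty)$. Moreover, for any $V\in\mathbf{CV}^m_\perp(\Omega)$ with associated boundary varifold $\Gamma$ we have $$\mathbf{M}(V)\le\frac{1}{\varkappa^{m,p}(\Omega)}\,\|B_V\|^p_{L^p(V)},\qquad \mathbf{M}(\Gamma)\le C\,\|B_V\|^p_{L^p(V)},$$ where $C=C(n,m,p,\Omega)$.
   Context: Let $S=\partial\Omega$, and let $\nu^S$ be the unit normal of $S$ pointing into $\Omega$. $G(m,n)$ is the Grassmannian of $m$-dimensional subspaces of $\mathbb{R}^n$, identified with the rank $m$ orthogonal projections $P\in\mathbb{R}^{n\times n}$. An $m$-varifold in $\mathbb{R}^n$ is a Radon measure $V$ on $\mathbb{R}^n\times G(m,n)$, with mass $\mathbf{M}(V)=V(\mathbb{R}^n\times G(m,n))$; it has support in $\overline\Omega$ if it is supported in $\overline\Omega\times G(m,n)$. An $(m-1)$-varifold in $S$ is a Radon measure $\Gamma$ on $G_{m-1}(TS)=\{(x,Q):x\in S,\ Q\in G(m-1,n),\ Q\subset T_xS\}$, with mass $\mathbf{M}(\Gamma)$ its total measure. Orthogonal boundary: let $V$ be an $m$-varifold in $\mathbb{R}^n$ with support in $\overline\Omega$ and curvature $B\in L^1(V)$, where $B(x,P)$ is a bilinear map $\mathbb{R}^n\times\mathbb{R}^n\to\mathbb{R}^n$, and let $\Gamma$ be an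 $(m-1)$-varifold in $S$. $V$ (with curvature $B$) is orthogonal to $S$ along $\Gamma$ if for all $\phi\in C^1(\mathbb{R}^n\times\mathbb{R}^{n\times n},\mathbb{R}^n)$ $$\int_{\mathbb{R}^n\times G(m,n)}\big(D_P\phi\cdot B+\langle\operatorname{tr}B,\phi\rangle+\langle D_x\phi,P\rangle\big)\,dV(x,P)=-\int_{G_{m-1}(TS)}\langle\nu^S(x),\phi(x,\nu^S(x)\wedge Q)\rangle\,d\Gamma(x,Q).$$ Here $B_{ij}^k=\langle B(e_i,e_j),e_k\rangle$, $D_P\phi\cdot B=\sum_{i,j,k}\partial_{P^k_j}\phi^i\,B^k_{ij}$, $\operatorname{tr}B=\sum_iB(e_i,e_i)$, $\langle D_x\phi,P\rangle$ is the Hilbert–Schmidt product, and $\nu^S(x)\wedge Q$ is the span of $\nu^S(x)$ and $Q$. $\mathbf{CV}^m_\perp(\Omega)$ is the class of all $V$ for which this holds for some $\Gamma$; $\Gamma$ is the associated boundary varifold, and $B_V:=B$. $\varkappa^{m,p}(\Omega)=\inf\{\|B_V\|^p_{L^p(V)}:V\in\mathbf{CV}^m_\perp(\Omega),\ \mathbf{M}(V)=1\}$. $m$-slice: for an affine $m$-plane $x_0+P$, any nonempty connected component $\Delta$ of the interior (relative to $x_0+P$) of $\overline{\Omega}\cap(x_0+P)$ is an $m$-slice of $\Omega$. It is orthogonal if $\nu^S(x)\in P$ for all $x\in\partial\Delta$ (boundary relative to $x_0+P$). *)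

(* Defs.v *)
From HB Require Import structures.
From mathcomp Require Import all_boot all_order all_algebra.
From mathcomp Require Import all_classical all_reals all_analysis.

Set Implicit Arguments.
Unset Strict Implicit.
Unset Printing Implicit Defensive.

Import Order.TTheory GRing.Theory Num.Theory.
Import numFieldNormedType.Exports.

Local Open Scope classical_set_scope.
Local Open Scope ring_scope.

Section Calculus.
Context {R : realType}.

(* Continuity of every directional derivative 'D_v f amounts to continuity of
   the differential because V is only used in finite dimension. *)
Definition C1 {V W : normedModType R} (f : V -> W) : Prop :=
  (forall x, differentiable f x) /\ (forall v, continuous ('D_v f)).

Definition C2 {V W : normedModType R} (f : V -> W) : Prop :=
  C1 f /\ (forall v, C1 ('D_v f)).

End Calculus.

Definition frontier {T : topologicalType} (A : set T) : set T :=
  closure A `\` interior A.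

Section Domains.
Context {R : realType} {n : nat}.
Implicit Types (Omega S A : set 'rV[R]_n) (x v w : 'rV[R]_n).

(* The library norm on 'rV_n is the sup norm, so the Euclidean structure is
   spelled out. *)
Definition dot (v w : 'rV[R]_n) : R := \sum_i v ord0 i * w ord0 i.

(* Near each boundary point, Omega is the open region above the graph, in the
   unit direction e and over the hyperplane orthogonal to e, of a C^2 function
   (a function on that hyperplane is extended to R^n by composing it with the
   orthogonal projection). *)
Definition C2_boundary Omega : Prop :=
  forall x, frontier Omega x ->
    exists (e : 'rV[R]_n) (g : 'rV[R]_n -> R),
      [/\ dot e e = 1, C2 g &
          \forall y \near x, Omega y <-> g (y - dot y e *: e) < dot y e].

Definition bounded_C2_domain Omega : Prop :=
  [/\ open Omega, Omega !=set0, connected Omega, bounded_set Omega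
    & C2_boundary Omega].

(* T_x S, as the set of velocities at x of curves in S. *)
Definition tangent S x w : Prop :=
  exists c : R -> 'rV[R]_n,
    [/\ c 0 = x, \forall t \near (0 : R), S (c t) & is_derive (0 : R) 1 c w].

Definition is_inner_normal Omega x v : Prop :=
  [/\ dot v v = 1, forall w, tangent (frontier Omega) x w -> dot v w = 0
    & \forall t \near (0 : R)^'+, Omega (x + t *: v)].

(* On the boundary of a C^2 domain the inner unit normal exists and is unique;
   elsewhere inner_normal is irrelevant. *)
Definition inner_normal Omega x : 'rV[R]_n :=
  xget 0 [set v | is_inner_normal Omega x v].

End Domains.

Section Grassmannian.
Context {R : realType} {n : nat}.

(* A subspace is the row space of its orthogonal projection, so v \in P reads
   (v <= P)%MS. *)
Definition Grass (m : nat) : set 'M[R]_n :=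
  [set P | [/\ P^T = P, P *m P = P & \rank P = m]].

(* kermx U^T spans the orthogonal complement of the row space of U. *)
Definition orth_proj (U : 'M[R]_n) : 'M[R]_n := proj_mx U (kermx U^T).

Definition wedge (v : 'rV[R]_n) (Q : 'M[R]_n) : 'M[R]_n :=
  orth_proj (v + Q)%MS.

Definition affine_plane (x0 : 'rV[R]_n) (P : 'M[R]_n) : set 'rV[R]_n :=
  [set x | (x - x0 <= P)%MS].

(* In the library topology of (subspace A) the points outside A are isolated;
   hence, for subsets of A, interior and frontier in (subspace A) are the ones
   relative to A. *)
Definition is_slice (Omega : set 'rV[R]_n) (x0 : 'rV[R]_n) (P : 'M[R]_n)
    (Delta : set 'rV[R]_n) : Prop :=
  let A := affine_plane x0 P in
  let I := @interior (subspace A) (closure Omega `&` A) in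
  exists2 y, I y & Delta = @connected_component 'rV[R]_n I y.

Definition orthogonal_slice (Omega : set 'rV[R]_n) (m : nat)
    (Delta : set 'rV[R]_n) : Prop :=
  exists (x0 : 'rV[R]_n) (P : 'M[R]_n),
    [/\ Grass m P, is_slice Omega x0 P Delta
      & forall x, @frontier (subspace (affine_plane x0 P)) Delta x ->
          (inner_normal Omega x <= P)%MS].

End Grassmannian.

Section Varifolds.
Context (R : realType) (n : nat).

Definition phase : Type := ('rV[R]_n * 'M[R]_n)%type.

Definition borel_phase := g_sigma_algebraType (@open ('rV[R]_n * 'M[R]_n)%type).

(* A Radon measure on a closed set E of the phase space is identified with its
   extension by zero; in this separable locally compact setting a Borel measure
   which is finite on compact sets is automatically regular. *)
Definition radon_on (E : set phase) (mu : {measure set borel_phase -> \bar R})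
  : Prop :=
  mu (~` E) = 0%E /\ (forall K : set phase, compact K -> (mu K < +oo)%E).

Definition mass (mu : {measure set borel_phase -> \bar R}) : \bar R := mu setT.

Definition is_varifold (m : nat) (V : {measure set borel_phase -> \bar R})
  : Prop :=
  radon_on (setT `*` Grass m) V.

Definition GT (S : set 'rV[R]_n) (k : nat) : set phase :=
  [set z | [/\ S z.1, Grass k z.2
             & forall w : 'rV[R]_n, (w <= z.2)%MS -> tangent S z.1 w]].

Definition is_varifold_in (S : set 'rV[R]_n) (k : nat)
    (Gamma : {measure set borel_phase -> \bar R}) : Prop :=
  radon_on (GT S k) Gamma.

Definition curvature : Type :=
  phase -> {bilinear 'rV[R]_n -> 'rV[R]_n -> 'rV[R]_n}.

Definition coef (B : curvature) (i j k : 'I_n) (z : phase) : R :=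
  B z (delta_mx 0 i) (delta_mx 0 j) ord0 k.

Definition tr_curv (B : curvature) (z : phase) : 'rV[R]_n :=
  \sum_i B z (delta_mx 0 i) (delta_mx 0 i).

(* Hilbert-Schmidt norm of the bilinear map B(x, P). *)
Definition norm_curv (B : curvature) (z : phase) : R :=
  Num.sqrt (\sum_i \sum_j \sum_k (coef B i j k z) ^+ 2).

Definition L1_curv (V : {measure set borel_phase -> \bar R}) (B : curvature)
  : Prop :=
  forall i j k,
    V.-integrable [set: borel_phase] (fun z => (coef B i j k z)%:E).

Definition Lp_norm_pow (V : {measure set borel_phase -> \bar R}) (p : R)
    (B : curvature) : \bar R :=
  ('N[V]_p%:E [EFin \o norm_curv B] `^ p)%E.

(* The coordinate P^k_j = <P e_j, e_k> is the entry (k, j) of P. *)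
Definition DP_term (B : curvature) (phi : phase -> 'rV[R]_n) (z : phase) : R :=
  \sum_i \sum_j \sum_k
    ('D_((0, delta_mx k j) : phase) phi z) ord0 i * coef B i j k z.

Definition Dx_term (phi : phase -> 'rV[R]_n) (z : phase) : R :=
  \sum_i \sum_j ('D_((delta_mx 0 j, 0) : phase) phi z) ord0 i * z.2 i j.

Definition orthogonal_along (Omega : set 'rV[R]_n) (m : nat)
    (V : {measure set borel_phase -> \bar R}) (B : curvature)
    (Gamma : {measure set borel_phase -> \bar R}) : Prop :=
  forall phi : phase -> 'rV[R]_n, C1 phi ->
    (\int[V]_(z in (setT `*` Grass m : set borel_phase))
       (DP_term B phi z + dot (tr_curv B z) (phi z) + Dx_term phi z)%:E =
     - \int[Gamma]_(z in (GT (frontier Omega) m.-1 : set borel_phase))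
         (dot (inner_normal Omega z.1)
              (phi (z.1, wedge (inner_normal Omega z.1) z.2)))%:E)%E.

(* V has curvature B and associated boundary varifold Gamma. *)
Definition CV_perp (Omega : set 'rV[R]_n) (m : nat)
    (V : {measure set borel_phase -> \bar R}) (B : curvature)
    (Gamma : {measure set borel_phase -> \bar R}) : Prop :=
  [/\ is_varifold m V, V (~` (closure Omega `*` Grass m)) = 0%E, L1_curv V B,
      is_varifold_in (frontier Omega) m.-1 Gamma
    & orthogonal_along Omega m V B Gamma].

(* The infimum is over pairs (V, B), so that no uniqueness of the curvature is
   presupposed. *)
Definition kappa (Omega : set 'rV[R]_n) (m : nat) (p : R) : \bar R :=
  ereal_inf [set e | exists V B Gamma,
    [/\ CV_perp Omega m V B Gamma, mass V = 1%E & e = Lp_norm_pow V p B]].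

End Varifolds.

(* Main.v *)
Require Import Defs.
From HB Require Import structures.
From mathcomp Require Import all_boot all_order all_algebra.
From mathcomp Require Import all_classical all_reals all_analysis.
From mathcomp Require Import measurable_realfun ring lra.
Import Order.TTheory GRing.Theory Num.Theory.
Import numFieldNormedType.Exports.
Set Implicit Arguments.
Unset Strict Implicit.
Unset Printing Implicit Defensive.
Local Open Scope classical_set_scope.
Local Open Scope ring_scope.

(* Positivity of kappa. Since |B| <= t + t^(1-p) |B|^p, it is enough to bound the
   total curvature from below at mass 1. Call a point (x, P) null if the mass near
   it tends to 0 with the total curvature. A test field psi w that is tangential
   wherever S meets its support sees no boundary term, so the integral of
   <D_x psi, P w> tends to 0. Taking for psi a bump stretched along a vector v of P,
   one finds that a non-null point stays non-null under small translations inside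
   P as long as it is not conormal, i.e. as long as not both x in S and nu(x) in P.
   Hence the slice through a non-null, non-conormal point would be an orthogonal
   slice. Non-null conormal points are excluded by the field f psi e, where f
   defines Omega near x and e is transversal to S: there the integrand is psi times
   a positive function. By compactness the total mass would tend to 0.

   The bound on M(Gamma) follows from the first variation along a field
   transversal to S.

   Finally kappa < +oo is needed, as otherwise 1/kappa would be 0. The test
   varifold lives on a thick shell in an (m+1)-dimensional plane: the point c + rho y
   carries the plane orthogonal to y, with a radial density supported in the shell,
   so that the m-spheres in the shell make up a varifold without boundary and with
   bounded curvature. *)

(** Nullity stands in for a compactness argument: unit-mass varifolds whose curvature tends to 0
    would subconverge to a measure, and the non-null points are, heuristically, those charged by
    some limit. As delta is uniform in (V, B, Gamma), no weak limit has to be formed, and finite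
    covers apply because null sets are stable under finite unions. The obstacle is the boundary
    term: nothing makes Gamma small together with the curvature, so the positivity proof may only
    use test fields whose boundary integrand vanishes identically. That integrand is evaluated at
    the span of nu and Q, which always contains nu. This is why the test functions depend on P as
    well as on x: localising P away from conormal pairs makes a field admissible even where x lies
    on S, so that the transport also works at boundary points. Every field used is a scalar psi(x,
    P) times a constant vector w, for which <D_x phi, P> is the derivative of psi along P w. *)

(** * Calculus of scalar C1 functions *)

Section ScalarC1.
Context {R : realType} {V : normedModType R}.
Implicit Types (f g : V -> R).

Lemma C1_continuous f : C1 f -> continuous f.
Proof. by move=> [df _] x; exact/differentiable_continuous. Qed.

Lemma C1_cst (a : R) : C1 (cst a : V -> R).
Proof.
split=> [x|v]; first exact: differentiable_cst.
have -> : 'D_v (cst a : V -> R) = cst 0 by apply/funext => x; rewrite derive_cst.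
by move=> x; exact: cvg_cst.
Qed.

Lemma C1D f g : C1 f -> C1 g -> C1 (fun x => f x + g x).
Proof.
move=> [df cf] [dg cg]; split=> [x|v]; first exact: differentiableD.
have -> : 'D_v (fun x => f x + g x) = fun x => 'D_v f x + 'D_v g x.
  by apply/funext => x; rewrite deriveD//; exact: diff_derivable.
by move=> x; apply: cvgD; [exact: cf|exact: cg].
Qed.

Lemma C1M f g : C1 f -> C1 g -> C1 (fun x => f x * g x).
Proof.
move=> hf hg; have [df cf] := hf; have [dg cg] := hg.
split=> [x|v]; first exact: differentiableM.
have -> : 'D_v (fun x => f x * g x) = fun x => f x * 'D_v g x + g x * 'D_v f x.
  by apply/funext => x; rewrite deriveM//; exact: diff_derivable.
by move=> x; apply: cvgD; apply: cvgM; [exact: C1_continuous|exact: cg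
  |exact: C1_continuous|exact: cf].
Qed.

Lemma C1N f : C1 f -> C1 (fun x => - f x).
Proof.
move=> hf; have := C1M (C1_cst (-1)) hf; congr C1.
by apply/funext => x; rewrite /= mulN1r.
Qed.

Lemma C1B f g : C1 f -> C1 g -> C1 (fun x => f x - g x).
Proof. by move=> hf hg; exact: (C1D hf (C1N hg)). Qed.

Lemma C1_sum (I : Type) (s : seq I) (f : I -> V -> R) :
  (forall i, C1 (f i)) -> C1 (fun x => \sum_(i <- s) f i x).
Proof.
move=> hf; elim: s => [|i s IH].
  have -> : (fun x => \sum_(i <- [::]) f i x) = cst 0.
    by apply/funext => x; rewrite big_nil.
  exact: C1_cst.
have -> : (fun x => \sum_(j <- i :: s) f j x) =
    fun x => f i x + \sum_(j <- s) f j x.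
  by apply/funext => x; rewrite big_cons.
exact: C1D.
Qed.

Lemma C1_compR (r r' : R -> R) f : (forall x : R, is_derive x 1 r (r' x)) ->
  continuous r' -> C1 f ->
  C1 (fun x => r (f x)) /\
  forall v x, 'D_v (fun x => r (f x)) x = r' (f x) * 'D_v f x.
Proof.
move=> hr cr hf; have [df cf] := hf.
have dr y : differentiable r y by apply/derivable1_diffP; case: (hr y).
have drf x : differentiable (fun x => r (f x)) x.
  by apply: differentiable_comp => //; exact: dr.
have E v x : 'D_v (fun x => r (f x)) x = r' (f x) * 'D_v f x.
  rewrite deriveE// (_ : (fun x => r (f x)) = r \o f)// diff_comp//=.
  rewrite -(deriveE v (df x)).
  have -> : 'd r (f x) = ( *:%R^~ (derive1 r (f x))) :> (R -> R).
    by apply: deriv1E; exact/derivable1_diffP.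
  by rewrite derive1E (@derive_val _ _ _ _ _ _ _ (hr (f x))) /GRing.scale/= mulrC.
split; last exact: E.
split=> [|v]; first exact: drf.
rewrite (_ : 'D_v _ = fun x => r' (f x) * 'D_v f x); last exact/funext.
move=> x; apply: cvgM; last exact: cf.
by apply: (@continuous_comp _ _ _ f r'); [exact: C1_continuous|exact: cr].
Qed.

Lemma C1_scalel n f (w : 'rV[R]_n) : C1 f ->
  C1 (fun x => f x *: w) /\
  forall v x, 'D_v (fun x => f x *: w) x = 'D_v f x *: w.
Proof.
move=> hf; have [df cf] := hf.
have E v x : 'D_v (fun x => f x *: w) x = 'D_v f x *: w.
  rewrite deriveE; last exact: differentiableZl.
  by rewrite diffZl//= -deriveE.
split; last exact: E.
split=> [x|v]; first exact: differentiableZl.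
rewrite (_ : 'D_v _ = fun x => 'D_v f x *: w); last exact/funext.
by move=> x; apply: cvgZr_tmp; exact: cf.
Qed.

Lemma linear_C1 (f : {linear V -> R}) : continuous f -> C1 f.
Proof.
move=> cf; split=> [x|v]; first exact: linear_differentiable.
have -> : 'D_v f = cst (f v).
  apply/funext => x; rewrite deriveE; last exact: linear_differentiable.
  by rewrite diff_lin.
by move=> x; exact: cvg_cst.
Qed.

Lemma C1_coord p q (f : {linear V -> 'M[R]_(p, q)}) i j :
  continuous f -> C1 (fun x => f x i j).
Proof.
move=> cf.
have lf : linear (fun x => f x i j : R^o).
  by move=> a x y; rewrite linearP !mxE.
pose gM := GRing.isLinear.Build _ _ _ _ _ lf.
pose g : {linear V -> R^o} := HB.pack (fun x => f x i j) gM.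
have cg : continuous (g : V -> R).
  move=> x; apply: (@continuous_comp _ _ _ f (fun M : 'M[R]_(p, q) => M i j)).
    exact: cf.
  exact: coord_continuous.
exact: (linear_C1 (f := (g : {linear V -> R}))).
Qed.

End ScalarC1.

Section Coordinates.
Context {R : realType} {n : nat}.
Local Notation phase := (phase R n).

Lemma C1_rV (i : 'I_n) : C1 (fun x : 'rV[R]_n => x ord0 i).
Proof.
by apply: (@C1_coord _ _ _ _ (@idfun 'rV[R]_n)) => x; exact: cvg_id.
Qed.

Lemma C1_fst (i : 'I_n) : C1 (fun z : phase => z.1 ord0 i).
Proof.
by apply: (@C1_coord _ _ _ _ (@fst 'rV[R]_n 'M[R]_n)) => x; exact: cvg_fst.
Qed.

Lemma C1_snd (i j : 'I_n) : C1 (fun z : phase => z.2 i j).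
Proof.
by apply: (@C1_coord _ _ _ _ (@snd 'rV[R]_n 'M[R]_n)) => x; exact: cvg_snd.
Qed.

End Coordinates.

(** * A C1 cutoff *)

Section SquaredRamp.
Context {R : realType}.
Implicit Types s : R.

Definition ramp s : R := Num.max 0 s.
(** Test fields need only be C1, and the squared positive part is a simple C1 function that vanishes
    on a half-line and is positive beyond it, with the explicit derivative [2 * ramp s]. *)
Definition sqramp s : R := ramp s ^+ 2.

Lemma ramp_pos s : 0 <= s -> ramp s = s. Proof. by move=> h; apply/max_idPr. Qed.

Lemma ramp_neg s : s <= 0 -> ramp s = 0. Proof. by move=> h; apply/max_idPl. Qed.

Lemma sqramp_ge0 s : 0 <= sqramp s. Proof. exact: sqr_ge0. Qed.

Lemma sqramp_gt0 s : (0 < sqramp s) = (0 < s).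
Proof.
rewrite /sqramp; case: (leP s 0) => s0; first by rewrite ramp_neg// expr0n ltxx.
by rewrite ramp_pos ?exprn_gt0// ltW.
Qed.

Lemma ramp_continuous : continuous ramp.
Proof.
by move=> x; apply: continuous_max; [exact: cvg_cst|exact: cvg_id].
Qed.

Lemma is_derive_sqramp s : is_derive s 1 sqramp (2 * ramp s).
Proof.
have [s0|s0|->] := ltgtP s 0.
- rewrite (ramp_neg (ltW s0)) mulr0; apply: (@near_eq_is_derive _ _ _ (cst 0)).
  + near=> t; rewrite /sqramp ramp_neg ?expr0n//; apply: ltW.
    by near: t; exact: lt_nbhsl.
- rewrite (ramp_pos (ltW s0)).
  apply: (@near_eq_is_derive _ R R (fun t : R => (t ^+ 2 : R))).
  + near=> t; rewrite /sqramp ramp_pos//; apply: ltW.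
    by near: t; exact: lt_nbhsr.
  + by apply: is_derive_eq; rewrite /GRing.scale/= ?mulr1 ?expr1 mulr_natl.
- rewrite ramp_neg// mulr0.
  have h : h^-1 *: (sqramp (h *: 1 + 0) - sqramp 0) @[h --> 0^'] --> (0 : R).
    apply/cvgrPdist_le => e e0; near=> h.
    rewrite sub0r normrN /sqramp addr0 [ramp 0]ramp_neg// expr0n subr0.
    rewrite /GRing.scale/= mulr1 normrM normfV.
    have h0 : 0 < `|h| by rewrite normr_gt0; near: h; exact: nbhs_dnbhs_neq.
    have he : `|h| <= e.
      near: h; apply: nbhs_dnbhs; apply/nbhs_ballP; exists e => //= x.
      by rewrite /ball/= sub0r normrN => /ltW.
    rewrite mulrC ler_pdivrMr// normrX.
    apply: (@le_trans _ _ (`|h| ^+ 2)); last by rewrite expr2 ler_pM2r.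
    rewrite lerXn2r ?nnegrE// /ramp.
    by case: (leP 0 h) => h1; rewrite ?(ger0_norm h1)// normr0.
  by apply: DeriveDef; [apply: cvgP h|exact: cvg_lim h].
Unshelve. all: by end_near. Qed.

Lemma C1_sqramp {V : normedModType R} (f : V -> R) : C1 f ->
  C1 (fun x => sqramp (f x)) /\
  forall v x, 'D_v (fun x => sqramp (f x)) x = 2 * ramp (f x) * 'D_v f x.
Proof.
move=> hf; apply: (C1_compR is_derive_sqramp _ hf).
by move=> x; apply: cvgM; [exact: cvg_cst|exact: ramp_continuous].
Qed.

End SquaredRamp.

Lemma continuous_sumR (R : realType) (T : topologicalType) (I : Type)
    (s : seq I) (F : I -> T -> R) : (forall i, continuous (F i)) ->
  continuous (fun x => \sum_(i <- s) F i x).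
Proof.
move=> cF; elim: s => [|i s IH].
  have -> : (fun x => \sum_(i <- [::]) F i x) = cst 0.
    by apply/funext => x; rewrite big_nil.
  by move=> x; exact: cvg_cst.
have -> : (fun x => \sum_(j <- i :: s) F j x) =
    fun x => F i x + \sum_(j <- s) F j x.
  by apply/funext => x; rewrite big_cons.
by move=> x; apply: cvgD; [exact: cF|exact: IH].
Qed.

(** * The Euclidean scalar product, gradients and derivatives along lines *)

Section Dot.
Context {R : realType} {n : nat}.
Implicit Types (u v w : 'rV[R]_n) (P : 'M[R]_n).

Lemma dotC v w : dot v w = dot w v.
Proof. by apply: eq_bigr => i _; rewrite mulrC. Qed.

Lemma dotDl u v w : dot (u + v) w = dot u w + dot v w.
Proof.
by rewrite /dot -big_split; apply: eq_bigr => i _; rewrite mxE mulrDl.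
Qed.

Lemma dotZl (a : R) v w : dot (a *: v) w = a * dot v w.
Proof.
by rewrite /dot mulr_sumr; apply: eq_bigr => i _; rewrite mxE mulrA.
Qed.

Lemma dotDr u v w : dot w (u + v) = dot w u + dot w v.
Proof. by rewrite dotC dotDl !(dotC w). Qed.

Lemma dotZr (a : R) v w : dot w (a *: v) = a * dot w v.
Proof. by rewrite dotC dotZl (dotC w). Qed.

Lemma dotNl v w : dot (- v) w = - dot v w.
Proof. by rewrite -scaleN1r dotZl mulN1r. Qed.

Lemma dotBl u v w : dot (u - v) w = dot u w - dot v w.
Proof. by rewrite dotDl dotNl. Qed.

Lemma dotBr u v w : dot w (u - v) = dot w u - dot w v.
Proof. by rewrite dotC dotBl !(dotC w). Qed.

Lemma dot0l v : dot 0 v = 0.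
Proof. by rewrite -(scale0r 0) dotZl mul0r. Qed.

Lemma dot_ge0 v : 0 <= dot v v.
Proof. by apply: sumr_ge0 => i _; rewrite -expr2 sqr_ge0. Qed.

Lemma sqr_coord_le_dot v i : v ord0 i ^+ 2 <= dot v v.
Proof.
rewrite /dot (bigD1 i)//= -expr2 lerDl; apply: sumr_ge0 => j _.
by rewrite -expr2 sqr_ge0.
Qed.

Lemma dot_eq0 v : dot v v = 0 -> v = 0.
Proof.
move=> h; apply/rowP => i; rewrite mxE; apply/eqP; rewrite -sqrf_eq0.
by rewrite eq_le sqr_ge0 -h sqr_coord_le_dot.
Qed.

Lemma dot_gt0 v : v != 0 -> 0 < dot v v.
Proof.
by move=> v0; rewrite lt_def dot_ge0 andbT; apply: contra v0 => /eqP/dot_eq0 ->.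
Qed.

Lemma dotmx v w : v *m w^T = (dot v w)%:M.
Proof.
apply/matrixP => i j; rewrite !ord1 !mxE eqxx mulr1n.
by apply: eq_bigr => k _; rewrite mxE.
Qed.

Lemma dot_mulmx v w P : dot (v *m P) w = dot v (w *m P^T).
Proof.
have := dotmx (v *m P) w; have := dotmx v (w *m P^T).
rewrite trmx_mul trmxK mulmxA => -> /matrixP/(_ ord0 ord0).
by rewrite !mxE eqxx !mulr1n => ->.
Qed.

Lemma norm_le_coord v (a : R) : 0 <= a -> (forall i, `|v ord0 i| <= a) ->
  `|v| <= a.
Proof.
move=> a0 h; rewrite [leLHS]/Num.norm/= mx_normrE.
by apply: bigmax_le => // -[i j] _; rewrite ord1.
Qed.

Lemma norm_le_dot v (a : R) : 0 <= a -> dot v v <= a ^+ 2 -> `|v| <= a.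
Proof.
move=> a0 h; apply: norm_le_coord => // i.
rewrite -(ler_pXn2r (n := 2%N))// ?nnegrE// real_normK ?num_real//.
exact: le_trans (sqr_coord_le_dot v i) h.
Qed.

Lemma dot_continuous_comp (T : topologicalType) (f g : T -> 'rV[R]_n) :
  continuous f -> continuous g -> continuous (fun x => dot (f x) (g x)).
Proof.
move=> cf cg; apply: continuous_sumR => i x.
apply: cvgM; apply: (@continuous_comp _ _ _ _ (fun u : 'rV[R]_n => u ord0 i)).
- exact: cf.
- exact: coord_continuous.
- exact: cg.
- exact: coord_continuous.
Qed.

End Dot.

Section Gradient.
Context {R : realType} {n : nat}.
Implicit Types (f : 'rV[R]_n -> R) (x v w : 'rV[R]_n).

Definition grad f x : 'rV[R]_n := \row_i 'D_(delta_mx 0 i) f x.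

Lemma grad_dot f x w : C1 f -> 'D_w f x = dot (grad f x) w.
Proof.
move=> [df _]; rewrite [in LHS](row_sum_delta w) deriveE// linear_sum.
apply: eq_bigr => i _; rewrite linearZ /= -deriveE// mxE mulrC.
by [].
Qed.

Lemma grad_continuous f : C1 f -> continuous (grad f).
Proof.
move=> [_ cf] x; have FF : Filter (nbhs x) by exact: nbhs_filter.
apply/(@cvgrPdist_le _ 'rV[R]_n _ (nbhs x) FF) => /= eps e0.
have : \forall y \near x, forall i, `|'D_(delta_mx 0 i) f x
    - 'D_(delta_mx 0 i) f y| <= eps.
  apply: (@filter_forall _ _ (fun i y => `|'D_(delta_mx 0 i) f x
    - 'D_(delta_mx 0 i) f y| <= eps) (nbhs x) _) => i.
  have /cvgrPdist_le := cf (delta_mx 0 i) x.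
  exact.
apply: filterS => y h; apply: norm_le_coord => [|i]; first exact: ltW.
by rewrite !mxE; exact: h.
Qed.

Lemma derive_gt0_near f x v : C1 f -> f x = 0 -> 0 < 'D_v f x ->
  \forall t \near (0 : R)^'+, 0 < f (x + t *: v).
Proof.
move=> [df _] fx0 D0.
have /cvg_dnbhs_at_right/cvgrPdist_lt/(_ _ D0) h := diff_derivable (df x) (v := v).
near=> t.
have t0 : 0 < t by [].
have : `|'D_v f x - t^-1 *: (f (t *: v + x) - f x)| < 'D_v f x by near: t.
rewrite fx0 subr0 ltr_norml => /andP[_]; rewrite gtrBl /GRing.scale/=.
by rewrite pmulr_rgt0 ?invr_gt0// addrC.
Unshelve. all: by end_near. Qed.

End Gradient.

Lemma near_line {R : realType} {V : normedModType R} (x v : V) (P : V -> Prop) :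
  (\forall y \near x, P y) -> \forall t \near (0 : R), P (x + t *: v).
Proof.
move=> h; have : x + t *: v @[t --> (0 : R)] --> x + 0 *: v.
  by apply: cvgD; [exact: cvg_cst|exact: cvgZr_tmp].
by rewrite scale0r addr0 => /(_ _ h).
Qed.

Lemma is_derive_line {R : realType} {V : normedModType R} (x v : V) (t : R) :
  is_derive t 1 (fun s : R => x + s *: v) v.
Proof.
have h : is_derive t 1 (fun s : R => s *: v) v.
  apply: DeriveDef; first by apply: diff_derivable; exact: differentiableZl.
  rewrite deriveE; last exact: differentiableZl.
  by rewrite diffZl//= diff_val scale1r.
by apply: is_derive_eq (is_deriveD (is_derive_cst x t 1) h) _; rewrite add0r.
Qed.

Lemma is_derive_curve {R : realType} {V W : normedModType R} (f : V -> W)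
    (c : R -> V) (t : R) (w : V) :
  is_derive t 1 c w -> differentiable f (c t) ->
  is_derive t 1 (fun s => f (c s)) ('D_w f (c t)).
Proof.
move=> dc df.
have dcc : differentiable c t by apply/derivable1_diffP; case: dc.
have dfc : differentiable (f \o c) t by exact: differentiable_comp.
apply: DeriveDef; first exact: (diff_derivable dfc).
rewrite (deriveE _ dfc) diff_comp//= -(deriveE (1 : R) dcc).
by rewrite (@derive_val _ _ _ _ _ _ _ dc) -deriveE.
Qed.

(** The difference quotient along w is constant. Several derivatives below are read off in this way
    from affine behaviour on a line, without product or chain rule. *)
Lemma derive_along {R : realType} {V : normedModType R} (f : V -> R)
    (z w : V) (c : R) : (forall t, f (z + t *: w) = f z + t * c) ->
  'D_w f z = c.
Proof.
move=> h; rewrite /derive; apply: cvg_lim => //; apply: cvg_near_cst.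
near=> t; have t0 : t != 0 by near: t; exact: nbhs_dnbhs_neq.
by rewrite /= [_ + z]addrC h addrAC subrr add0r /GRing.scale/= mulKf.
Unshelve. all: by end_near. Qed.

(** * Charts of the boundary and the inner normal *)

Section Chart.
Context {R : realType} {n : nat}.
Variables (Omega : set 'rV[R]_n) (f : 'rV[R]_n -> R) (e : 'rV[R]_n).
Hypotheses (oO : open Omega) (hf : C1 f)
  (fe : forall z s, f (z + s *: e) = f z + s).
Implicit Types x y v w : 'rV[R]_n.

(** It is used with f normalised to have slope exactly 1 along e, the height over the boundary
    graph. The gradient then never vanishes, and subtracting [f z *: e] moves z onto the zero
    set. *)
Definition region_above (g : 'rV[R]_n -> R) x :=
  \forall y \near x, Omega y <-> 0 < g y.

Lemma region_above_near x : region_above f x ->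
  \forall y \near x, region_above f y.
Proof. by move=> h; exact: (near_join h). Qed.

Lemma derive_chart x : 'D_e f x = 1.
Proof.
by apply: derive_along => t; rewrite fe mulr1.
Qed.

Lemma grad_neq0 x : grad f x != 0.
Proof.
apply/eqP => g0; have := derive_chart x; rewrite grad_dot// g0 dot0l.
by move/eqP; rewrite eq_sym oner_eq0.
Qed.

Lemma closure_chart x : region_above f x -> closure Omega x -> 0 <= f x.
Proof.
move=> hx cx; rewrite leNgt; apply/negP => f0.
have cf : {for x, continuous f} by exact: (C1_continuous hf).
have : \forall y \near x, ~ Omega y.
  near=> y; have -> : Omega y <-> 0 < f y by near: y.
  apply/negP; rewrite -leNgt ltW//; near: y.
  exact: (cf _ (lt_nbhsl f0)).
by move/cx => -[y []].
Unshelve. all: by end_near. Qed.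

Lemma frontier_chart x : region_above f x -> (frontier Omega x <-> f x = 0).
Proof.
move=> hx; have Ox : Omega x <-> 0 < f x by exact: (nbhs_singleton hx).
split=> [[cx]|fx0].
  move/interior_id: oO => -> nO; apply/eqP; rewrite eq_le closure_chart// andbT.
  by rewrite leNgt; apply/negP => /Ox.
split; last by move/interior_id: oO => ->; rewrite Ox fx0 ltxx.
move=> U Ux.
have : \forall t \near (0 : R), U (x + t *: e) /\
    (Omega (x + t *: e) <-> 0 < f (x + t *: e)).
  by apply: (near_line e (P := fun y => U y /\ (Omega y <-> 0 < f y))); near=> y; split; near: y.
move=> /nbhs_ballP[d/= d0 H]; exists (x + (d / 2) *: e).
have [|Ud Od] := H (d / 2).
  rewrite /ball/= sub0r normrN gtr0_norm ?divr_gt0//; lra.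
split=> //; apply/Od; rewrite fe fx0 add0r; lra.
Unshelve. all: by end_near. Qed.

Lemma tangent_chart x w : region_above f x -> f x = 0 ->
  tangent (frontier Omega) x w <-> 'D_w f x = 0.
Proof.
move=> hx fx0; have df := hf.1; split.
  move=> [c [c0 nc dc]].
  have := is_derive_curve dc; rewrite c0 => /(_ _ f (df x)) dfc.
  have [_ <-] := dfc.
  rewrite (@near_eq_derive _ _ _ _ (cst 0)) ?derive_cst//.
  have : c s @[s --> (0 : R)] --> c 0.
    by apply: differentiable_continuous; apply/derivable1_diffP; case: dc.
  rewrite c0 => /(_ _ (region_above_near hx)) cc.
  near=> t; apply/frontier_chart; first by near: t.
  by near: t.
(* Lowering the straight line along e by its height keeps the curve on the zero set; the correction
   has derivative ['D_w f x *: e], which is 0. *)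
move=> Dw; pose c (t : R) := x + t *: w - f (x + t *: w) *: e.
have dfl : is_derive (0 : R) 1 (fun t : R => f (x + t *: w)) 0.
  have := is_derive_curve (is_derive_line x w 0) (df _).
  by rewrite scale0r addr0 Dw.
have dfe : is_derive (0 : R) 1 (fun t : R => f (x + t *: w) *: e) 0.
  have d1 : differentiable (fun t : R => f (x + t *: w)) 0.
    by apply/derivable1_diffP; case: dfl.
  apply: DeriveDef; first by apply: diff_derivable; exact: differentiableZl.
  rewrite deriveE; last exact: differentiableZl.
  rewrite diffZl//= -(deriveE (1 : R) d1).
  by rewrite (@derive_val _ _ _ _ _ _ _ dfl) scale0r.
have dc : is_derive (0 : R) 1 c w.
  apply: is_derive_eq (is_deriveB (is_derive_line x w 0) dfe) _.
  by rewrite subr0.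
have c0 : c 0 = x by rewrite /c scale0r addr0 fx0 scale0r subr0.
exists c; split => //.
have : c s @[s --> (0 : R)] --> c 0.
  by apply: differentiable_continuous; apply/derivable1_diffP; case: dc.
rewrite c0 => /(_ _ (region_above_near hx)) cc.
near=> t; apply/frontier_chart; first by near: t.
by rewrite /c -scaleNr fe subrr.
Unshelve. all: by end_near. Qed.

Definition normal_chart x : 'rV[R]_n :=
  (Num.sqrt (dot (grad f x) (grad f x)))^-1 *: grad f x.

(** Orthogonality to the tangent vectors forces a normal to be a multiple of the gradient, unit
    length leaves two signs, and pointing into Omega excludes the negative one. *)
Lemma inner_normal_chart x : region_above f x -> f x = 0 ->
  inner_normal Omega x = normal_chart x.
Proof.
move=> hx fx0; set N := grad f x; have N0 : 0 < dot N N.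
  by apply: dot_gt0; exact: grad_neq0.
set k := (Num.sqrt (dot N N))^-1.
have k0 : 0 < k by rewrite invr_gt0 sqrtr_gt0.
have kN : k ^+ 2 * dot N N = 1.
  by rewrite exprVn sqr_sqrtr ?(ltW N0)// mulVf// gt_eqF.
have Onear v : \forall t \near (0 : R)^'+,
    Omega (x + t *: v) <-> 0 < f (x + t *: v).
  apply: cvg_within.
  exact: (near_line v (P := fun y => Omega y <-> 0 < f y)).
have norm_k : is_inner_normal Omega x (k *: N).
  split; first by rewrite dotZl dotZr mulrA -expr2.
    by move=> w /(tangent_chart w hx fx0); rewrite grad_dot// dotZl => ->; rewrite mulr0.
  have /(derive_gt0_near hf fx0) : 0 < 'D_(k *: N) f x.
    by rewrite grad_dot// dotZr mulr_gt0.
  by move=> h; near=> t; have -> : Omega (x + t *: (k *: N)) <->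
    0 < f (x + t *: (k *: N)); near: t.
suff uniq v : is_inner_normal Omega x v -> v = k *: N.
  apply: uniq; rewrite /inner_normal; exact: (xgetI _ norm_k).
move=> [vv tv Ov]; pose l := dot v N / dot N N.
have NN : dot N N != 0 by rewrite gt_eqF.
have vl : v = l *: N.
  pose w := v - l *: N.
  have Nw : dot N w = 0.
    by rewrite dotBr dotZr (dotC N v) /l mulfVK// subrr.
  have vw : dot v w = 0.
    by apply: tv; apply/(tangent_chart w hx fx0); rewrite grad_dot.
  apply/eqP; rewrite -subr_eq0; apply/eqP; apply: dot_eq0.
  by rewrite -/w {1}/w dotBl dotZl vw Nw mulr0 subrr.
have ll : l ^+ 2 * dot N N = 1.
  by rewrite -vv [in RHS]vl dotZl dotZr mulrA expr2.
have : l ^+ 2 == k ^+ 2.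
  by apply/eqP; apply: (mulIf NN); rewrite ll kN.
rewrite eqf_sqr => /orP[/eqP lk|/eqP lk]; first by rewrite vl lk.
have D0 : 0 < 'D_(- v) f x.
  by rewrite grad_dot// vl lk -scaleNr opprK dotZr mulr_gt0.
have : \forall t \near (0 : R)^'+, 0 < - f (x + t *: v).
  apply: (derive_gt0_near (C1N hf)); first by rewrite fx0 oppr0.
  rewrite deriveN; last by apply: diff_derivable; exact: hf.1.
  by move: D0; rewrite !grad_dot// dotC dotNl dotC.
move=> f_neg.
have [t [Ot ft Otf]] : exists t, [/\ Omega (x + t *: v), 0 < - f (x + t *: v) &
    (Omega (x + t *: v) <-> 0 < f (x + t *: v))].
  apply: (@filter_ex _ (0 : R)^'+); near=> t; split; near: t => //.
by exfalso; move/Otf: Ot; lra.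
Unshelve. all: by end_near. Qed.

End Chart.

(** * Continuity of matrix operations and compactness of the Grassmannian *)

Section Continuity.
Context {R : realType} {n : nat}.

Lemma cvg_mx (T : topologicalType) p q (x : T) (F : T -> 'M[R]_(p, q))
    (M : 'M[R]_(p, q)) :
  (forall i j, F y i j @[y --> x] --> M i j) -> F y @[y --> x] --> M.
Proof.
move=> cF; have FF : Filter (nbhs x) by exact: nbhs_filter.
apply/(@cvgrPdist_le _ 'M[R]_(p, q) _ (nbhs x) FF) => /= eps e0.
have : \forall y \near x, forall ij : 'I_p * 'I_q,
    `|M ij.1 ij.2 - F y ij.1 ij.2| <= eps.
  apply: filter_forall => -[i j] /=.
  by have /cvgrPdist_le := cF i j; exact.
apply: filterS => y h; rewrite [leLHS]/Num.norm/= mx_normrE.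
by apply: bigmax_le => [|ij _]; [exact: ltW|rewrite !mxE; exact: h].
Qed.

Lemma coord_comp_continuous (T : topologicalType) p q (F : T -> 'M[R]_(p, q))
    i j : continuous F -> continuous (fun x => F x i j).
Proof.
move=> cF x; apply: (@continuous_comp _ _ _ F (fun M : 'M[R]_(p, q) => M i j)).
  exact: cF.
exact: coord_continuous.
Qed.

Lemma mulmx_continuous (T : topologicalType) p q r (F : T -> 'M[R]_(p, q))
    (G : T -> 'M[R]_(q, r)) : continuous F -> continuous G ->
  continuous (fun x => F x *m G x).
Proof.
move=> cF cG x; apply: cvg_mx => i j; rewrite mxE.
under eq_cvg do rewrite mxE.
apply: (continuous_sumR (F := fun k y => F y i k * G y k j)) => k y.
by apply: cvgM; exact: coord_comp_continuous.
Qed.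

Lemma cst_continuousT (T U : topologicalType) (a : U) :
  continuous (fun _ : T => a).
Proof. by move=> x; exact: cvg_cst. Qed.

Lemma closed_eq_fun (T : topologicalType) (V : normedModType R) (f g : T -> V) :
  continuous f -> continuous g -> closed [set x | f x = g x].
Proof.
move=> cf cg; have -> : [set x | f x = g x] = (fun x => `|f x - g x|) @^-1` [set 0].
  by apply/seteqP; split => x /=; [move->; rewrite subrr normr0
    |move/eqP; rewrite normr_eq0 subr_eq0 => /eqP].
apply: preimage_closed; last exact: closed_eq.
by move=> x _; apply: cvg_norm; apply: cvgB; [exact: cf|exact: cg].
Qed.

Lemma preim_open (T U : topologicalType) (f : T -> U) (A : set U) :
  continuous f -> open A -> open (f @^-1` A).
Proof. by move=> /continuousP cf oA; exact: cf. Qed.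

Lemma frontier_closed (T : topologicalType) (A : set T) : closed (frontier A).
Proof.
apply: closedI; first exact: closed_closure.
by rewrite closedC; exact: open_interior.
Qed.

End Continuity.

Section GrassCompact.
Context {R : realType} {n : nat}.

(** Write P = C W with C of full column rank and W of full row rank. Idempotence gives W C = 1, of
    size the rank, and C W has the same trace as W C. *)
Lemma mxtrace_idem (P : 'M[R]_n) : P *m P = P -> \tr P = (\rank P)%:R.
Proof.
move=> PP; rewrite -[in LHS](mulmx_base P) mxtrace_mulC.
suff -> : row_base P *m col_base P = 1%:M by rewrite mxtrace1.
have /row_freeP[K hK] := row_base_free P.
have /row_fullP[L hL] := col_base_full P.
have := mulmx_base P; move: hK hL PP.
move: (col_base P) (row_base P) K L => C W K L hK hL PP CW.
have : L *m ((C *m W) *m (C *m W)) *m K = L *m (C *m W) *m K by rewrite CW PP.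
by rewrite !mulmxA hL !mul1mx -!mulmxA hK mulmx1.
Qed.

(** The rank is not continuous but the trace is; this form shows that the Grassmannian is closed. *)
Lemma GrassE m : Grass m =
  [set P : 'M[R]_n | P^T = P] `&` [set P | P *m P = P] `&` [set P | \tr P = m%:R].
Proof.
apply/seteqP; split => P /=; first by move=> [h1 h2 h3]; rewrite mxtrace_idem// h3.
move=> [[h1 h2] h3]; split => //; apply/eqP.
by rewrite -(eqr_nat R) -mxtrace_idem// h3.
Qed.

Lemma Grass_closed m : closed (@Grass R n m).
Proof.
have ci : continuous (@id 'M[R]_n) by move=> x; exact: cvg_id.
rewrite GrassE; apply: closedI; first apply: closedI.
- apply: closed_eq_fun ci => x.
  apply: (@cvg_mx _ _ _ _ x (fun P => P^T) x^T) => i j; rewrite mxE.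
  by under eq_cvg do rewrite mxE; exact: coord_continuous.
- by apply: closed_eq_fun => //; exact: mulmx_continuous.
- apply: closed_eq_fun; last exact: cst_continuousT.
  by apply: continuous_sumR => i; exact: coord_continuous.
Qed.

(** As P is symmetric and idempotent, [P i i] is the squared length of row i. It dominates every
    [P i j ^+ 2], in particular its own square, hence is at most 1. *)
Lemma Grass_le1 m P (i j : 'I_n) : @Grass R n m P -> `|P i j| <= 1.
Proof.
move=> [Ps PP _]; have hij : P i j ^+ 2 <= P i i.
  rewrite -[in leRHS]PP mxE (bigD1 j)//= -[in X in _ <= P i j * X + _]Ps mxE.
  rewrite -expr2 lerDl; apply: sumr_ge0 => k _.
  by rewrite -[in X in _ * X]Ps mxE -expr2 sqr_ge0.
have hii : P i i ^+ 2 <= P i i.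
  rewrite -[in leRHS]PP mxE (bigD1 i)//= -expr2 lerDl; apply: sumr_ge0 => k _.
  by rewrite -[in X in _ * X]Ps mxE -expr2 sqr_ge0.
have : P i i <= 1 by nra.
move=> h; rewrite -(@ler_pXn2r _ 2)// ?nnegrE// real_normK ?num_real// expr1n.
exact: le_trans hij h.
Qed.

Lemma Grass_compact m : compact (@Grass R n m).
Proof.
pose B : set 'rV[R]_(n * n) := [set v | forall k, [set` `[(-1 : R), 1]] (v ord0 k)].
have cB : compact B by apply: (@rV_compact _ _ (fun=> [set` `[(-1 : R), 1]])) => i; exact: segment_compact.
apply: (@subclosed_compact _ _ (vec_mx @` B)); first exact: Grass_closed.
  apply: continuous_compact => //; apply: continuous_subspaceT => x.
  apply: cvg_mx => i j; rewrite mxE; under eq_cvg do rewrite mxE.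
  exact: coord_continuous.
move=> P hP; exists (mxvec P); last exact: mxvecK.
move=> k; case/mxvec_indexP: k => i j; rewrite mxvecE /= in_itv/=.
by rewrite -ler_norml (Grass_le1 _ _ hP).
Qed.

Lemma bounded_closure_compact (A : set 'rV[R]_n) : bounded_set A ->
  compact (closure A).
Proof.
move=> [M [Mr hM]]; apply: bounded_closed_compact; last exact: closed_closure.
exists M; split => // N MN x cx /=.
have cN : closed [set y : 'rV[R]_n | `|y| <= N].
  apply: (preimage_closed (D := [set r | r <= N]) (f := fun y : 'rV[R]_n => `|y|)).
    by move=> y _; exact: norm_continuous.
  exact: closed_le.
by apply: cN; apply: closure_subset cx => y Ay; exact: hM.
Qed.

End GrassCompact.

(** * Conormal pairs *)

Section OrthProj.
Context {R : realType} {n : nat}.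

(** [proj_mx] fixes its first space once the two spaces meet trivially, and a vector of U orthogonal
    to U has square 0. *)
Lemma orth_proj_id (U : 'M[R]_n) (v : 'rV[R]_n) : (v <= U)%MS ->
  v *m orth_proj U = v.
Proof.
move=> vU; apply: proj_mx_id => //; apply/eqP/rowV0P => w.
rewrite sub_capmx => /andP[/submxP[a ->] /sub_kermxP h].
apply: dot_eq0; rewrite dot_mulmx; have := dotmx a (a *m U *m U^T).
by rewrite h trmx0 mulmx0 => /matrixP/(_ ord0 ord0); rewrite !mxE eqxx.
Qed.

Lemma wedge_id (v : 'rV[R]_n) Q : v *m wedge v Q = v.
Proof. by apply: orth_proj_id; exact: addsmxSl. Qed.

End OrthProj.

Section DomainChart.
Context {R : realType} {n : nat}.
Variable Omega : set 'rV[R]_n.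

Definition is_chart (f : 'rV[R]_n -> R) (e : 'rV[R]_n) :=
  C1 f /\ forall z s, f (z + s *: e) = f z + s.

Lemma C1_comp_linear (f : 'rV[R]_n -> R) (L : {linear 'rV[R]_n -> 'rV[R]_n}) :
  continuous L -> C1 f -> C1 (fun y => f (L y)).
Proof.
move=> cL [df cf]; have dL x : differentiable L x by exact: linear_differentiable.
have dfL x : differentiable (f \o L) x by exact: differentiable_comp.
split=> [x|v]; first exact: dfL.
have -> : 'D_v (fun y => f (L y)) = fun x => 'D_(L v) f (L x).
  apply/funext => x; rewrite (deriveE _ (dfL x)) diff_comp//= diff_lin//.
  by rewrite -deriveE.
move=> x; apply: (@continuous_comp _ _ _ L ('D_(L v) f)); first exact: cL.
exact: cf.
Qed.

(** f is the height of y along e minus g at the projection of y to the orthogonal complement of e;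
    the matrix [M] of this projection kills e, whence the slope 1. *)
Lemma C2_chart x : C2_boundary Omega -> frontier Omega x ->
  exists f e, is_chart f e /\ region_above Omega f x.
Proof.
move=> hO /hO[e [g [ee [hg _] hx]]].
pose M : 'M[R]_n := 1%:M - e^T *m e.
have ME y : y *m M = y - dot y e *: e.
  by rewrite mulmxBr mulmx1 mulmxA dotmx mul_scalar_mx.
exists (fun y => dot y e - g (y *m M)), e; split; first split.
- apply: C1B.
    by apply: C1_sum => i; exact: (C1M (C1_rV i) (C1_cst (e ord0 i))).
  apply: (C1_comp_linear (L := mulmxr M)) => //.
  by apply: mulmx_continuous; [move=> y; exact: cvg_id|exact: cst_continuousT].
- move=> z s; rewrite !ME !dotDl dotZl ee mulr1 scalerDl.
  by rewrite opprD addrACA subrr addr0 addrAC.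
- by apply: filterS hx => y; rewrite ME subr_gt0.
Qed.

(** The boundary integral evaluates test fields only at such pairs, because the span of nu and Q
    contains nu. *)
Definition conormal : set (phase R n) :=
  [set z | frontier Omega z.1 /\
           inner_normal Omega z.1 *m z.2 = inner_normal Omega z.1].

Hypothesis oO : open Omega.
Hypothesis bO : C2_boundary Omega.

Lemma frontier_normal f e x : is_chart f e -> region_above Omega f x ->
  frontier Omega x ->
  f x = 0 /\ exists2 k, 0 < k & inner_normal Omega x = k *: grad f x.
Proof.
move=> [hf hfe] hx /(frontier_chart oO hf hfe hx) fx0; split=> //.
exists (Num.sqrt (dot (grad f x) (grad f x)))^-1.
  by rewrite invr_gt0 sqrtr_gt0 dot_gt0//; exact: (grad_neq0 hf hfe).
exact: inner_normal_chart.
Qed.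

(** [inner_normal] is picked pointwise, whereas the gradient of a chart is continuous around x.
    Expressed through the gradient, conormality is visibly stable under limits. *)
Lemma conormal_grad f e z : is_chart f e -> region_above Omega f z.1 ->
  conormal z -> f z.1 = 0 /\ grad f z.1 *m z.2 = grad f z.1.
Proof.
move=> cf hz [Sz]; have [fz [k k0 ->]] := frontier_normal cf hz Sz.
by rewrite -scalemxAl => /(scalerI (lt0r_neq0 k0)) ->.
Qed.

Lemma grad_conormal f e z : is_chart f e -> region_above Omega f z.1 ->
  f z.1 = 0 -> grad f z.1 *m z.2 = grad f z.1 -> conormal z.
Proof.
move=> cf hz fz h; have Sz : frontier Omega z.1.
  by apply/(frontier_chart oO cf.1 cf.2 hz).
split=> //; have [_ [k k0 ->]] := frontier_normal cf hz Sz.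
by rewrite -scalemxAl h.
Qed.

Lemma near_fst (T U : topologicalType) (z : T * U) (P : T -> Prop) :
  (\forall x \near z.1, P x) -> \forall y \near z, P y.1.
Proof. by move=> h; exact: (@cvg_fst T U (nbhs z.1) (nbhs z.2) _ P h). Qed.

Lemma near_snd (T U : topologicalType) (z : T * U) (P : U -> Prop) :
  (\forall x \near z.2, P x) -> \forall y \near z, P y.2.
Proof. by move=> h; exact: (@cvg_snd T U (nbhs z.1) (nbhs z.2) _ P h). Qed.

Lemma fst_continuous (T U : topologicalType) :
  continuous (fun z : T * U => z.1).
Proof. by move=> z; exact: cvg_fst. Qed.

Lemma snd_continuous (T U : topologicalType) :
  continuous (fun z : T * U => z.2).
Proof. by move=> z; exact: cvg_snd. Qed.

Lemma open_neq (T : topologicalType) (V : normedModType R) (f g : T -> V) :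
  continuous f -> continuous g -> open [set x | f x <> g x].
Proof. by move=> cf cg; apply: closed_openC; exact: closed_eq_fun. Qed.

Lemma closed_near (T : topologicalType) (A : set T) :
  (forall x, ~ A x -> \forall y \near x, ~ A y) -> closed A.
Proof. by move=> h; rewrite -openC openE => x /h. Qed.

Lemma grad_mul_near f e (z : phase R n) : is_chart f e ->
  grad f z.1 *m z.2 <> grad f z.1 ->
  \forall y \near z, grad f y.1 *m y.2 <> grad f y.1.
Proof.
move=> [hf _]; have cg : continuous (fun z : phase R n => grad f z.1).
  move=> y; apply: (@continuous_comp _ _ _ fst (grad f)); first exact: fst_continuous.
  exact: grad_continuous.
have : open [set y : phase R n | grad f y.1 *m y.2 <> grad f y.1].
  apply: (open_neq (f := fun z : phase R n => grad f z.1 *m z.2)) => //.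
  by apply: mulmx_continuous => //; exact: snd_continuous.
by rewrite openE; apply.
Qed.

Lemma conormal_closed : closed conormal.
Proof.
apply: closed_near => z nz; have [Sz|nSz] := pselect (frontier Omega z.1).
  have [f [e [cf hx]]] := C2_chart bO Sz.
  have [fz _] := frontier_normal cf hx Sz.
  have : grad f z.1 *m z.2 <> grad f z.1.
    by move=> h; apply: nz; exact: (grad_conormal cf hx fz h).
  move=> /(grad_mul_near cf); apply: filterS2 (near_fst (region_above_near hx)).
  by move=> y hy hn /(conormal_grad cf hy)[].
have /closed_openC := @frontier_closed _ Omega; rewrite openE => /(_ _ nSz).
by move=> h; apply: filterS (near_fst h) => y /= nS [].
Qed.

Lemma GT_closed k : closed (GT (frontier Omega) k).
Proof.
apply: closed_near => z nz; have [Sz|nSz] := pselect (frontier Omega z.1); last first.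
  have /closed_openC := @frontier_closed _ Omega; rewrite openE => /(_ _ nSz).
  by move=> h; apply: filterS (near_fst h) => y /= nS [].
have [Gz|nGz] := pselect (@Grass R n k z.2); last first.
  have /closed_openC := @Grass_closed R n k; rewrite openE => /(_ _ nGz).
  by move=> /near_snd; apply: filterS => y nG [].
have [f [e [cf hx]]] := C2_chart bO Sz.
have [fz _] := frontier_normal cf hx Sz.
(* The vectors of the plane are the products u Q with u free. A failure of tangency is witnessed by
   one u, which is kept fixed while (x, Q) varies; the resulting condition is open. *)
have [u hu] : exists u, dot (grad f z.1) (u *m z.2) <> 0.
  apply/not_existsP => h; apply: nz; split=> // w /submxP[u ->].
  by apply/(tangent_chart oO cf.1 cf.2 _ hx fz); rewrite grad_dot//; [exact: contrapT|exact: cf.1].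
have : open [set y : phase R n | dot (grad f y.1) (u *m y.2) <> 0].
  apply: (open_neq (V := R)); last exact: cst_continuousT.
  apply: dot_continuous_comp.
    move=> y; apply: (@continuous_comp _ _ _ fst (grad f)); first exact: fst_continuous.
    exact: (grad_continuous cf.1).
  by apply: mulmx_continuous; [exact: cst_continuousT|exact: snd_continuous].
rewrite openE => /(_ _ hu); apply: filterS2 (near_fst (region_above_near hx)).
move=> y hy hn [Sy _ ty]; apply: hn; rewrite -grad_dot; last exact: cf.1.
have [fy _] := frontier_normal cf hy Sy.
by apply/(tangent_chart oO cf.1 cf.2 _ hy fy); apply: ty; exact: submxMl.
Qed.

End DomainChart.

(** * Measurability on the phase space and scalar test functions *)

Section PhaseMeasure.
Context {R : realType} {n : nat}.
Local Notation phase := (phase R n).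
Local Notation bphase := (borel_phase R n).

Lemma open_measurable_phase (A : set phase) : open A ->
  measurable (A : set bphase).
Proof. by move=> oA; exact: sub_gen_smallest. Qed.

Lemma closed_measurable_phase (A : set phase) : closed A ->
  measurable (A : set bphase).
Proof.
by move=> /closed_openC/open_measurable_phase; rewrite -[in X in _ -> X](setCK A); exact: measurableC.
Qed.

Lemma continuous_measurable_phase (f : phase -> R) : continuous f ->
  measurable_fun [set: bphase] (f : bphase -> R).
Proof.
move=> /continuousP cf; apply: (measurability _ (RGenOpens.measurableE R)).
move=> _ [_ [a [b ->] <-]]; rewrite setTI.
by apply: open_measurable_phase; apply: cf; exact: interval_open.
Qed.

Lemma continuous_compact_bounded (T : topologicalType) (A : set T) (f : T -> R) :
  compact A -> continuous f -> exists2 M, 0 <= M & forall x, A x -> `|f x| <= M.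
Proof.
move=> cA cf; have : compact (f @` A).
  by apply: continuous_compact => //; exact: continuous_subspaceT.
move/compact_bounded => [M [Mr hM]]; exists (`|M| + 1).
  by rewrite addr_ge0.
move=> x Ax; apply: (hM (`|M| + 1)); last by exists x.
by rewrite ltr_pwDr// ler_norm.
Qed.

Lemma derive_pair0 (psi : phase -> R) (u : 'rV[R]_n) (z : phase) : C1 psi ->
  'D_((u, 0) : phase) psi z = \sum_j u ord0 j * 'D_((delta_mx 0 j, 0) : phase) psi z.
Proof.
move=> [dpsi _]; have -> : ((u, 0) : phase) =
    \sum_j u ord0 j *: ((delta_mx 0 j, 0) : phase).
  rewrite [in LHS](row_sum_delta u).
  have lp : linear (fun v : 'rV[R]_n => ((v, 0) : phase)).
    by move=> a x y; rewrite -[RHS]/((a *: x + y, a *: 0 + 0) : phase) scaler0 addr0.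
  pose pM := GRing.isLinear.Build _ _ _ _ _ lp.
  pose p : {linear 'rV[R]_n -> phase} := HB.pack (fun v => ((v, 0) : phase)) pM.
  rewrite -[LHS]/(p _) linear_sum; apply: eq_bigr => j _.
  by rewrite linearZ.
rewrite (deriveE _ (dpsi z)) linear_sum; apply: eq_bigr => j _.
by rewrite linearZ/= -deriveE.
Qed.

Lemma Dx_term_scale (psi : phase -> R) (w : 'rV[R]_n) (z : phase) : C1 psi ->
  Dx_term (fun z => psi z *: w) z = 'D_((w *m z.2, 0) : phase) psi z.
Proof.
move=> hpsi; have [_ E] := C1_scalel w hpsi.
rewrite derive_pair0// /Dx_term exchange_big; apply: eq_bigr => j _.
rewrite mxE mulr_suml; apply: eq_bigr => i _; rewrite E mxE.
by rewrite /=; ring.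
Qed.

Lemma Dx_continuous (psi : phase -> R) (w : 'rV[R]_n) : C1 psi ->
  continuous (fun z : phase => 'D_((w *m z.2, 0) : phase) psi z).
Proof.
move=> hpsi; under eq_fun do rewrite derive_pair0//.
apply: continuous_sumR => j z; apply: cvgM; last exact: hpsi.2.
apply: (coord_comp_continuous (F := fun z : phase => w *m z.2)).
by apply: mulmx_continuous; [exact: cst_continuousT|exact: snd_continuous].
Qed.

Definition curv_term (B : curvature R n) (psi : phase -> R) (w : 'rV[R]_n)
    (z : phase) : R :=
  DP_term B (fun z => psi z *: w) z + dot (tr_curv B z) (psi z *: w).

Lemma coef_le_norm B i j k (z : phase) : `|coef B i j k z| <= norm_curv B z.
Proof.
rewrite -[leLHS]sqrtr_sqr /norm_curv; apply: ler_wsqrtr.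
rewrite (bigD1 i)//= (bigD1 j)//= (bigD1 k)//= -!addrA lerDl.
by rewrite !addr_ge0// ?sumr_ge0// => *; rewrite ?sumr_ge0// => *; rewrite ?sumr_ge0// => *; exact: sqr_ge0.
Qed.

Lemma curv_termE B psi w z : C1 psi -> curv_term B psi w z =
  \sum_i \sum_j \sum_k ('D_((0, delta_mx k j) : phase) psi z * w ord0 i) * coef B i j k z
  + \sum_i \sum_k (psi z * w ord0 k) * coef B i i k z.
Proof.
move=> hpsi; have [_ E] := C1_scalel w hpsi; congr (_ + _).
  do 3 (apply: eq_bigr => ? _); by rewrite E mxE.
rewrite dotZr /dot mulr_sumr exchange_big; apply: eq_bigr => k _.
rewrite /tr_curv summxE mulr_suml mulr_sumr; apply: eq_bigr => i _.
by rewrite /coef mulrA mulrC mulrA mulrAC (mulrC (psi z)); ring.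
Qed.

(** The constant depends on the field and the compact set only. Its independence of B makes the
    later smallness uniform over varifolds. *)
Lemma curv_term_bound (A : set phase) psi w : compact A -> C1 psi ->
  exists2 C, 0 <= C & forall B z, A z ->
    `|curv_term B psi w z| <= C * norm_curv B z.
Proof.
move=> cA hpsi.
have h1 (i : 'I_n) (j : 'I_n) (k : 'I_n) : {M | 0 <= M &
    forall z, A z -> `|'D_((0, delta_mx k j) : phase) psi z * w ord0 i| <= M}.
  apply: cid2; apply: continuous_compact_bounded => // z.
  by apply: cvgM; [exact: hpsi.2|exact: cvg_cst].
have h2 (k : 'I_n) : {M | 0 <= M & forall z, A z -> `|psi z * w ord0 k| <= M}.
  apply: cid2; apply: continuous_compact_bounded => // z.
  by apply: cvgM; [exact: C1_continuous|exact: cvg_cst].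
exists (\sum_i \sum_j \sum_k s2val (h1 i j k) + \sum_(i < n) \sum_k s2val (h2 k)).
  apply: addr_ge0; apply: sumr_ge0 => i _; apply: sumr_ge0 => j _.
    by apply: sumr_ge0 => k _; exact: (s2valP (h1 i j k)).
  exact: (s2valP (h2 j)).
move=> B z Az; rewrite curv_termE//; apply: (le_trans (ler_normD _ _)).
rewrite mulrDl !mulr_suml; apply: lerD.
  apply: (le_trans (ler_norm_sum _ _ _)); apply: ler_sum => i _.
  rewrite mulr_suml; apply: (le_trans (ler_norm_sum _ _ _)); apply: ler_sum => j _.
  rewrite mulr_suml; apply: (le_trans (ler_norm_sum _ _ _)); apply: ler_sum => k _.
  by rewrite normrM ler_pM//; [exact: (s2valP' (h1 i j k))|exact: coef_le_norm].
apply: (le_trans (ler_norm_sum _ _ _)); apply: ler_sum => i _.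
apply: (le_trans (ler_norm_sum _ _ _)); apply: ler_sum => k _.
by rewrite normrM ler_pM//; [exact: (s2valP' (h2 k))|exact: coef_le_norm].
Qed.

End PhaseMeasure.

(** * Curvature varifolds and their first variation *)

(** Nested three times, it bounds the Hilbert-Schmidt norm of B by the sum of the absolute values of
    its coefficients, so that the norm is integrable. *)
Lemma sum_le_sqr_sum {R : realType} (I : Type) (s : seq I) (f g : I -> R) :
  (forall i, f i <= g i ^+ 2) -> (forall i, 0 <= g i) ->
  \sum_(i <- s) f i <= (\sum_(i <- s) g i) ^+ 2.
Proof.
move=> fg g0; elim: s => [|i s IH]; first by rewrite !big_nil expr0n.
rewrite !big_cons; have := fg i; have := g0 i.
have : 0 <= \sum_(j <- s) g j by apply: sumr_ge0.
by nra.
Qed.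

Section CurvatureVarifold.
Context {R : realType} {n m : nat}.
Variable Omega : set 'rV[R]_n.
Hypothesis bO : bounded_set Omega.
Local Notation phase := (phase R n).
Local Notation bphase := (borel_phase R n).

Definition support : set phase := closure Omega `*` Grass m.

Lemma support_compact : compact support.
Proof.
by apply: compact_setX; [exact: bounded_closure_compact|exact: Grass_compact].
Qed.

Lemma support_closed : closed support.
Proof.
apply: compact_closed support_compact; exact: norm_hausdorff.
Qed.

Lemma support_measurable : measurable (support : set bphase).
Proof. exact: (closed_measurable_phase support_closed). Qed.

Variables (V : {measure set bphase -> \bar R}) (B : curvature R n)
  (Gamma : {measure set bphase -> \bar R}).
Hypothesis H : CV_perp Omega m V B Gamma.

Lemma mass_support : mass V = V support.
Proof.
have [_ V0 _ _ _] := H; have mK := support_measurable.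
rewrite /mass -(setUv (support : set bphase)) measureU//; last exact: setICr.
  by rewrite -[RHS]adde0; congr (_ + _)%E; exact: V0.
exact: measurableC.
Qed.

Lemma mass_fin : (mass V < +oo)%E.
Proof. by rewrite mass_support; case: H => -[_ h] _ _ _ _; exact: h support_compact. Qed.

Lemma continuous_integrable (f : phase -> R) : continuous f ->
  V.-integrable (support : set bphase) (EFin \o f).
Proof.
move=> cf; apply: measurable_bounded_integrable; first exact: support_measurable.
- by rewrite -mass_support mass_fin.
- apply: measurable_funTS; exact: continuous_measurable_phase.
have [M M0 hM] := continuous_compact_bounded support_compact cf.
by exists M; split; [exact: num_real|move=> x Mx y Ky; exact: le_trans (hM _ Ky) (ltW Mx)].
Qed.

Lemma coef_measurable i j k : measurable_fun [set: bphase] (coef B i j k : bphase -> R).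
Proof.
have [_ _ /(_ i j k)/measurable_int hB _ _] := H.
exact/measurable_EFinP.
Qed.

Lemma norm_curv_measurable : measurable_fun [set: bphase] (norm_curv B : bphase -> R).
Proof.
apply: (measurableT_comp (f := @Num.sqrt R)).
  by apply: continuous_measurable_fun; exact: sqrt_continuous.
apply: measurable_sum => i; apply: measurable_sum => j; apply: measurable_sum => k.
by apply: measurable_funX; exact: coef_measurable.
Qed.

Lemma norm_curv_ge0 z : 0 <= norm_curv B z.
Proof. exact: sqrtr_ge0. Qed.

Lemma norm_curv_integrable : V.-integrable (support : set bphase) (EFin \o norm_curv B).
Proof.
have [_ _ hB _ _] := H; have mK := support_measurable.
pose h (z : bphase) := \sum_i \sum_j \sum_k `|coef B i j k z|.
apply: (@le_integrable _ _ _ V _ mK _ (EFin \o h)).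
- by apply: measurable_funTS; apply/measurable_EFinP; exact: norm_curv_measurable.
- move=> z _ /=; rewrite lee_fin ger0_norm ?norm_curv_ge0//.
  have h0 : 0 <= h z by do 3 (apply: sumr_ge0 => ? _).
  rewrite ger0_norm// /norm_curv -[leRHS](ger0_norm h0) -sqrtr_sqr.
  apply: ler_wsqrtr; apply: sum_le_sqr_sum => i; last first.
    by do 2 (apply: sumr_ge0 => ? _).
  apply: sum_le_sqr_sum => j; last by apply: sumr_ge0 => ? _.
  by apply: sum_le_sqr_sum => k //; rewrite real_normK ?num_real.
- have -> : EFin \o h = fun z => (\sum_i \sum_j \sum_k `|coef B i j k z|%:E)%E.
    apply/funext => z; rewrite /= /h -sumEFin; apply: eq_bigr => i _.
    rewrite -sumEFin; apply: eq_bigr => j _; by rewrite -sumEFin.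
  apply: integrable_sum => // i _; apply: integrable_sum => // j _.
  apply: integrable_sum => // k _.
  apply: (integrableS measurableT) => //.
  have := integrable_abse (hB i j k); apply: eq_integrable => //.
Qed.

Lemma curv_term_measurable psi w : C1 psi ->
  measurable_fun [set: bphase] (curv_term B psi w : bphase -> R).
Proof.
move=> hpsi.
rewrite (_ : curv_term B psi w = fun z =>
  \sum_i \sum_j \sum_k ('D_((0, delta_mx k j) : phase) psi z * w ord0 i) * coef B i j k z
  + \sum_i \sum_k (psi z * w ord0 k) * coef B i i k z); last first.
  by apply/funext => z; exact: curv_termE.
apply: measurable_funD.
  apply: measurable_sum => i; apply: measurable_sum => j; apply: measurable_sum => k.
  apply: measurable_funM; last exact: coef_measurable.
  apply: continuous_measurable_phase => z.
  by apply: cvgM; [exact: hpsi.2|exact: cvg_cst].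
apply: measurable_sum => i; apply: measurable_sum => k.
apply: measurable_funM; last exact: coef_measurable.
apply: continuous_measurable_phase => z.
by apply: cvgM; [exact: C1_continuous|exact: cvg_cst].
Qed.

Lemma curv_term_integrable psi w : C1 psi ->
  V.-integrable (support : set bphase) (EFin \o curv_term B psi w).
Proof.
move=> hpsi; have mK := support_measurable.
have [C C0 hC] := curv_term_bound w support_compact hpsi.
apply: (@le_integrable _ _ _ V _ mK _ (fun z => C%:E * (norm_curv B z)%:E)%E).
- by apply: measurable_funTS; apply/measurable_EFinP; exact: curv_term_measurable.
- move=> z Kz /=; rewrite lee_fin (le_trans (hC B z Kz))//.
  by rewrite ger0_norm// mulr_ge0// norm_curv_ge0.
- by apply: integrableZl => //; exact: norm_curv_integrable.
Qed.

Definition total_curv : R := \int[V]_(z in (support : set bphase)) norm_curv B z.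

Lemma total_curv_ge0 : 0 <= total_curv.
Proof. by apply: Rintegral_ge0 => z _; exact: norm_curv_ge0. Qed.

(** The boundary integral stays in the extended reals: its finiteness is a consequence of the
    identity, not an assumption. *)
Lemma first_variation (psi : phase -> R) (w : 'rV[R]_n) : C1 psi ->
  (\int[Gamma]_(z in (GT (frontier Omega) m.-1 : set bphase))
     (psi (z.1, wedge (inner_normal Omega z.1) z.2) *
      dot (inner_normal Omega z.1) w)%:E =
  (- (\int[V]_(z in (support : set bphase)) curv_term B psi w z +
   \int[V]_(z in (support : set bphase)) 'D_((w *m z.2, 0) : phase) psi z))%:E)%E.
Proof.
move=> hpsi; have [hV V0 _ _ /(_ _ (C1_scalel w hpsi).1)] := H.
have mK := support_measurable.
have i1 := curv_term_integrable w hpsi.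
have i2 := continuous_integrable (Dx_continuous (w := w) hpsi).
(* The defining identity integrates over all x. V has no mass off the compact support, so the domain
   may be shrunk to it; there continuous functions are bounded. *)
set G := (setT `*` Grass m : set bphase).
have mG : measurable G.
  apply: closed_measurable_phase.
  have -> : (G : set phase) = snd @^-1` (@Grass R n m).
    by apply/seteqP; split => z //= -[].
  apply: preimage_closed; last exact: Grass_closed.
  by move=> z _; exact: snd_continuous.
have GK : G `\` ~` support = (support : set bphase).
  apply/seteqP; split => z /=; first by move=> [_ /contrapT].
  by move=> Kz; split=> [|]; [split=> //; case: Kz|exact].
pose F (z : bphase) := curv_term B psi w z + 'D_((w *m z.2, 0) : phase) psi z.
have mF : measurable_fun setT F.
  apply: measurable_funD; first exact: curv_term_measurable.
  by apply: continuous_measurable_phase; exact: Dx_continuous.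
have iF : V.-integrable (support : set bphase) (EFin \o F).
  have := integrableD mK i1 i2; exact.
have iFG : V.-integrable G (EFin \o F).
  have := @negligible_integrable _ _ _ V G (~` support : set bphase) (EFin \o F).
  rewrite GK; move=> -> //; first exact: measurableC.
  by apply: measurable_funTS; exact/measurable_EFinP.
rewrite (eq_integral (EFin \o F)); last first.
  by move=> z _; rewrite /= Dx_term_scale.
rewrite (@negligible_integral _ _ _ V _ (~` support : set bphase))//; last exact: measurableC.
rewrite GK => E; rewrite -RintegralD//.
have -> : (\int[Gamma]_(z in (GT (frontier Omega) m.-1 : set bphase))
     (psi (z.1, wedge (inner_normal Omega z.1) z.2) *
      dot (inner_normal Omega z.1) w)%:E =
    - \int[V]_(z in (support : set bphase)) (EFin \o F) z)%E.
  rewrite E oppeK; apply: eq_integral => z _; by rewrite dotZr.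
rewrite EFinN; congr (- _)%E.
by rewrite /Rintegral fineK//; exact: integrable_fin_num.
Qed.

End CurvatureVarifold.

(** * Null sets and vanishing integrals *)

Section Vanishing.
Context {R : realType} {n m : nat}.
Variable Omega : set 'rV[R]_n.
Hypothesis bO : bounded_set Omega.
Local Notation phase := (phase R n).
Local Notation bphase := (borel_phase R n).

Lemma first_variation_bound (psi : phase -> R) (w : 'rV[R]_n) : C1 psi ->
  (forall z : phase, conormal Omega z ->
     psi z * dot (inner_normal Omega z.1) w = 0) ->
  exists2 C, 0 <= C & forall V B Gamma, CV_perp Omega m V B Gamma ->
    `|\int[V]_(z in (@support R n m Omega : set bphase))
        'D_((w *m z.2, 0) : phase) psi z| <= C * @total_curv R n m Omega V B.
Proof.
move=> hpsi h0; have cK := @support_compact R n m Omega bO.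
have [C C0 hC] := curv_term_bound w cK hpsi.
exists C => // V B Gamma H; have := first_variation bO H w hpsi.
have mK := @support_measurable R n m Omega bO.
rewrite integral0_eq; last first.
  move=> z [Sz _ _]; congr (_%:E).
  (* The pair formed by x and the span of nu and Q is conormal, so the boundary integrand is 0 at
     every point. *)
  by rewrite (h0 (z.1, _))//; split=> //=; exact: wedge_id.
move=> [/eqP]; rewrite eq_sym oppr_eq0 addrC addr_eq0 => /eqP ->; rewrite normrN.
have i1 := curv_term_integrable bO H w hpsi.
have i2 := norm_curv_integrable bO H.
apply: (le_trans (le_normr_Rintegral mK i1)).
rewrite /total_curv -RintegralZl//; apply: le_Rintegral => //.
- exact: (integrable_norm i1).
- by have := integrableZl mK C i2; exact.
- by move=> z /hC.
Qed.

End Vanishing.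

(** The open sets with property P, directed by inclusion thanks to stability under unions, define a
    filter of tails. Compactness in its near-covering form, applied to this filter, produces a
    single set that covers A. *)
Lemma compact_open_induction (T : topologicalType) (A : set T)
    (P : set T -> Prop) : compact A -> P set0 ->
  (forall U W, open U -> open W -> P U -> P W -> P (U `|` W)) ->
  (forall x, A x -> exists U, [/\ open U, U x & P U]) ->
  exists U, [/\ open U, A `<=` U & P U].
Proof.
move=> /compact_near_coveringP cA P0 PU hA.
pose F (S : set (set T)) := exists N, [/\ open N, P N &
  forall N', open N' -> P N' -> N `<=` N' -> S N'].
have FF : Filter F.
  split.
  - by exists set0; split => //; exact: open0.
  - move=> S1 S2 [N1 [oN1 pN1 h1]] [N2 [oN2 pN2 h2]]; exists (N1 `|` N2); split.
    + exact: openU.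
    + exact: PU.
    + move=> N' oN' pN' sN'; split.
        by apply: h1 => // x Nx; apply: sN'; left.
      by apply: h2 => // x Nx; apply: sN'; right.
  - by move=> S1 S2 S12 [N [oN pN h]]; exists N; split => // N' *; apply/S12/h.
have [] := cA (set T) F (fun N x => N x) FF.
  move=> x /hA[U [oU Ux pU]].
  exists (U, [set N | U `<=` N]); last by move=> [y N] /= [Uy]; exact.
  by split => /=; [move: oU; rewrite openE; exact|exists U].
by move=> N [oN pN h]; exists N; split => //; exact: (h N).
Qed.

Section NullSets.
Context {R : realType} {n m : nat}.
Variable Omega : set 'rV[R]_n.
Hypothesis bO : bounded_set Omega.
Local Notation phase := (phase R n).
Local Notation bphase := (borel_phase R n).
Local Notation K := (@support R n m Omega).

Definition almost_flat (delta : R) (V : {measure set bphase -> \bar R})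
    (B : curvature R n) (Gamma : {measure set bphase -> \bar R}) :=
  [/\ CV_perp Omega m V B Gamma, mass V = 1%E
    & @total_curv R n m Omega V B <= delta].

Definition null (A : set phase) := forall eps, 0 < eps ->
  exists2 delta, 0 < delta & forall V B Gamma, almost_flat delta V B Gamma ->
    (V A <= eps%:E)%E.

(** The counterpart of [null] for integrands, and the form in which the first variation delivers
    information; [vanishing_null_at] and [null_vanishing] translate between the two. *)
Definition vanishing (f : phase -> R) := forall eps, 0 < eps ->
  exists2 delta, 0 < delta & forall V B Gamma, almost_flat delta V B Gamma ->
    `|\int[V]_(z in (K : set bphase)) f z| <= eps.

Definition null_at z := exists U : set phase, [/\ open U, U z & null U].

Lemma almost_flatW d1 d2 V B Gamma : d1 <= d2 -> almost_flat d1 V B Gamma ->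
  almost_flat d2 V B Gamma.
Proof. by move=> d12 [? ? h]; split=> //; exact: le_trans h d12. Qed.

Lemma null_sub (A A' : set phase) : measurable (A : set bphase) ->
  measurable (A' : set bphase) -> A `<=` A' -> null A' -> null A.
Proof.
move=> mA mA' AA' hA' eps /hA'[d d0 h]; exists d => // V B Gamma /h.
by apply: le_trans; apply: le_measure => //; rewrite inE.
Qed.

Lemma null0 : null set0.
Proof. by move=> eps e0; exists 1 => // V B Gamma _; rewrite measure0 lee_fin ltW. Qed.

Lemma nullU (A A' : set phase) : measurable (A : set bphase) ->
  measurable (A' : set bphase) -> null A -> null A' -> null (A `|` A').
Proof.
move=> mA mA' hA hA' eps e0; have e2 : 0 < eps / 2 by rewrite divr_gt0.
have [d d0 h] := hA _ e2; have [d' d0' h'] := hA' _ e2.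
exists (Num.min d d'); first by rewrite lt_min d0.
move=> V B Gamma f; apply: (le_trans (measureU2 V mA mA')).
rewrite [eps]splitr EFinD; apply: leeD.
  by apply: (h V B Gamma); apply: almost_flatW f; rewrite ge_min lexx.
by apply: (h' V B Gamma); apply: almost_flatW f; rewrite ge_min lexx orbT.
Qed.

Lemma null_compact (A : set phase) : compact A -> measurable (A : set bphase) ->
  (forall z, A z -> null_at z) -> null A.
Proof.
move=> cA mA hA; have [|U [oU AU nU]] := compact_open_induction cA null0 _ hA.
  by move=> U W oU oW; apply: nullU; exact: open_measurable_phase.
by apply: null_sub nU => //; exact: open_measurable_phase.
Qed.

Lemma first_variation_vanishing (psi : phase -> R) (w : 'rV[R]_n) : C1 psi ->
  (forall z, conormal Omega z -> psi z * dot (inner_normal Omega z.1) w = 0) ->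
  vanishing (fun z => 'D_((w *m z.2, 0) : phase) psi z).
Proof.
move=> hpsi h0 eps e0.
have [C C0 hC] := first_variation_bound (m := m) bO hpsi h0.
have C1 : 0 < C + 1 by rewrite ltr_pwDr.
exists (eps / (C + 1)); first exact: divr_gt0.
move=> V B Gamma [H _ hd]; apply: (le_trans (hC V B Gamma H)).
apply: (@le_trans _ _ ((C + 1) * (eps / (C + 1)))); last first.
  by rewrite mulrC divfK ?gt_eqF.
apply: ler_pM => //; first exact: total_curv_ge0.
by rewrite lerDl.
Qed.

Lemma vanishingD (f g : phase -> R) : continuous f -> continuous g ->
  vanishing f -> vanishing g -> vanishing (fun z => f z + g z).
Proof.
move=> cf cg hf hg eps e0; have e2 : 0 < eps / 2 by rewrite divr_gt0.
have [d d0 h] := hf _ e2; have [d' d0' h'] := hg _ e2.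
exists (Num.min d d'); first by rewrite lt_min d0.
move=> V B Gamma fl; have [H _ _] := fl.
rewrite RintegralD; last 3 first.
- exact: support_measurable.
- exact: (continuous_integrable bO H cf).
- exact: (continuous_integrable bO H cg).
apply: (le_trans (ler_normD _ _)); rewrite [eps]splitr; apply: lerD.
  by apply: (h V B Gamma); apply: almost_flatW fl; rewrite ge_min lexx.
by apply: (h' V B Gamma); apply: almost_flatW fl; rewrite ge_min lexx orbT.
Qed.

Lemma measure_supportI V B Gamma (A : set bphase) : CV_perp Omega m V B Gamma ->
  measurable A -> V A = V (A `&` K).
Proof.
move=> [_ V0 _ _ _] mA; have mK := @support_measurable R n m Omega bO.
have := measureDI V mA (mK : measurable (K : set bphase)).
move=> ->; rewrite -[RHS]add0e; congr (_ + _)%E.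
apply/eqP; rewrite eq_le measure_ge0 andbT.
rewrite -[leRHS]V0; apply: le_measure; rewrite ?inE.
- exact: measurableD.
- exact: (measurableC mK).
- by move=> z [].
Qed.

(** Chebyshev's inequality on the open set where f exceeds half its value at z0. *)
Lemma vanishing_null_at (f : phase -> R) z0 : continuous f ->
  (forall z, K z -> 0 <= f z) -> vanishing f -> 0 < f z0 -> null_at z0.
Proof.
move=> cf f0 vf fz; pose c := f z0 / 2; have c0 : 0 < c by rewrite divr_gt0.
pose U : set phase := f @^-1` [set r | c < r].
have oU : open U by apply: preim_open => //; exact: open_gt.
exists U; split=> //; first by rewrite /U/= /c; lra.
move=> eps e0; have ce : 0 < c * eps by rewrite mulr_gt0.
have [d d0 h] := vf _ ce; exists d => // V B Gamma fl.
have [H _ _] := fl; have mU := open_measurable_phase oU.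
have mK := @support_measurable R n m Omega bO.
have mUK : measurable ((U `&` K) : set bphase) by exact: measurableI.
rewrite (measure_supportI H mU).
have cfi := continuous_integrable bO H cf.
rewrite -(@lee_pmul2l _ c%:E)// -(integral_cst V mUK c%:E) -EFinM.
apply: (@le_trans _ _ (\int[V]_(z in (K : set bphase)) (f z)%:E)%E).
  apply: (@le_trans _ _ (\int[V]_(z in ((U `&` K) : set bphase)) (f z)%:E)%E).
    apply: ge0_le_integral => //.
    - by move=> z _; rewrite lee_fin ltW.
    - apply/measurable_EFinP; apply: measurable_funTS.
      exact: continuous_measurable_phase.
    - by move=> z [/ltW + _]; rewrite lee_fin.
  apply: ge0_subset_integral => //.
  apply/measurable_EFinP; apply: measurable_funTS.
  exact: continuous_measurable_phase.
rewrite -(fineK (integrable_fin_num mK cfi)) lee_fin.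
by apply: le_trans (h V B Gamma fl); rewrite ler_norm.
Qed.

(** Where |f| is at most [eps / 2] the unit mass contributes at most [eps / 2]; the rest of the
    support lies in a null set, and there f is bounded by compactness. *)
Lemma null_vanishing (f : phase -> R) : continuous f ->
  (forall eta, 0 < eta -> exists A : set phase, [/\ measurable (A : set bphase),
     null A & forall z, K z -> eta < `|f z| -> A z]) -> vanishing f.
Proof.
move=> cf hf eps e0; have e2 : 0 < eps / 2 by rewrite divr_gt0.
have [A [mA nA hA]] := hf _ e2.
have [M M0 hM] := continuous_compact_bounded (@support_compact R n m Omega bO) cf.
have M1 : 0 < M + 1 by rewrite ltr_pwDr.
have [d d0 h] := nA (eps / 2 / (M + 1)) (divr_gt0 e2 M1).
exists d => // V B Gamma fl; have [H V1 _] := fl.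
have mK := @support_measurable R n m Omega bO.
have cfi := continuous_integrable bO H cf.
rewrite -lee_fin EFin_normr_Rintegral//.
have mf : measurable_fun (K : set bphase) (fun z => (f z)%:E).
  apply/measurable_EFinP; apply: measurable_funTS.
  exact: continuous_measurable_phase.
apply: (le_trans (le_abse_integral V mK mf)).
apply: (@le_trans _ _ (\int[V]_(z in (K : set bphase))
    ((eps / 2)%:E + (M + 1)%:E * (\1_A z)%:E))%E).
  apply: ge0_le_integral => //.
  - exact: measurableT_comp.
  - apply: emeasurable_funD => //; apply: measurable_funeM.
    by apply/measurable_EFinP; exact: measurable_indic.
  - move=> z Kz; rewrite -EFinM -EFinD lee_fin.
    have [lt|le] := ltP (eps / 2) `|f z|.
      rewrite indicE mem_set ?mulr1; last exact: hA.
      by apply: le_trans (hM _ Kz) _; lra.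
    by apply: le_trans le _; rewrite lerDl mulr_ge0// ltW.
rewrite ge0_integralD//; last 3 first.
- by move=> z _; rewrite lee_fin ltW.
- by move=> z _; rewrite -EFinM lee_fin mulr_ge0// ltW.
- apply: measurable_funeM.
  by apply/measurable_EFinP; exact: measurable_indic.
rewrite integral_cst// ge0_integralZl_EFin//; last 2 first.
- by apply/measurable_EFinP; exact: measurable_indic.
- exact: ltW.
rewrite integral_indic// -(mass_support bO H) V1 mule1.
rewrite [leRHS](_ : _ = (eps / 2)%:E + (eps / 2)%:E)%E; last first.
  by rewrite -EFinD -splitr.
apply: leeD => //.
apply: (@le_trans _ _ ((M + 1)%:E * (eps / 2 / (M + 1))%:E)%E).
  apply: lee_wpmul2l; first by rewrite lee_fin ltW.
  apply: le_trans (h V B Gamma fl); apply: le_measure; rewrite ?inE//.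
  exact: measurableI.
by rewrite -EFinM mulrC divfK// gt_eqF.
Qed.

End NullSets.

(** * Transport of non-null points along a plane *)

Section Bump.
Context {R : realType}.
Implicit Types (a e s : R).

(** Second differences: [tent] is the hat of height e on [-e, e], and [step] climbs from 0 to
    [2 * e ^+ 2] across [-e, e] with derivative twice the hat. The derivative of [bump] is
    therefore, up to the factor 2, a hat at 0 minus a hat at a, which compares the mass at both
    ends. *)
Definition tent e s : R := ramp (s + e) - 2 * ramp s + ramp (s - e).
Definition step e s : R := sqramp (s + e) - 2 * sqramp s + sqramp (s - e).
Definition bump e a s : R := step e s - step e (s - a).

Lemma tent_ge0 e s : 0 <= e -> 0 <= tent e s.
Proof.
move=> e0; rewrite /tent /ramp.
case: (leP 0 (s + e)); case: (leP 0 s); case: (leP 0 (s - e)); lra.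
Qed.

Lemma tent_out e s : 0 <= e -> e <= `|s| -> tent e s = 0.
Proof.
move=> e0; rewrite /tent; case: (leP 0 s) => s0.
  by rewrite ger0_norm// => h; rewrite !ramp_pos; lra.
by rewrite ltr0_norm// => h; rewrite !ramp_neg; lra.
Qed.

Lemma tent0 e : 0 <= e -> tent e 0 = e.
Proof.
move=> e0; rewrite /tent (@ramp_pos _ (0 + e)) ?ramp_neg; lra.
Qed.

Lemma tent_continuous e : continuous (tent e).
Proof.
move=> s; apply: cvgD; first apply: cvgB.
- apply: (@continuous_comp _ _ _ (fun s => s + e) ramp); last exact: ramp_continuous.
  by apply: cvgD; [exact: cvg_id|exact: cvg_cst].
- by apply: cvgM; [exact: cvg_cst|exact: ramp_continuous].
- apply: (@continuous_comp _ _ _ (fun s => s - e) ramp); last exact: ramp_continuous.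
  by apply: cvgB; [exact: cvg_id|exact: cvg_cst].
Qed.

Lemma bump_out e a s : 0 <= e -> 0 <= a -> s <= - e \/ a + e <= s ->
  bump e a s = 0.
Proof.
move=> e0 a0; rewrite /bump /step /sqramp => -[h|h].
  rewrite !ramp_neg; lra.
by rewrite !ramp_pos; lra.
Qed.

Lemma C1_step e {V : normedModType R} (f : V -> R) : C1 f ->
  C1 (fun x => step e (f x)) /\
  forall v x, 'D_v (fun x => step e (f x)) x = 2 * tent e (f x) * 'D_v f x.
Proof.
move=> hf; have [df _] := hf.
have [h1 d1] := C1_sqramp (C1D hf (C1_cst e)).
have [h2 d2] := C1_sqramp hf.
have [h3 d3] := C1_sqramp (C1B hf (C1_cst e)).
split; first exact: (C1D (C1B h1 (C1M (C1_cst 2) h2)) h3).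
move=> v x; rewrite /step.
have dd (g : V -> R) : C1 g -> derivable g x v.
  by case=> dg _; exact: diff_derivable.
rewrite (deriveD (dd _ (C1B h1 (C1M (C1_cst 2) h2))) (dd _ h3)).
rewrite (deriveB (dd _ h1) (dd _ (C1M (C1_cst 2) h2))).
rewrite (deriveM (dd _ (C1_cst 2)) (dd _ h2)) derive_cst d1 d2 d3.
rewrite (deriveD (dd _ hf) (dd _ (C1_cst e))) derive_cst.
rewrite (deriveB (dd _ hf) (dd _ (C1_cst e))) derive_cst.
by rewrite /tent /GRing.scale/=; ring.
Qed.

Lemma C1_bump e a {V : normedModType R} (f : V -> R) : C1 f ->
  C1 (fun x => bump e a (f x)) /\
  forall v x, 'D_v (fun x => bump e a (f x)) x =
    2 * (tent e (f x) - tent e (f x - a)) * 'D_v f x.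
Proof.
move=> hf; have [df _] := hf.
have [h1 d1] := C1_step e hf.
have [h2 d2] := C1_step e (C1B hf (C1_cst a)).
split; first exact: (C1B h1 h2).
have dd (g : V -> R) : C1 g -> forall v x, derivable g x v.
  by case=> dg _ v x; exact: diff_derivable.
move=> v x; rewrite /bump (deriveB (dd _ h1 _ _) (dd _ h2 _ _)) d1 d2.
rewrite (deriveB (dd _ hf _ _) (dd _ (C1_cst a) _ _)) derive_cst; ring.
Qed.

End Bump.

Section Transport.
Context {R : realType} {n m : nat}.
Variable Omega : set 'rV[R]_n.
Hypothesis bO : bounded_set Omega.
Local Notation phase := (phase R n).
Local Notation bphase := (borel_phase R n).
Local Notation K := (@support R n m Omega).

Variables (x0 v : 'rV[R]_n) (P0 : 'M[R]_n).

(** Coordinates adapted to a varying plane P: u is v projected to P, s and y are N times the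
    coordinate of x - x0 along u and its part orthogonal to u, and q is the squared distance of P
    from P0. Multiplying by N, the squared length of u, keeps everything polynomial, hence C1 even
    where u = 0. *)
Let u (z : phase) : 'rV[R]_n := v *m z.2.
Let N (z : phase) : R := dot (u z) (u z).
Let s (z : phase) : R := dot (z.1 - x0) (u z).
Let y (z : phase) : 'rV[R]_n := N z *: (z.1 - x0) - s z *: u z.
Let q (z : phase) : R := \sum_i \sum_j (z.2 i j - P0 i j) ^+ 2.

Let C1u i : C1 (fun z => u z ord0 i).
Proof.
rewrite (_ : (fun z => _) = fun z : phase => \sum_j v ord0 j * z.2 j i); last first.
  by apply/funext => z; rewrite mxE.
by apply: C1_sum => j; exact: (C1M (C1_cst _) (C1_snd _ _)).
Qed.

Let C1x i : C1 (fun z : phase => (z.1 - x0) ord0 i).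
Proof.
rewrite (_ : (fun z => _) = fun z : phase => z.1 ord0 i - x0 ord0 i); last first.
  by apply/funext => z; rewrite !mxE.
exact: (C1B (C1_fst i) (C1_cst _)).
Qed.

Let C1N' : C1 N.
Proof. by apply: C1_sum => i; exact: (C1M (C1u i) (C1u i)). Qed.

Let C1s : C1 s.
Proof. by apply: C1_sum => i; exact: (C1M (C1x i) (C1u i)). Qed.

Let C1y i : C1 (fun z => y z ord0 i).
Proof.
rewrite (_ : (fun z => _) = fun z => N z * (z.1 - x0) ord0 i - s z * u z ord0 i).
  exact: (C1B (C1M C1N' (C1x i)) (C1M C1s (C1u i))).
by apply/funext => z; rewrite /y !mxE.
Qed.

Let C1yy : C1 (fun z => dot (y z) (y z)).
Proof. by apply: C1_sum => i; exact: (C1M (C1y i) (C1y i)). Qed.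

Let C1q : C1 q.
Proof.
apply: C1_sum => i; apply: C1_sum => j.
have h := C1B (C1_snd i j) (C1_cst (P0 i j)).
rewrite (_ : (fun z => _) = fun z : phase => (z.2 i j - P0 i j) * (z.2 i j - P0 i j)).
  exact: (C1M h h).
by apply/funext => z; rewrite expr2.
Qed.

Let cutoff d (z : phase) : R :=
  sqramp (d ^+ 2 - dot (y z) (y z)) * sqramp (d ^+ 2 - q z).

Let psi d (z : phase) : R := bump d (dot v v) (s z) * cutoff d z.

Let C1cutoff d : C1 (cutoff d).
Proof.
have [h1 _] := C1_sqramp (C1B (C1_cst (d ^+ 2)) C1yy).
have [h2 _] := C1_sqramp (C1B (C1_cst (d ^+ 2)) C1q).
exact: (C1M h1 h2).
Qed.

Let C1psi d : C1 (psi d).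
Proof. by have [h _] := C1_bump d (dot v v) C1s; exact: (C1M h (C1cutoff d)). Qed.

(* Along the direction u = v P both y and P are constant while s grows at rate N. *)
Let derive_psi d z : 'D_((u z, 0) : phase) (psi d) z =
  2 * (tent d (s z) - tent d (s z - dot v v)) * N z * cutoff d z.
Proof.
pose w : phase := (u z, 0).
have z2 t : (z + t *: w).2 = z.2 by rewrite /= scaler0 addr0.
have z1 t : (z + t *: w).1 - x0 = (z.1 - x0) + t *: u z by rewrite /= addrAC.
have uE t : u (z + t *: w) = u z by rewrite /u z2.
have NE t : N (z + t *: w) = N z by rewrite /N uE.
have sE t : s (z + t *: w) = s z + t * N z.
  transitivity (dot ((z.1 - x0) + t *: u z) (u z)); last by rewrite dotDl dotZl.
  by rewrite [LHS]/s (z1 t) (uE t).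
have yE t : y (z + t *: w) = y z.
  rewrite /y z1 NE sE uE scalerDr scalerDl scalerA (mulrC (N z) t) opprD.
  by rewrite [- _ - _]addrC addrA addrK.
have qE t : q (z + t *: w) = q z by rewrite /q z2.
have [hb db] := C1_bump d (dot v v) C1s.
have dd (g : phase -> R) : C1 g -> forall v x, derivable g x v.
  by case=> dg _ v' x; exact: diff_derivable.
rewrite /psi (deriveM (dd _ hb _ _) (dd _ (C1cutoff d) _ _)) db.
rewrite (derive_along (w := w) (c := N z) sE).
rewrite (derive_along (w := w) (c := 0)) ?scaler0 ?add0r; last first.
  by move=> t; rewrite /cutoff yE qE mulr0 addr0.
by rewrite /GRing.scale/=; ring.
Qed.

Hypotheses (v0 : v != 0) (vP0 : v *m P0 = v).

Let a : R := dot v v.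

Let a_gt0 : 0 < a. Proof. exact: dot_gt0. Qed.

Let cutoff_supp d z : 0 < d -> cutoff d z != 0 ->
  `|y z| <= d /\ `|z.2 - P0| <= d.
Proof.
move=> d0; rewrite /cutoff mulf_eq0 negb_or => /andP[h1 h2].
have {}h1 : dot (y z) (y z) <= d ^+ 2.
  rewrite leNgt; apply: contra h1 => h1.
  by rewrite /sqramp ramp_neg ?expr0n// subr_le0 ltW.
have {}h2 : q z <= d ^+ 2.
  rewrite leNgt; apply: contra h2 => h2.
  by rewrite /sqramp ramp_neg ?expr0n// subr_le0 ltW.
split; first by apply: norm_le_dot h1; exact: ltW.
rewrite [leLHS]/Num.norm/= mx_normrE; apply: bigmax_le => [|[i j] _ /=]; first exact: ltW.
rewrite !mxE -(@ler_pXn2r _ 2)// ?nnegrE ?(ltW d0)// real_normK ?num_real//.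
apply: le_trans h2; rewrite /q (bigD1 i)//= (bigD1 j)//= -addrA lerDl.
rewrite addr_ge0// ?sumr_ge0// => *; rewrite ?sumr_ge0// => *; exact: sqr_ge0.
Qed.

(** At P0 one has u = v and N = a, so this is continuity. The vector [(a / N z) *: u z] is the
    displacement from x0 at which s = a and y = 0, where the bump ends. *)
Let near_plane eta : 0 < eta -> exists2 tau, 0 < tau & forall z : phase,
  `|z.2 - P0| < tau -> [/\ a / 2 <= N z, `|u z| <= 2 * `|v|
    & `|(a / N z) *: u z - v| <= eta].
Proof.
move=> eta0.
have cu : continuous (fun P : 'M[R]_n => v *m P).
  by apply: mulmx_continuous; [exact: cst_continuousT|move=> P; exact: cvg_id].
have cN : continuous (fun P : 'M[R]_n => dot (v *m P) (v *m P)).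
  exact: dot_continuous_comp.
have lu : v *m P @[P --> P0] --> v by rewrite -[X in _ --> X]vP0; exact: cu.
have lN : dot (v *m P) (v *m P) @[P --> P0] --> a.
  have -> : a = dot (v *m P0) (v *m P0) by rewrite vP0.
  exact: cN.
have nv : 0 < `|v| by rewrite normr_gt0.
have : \forall P \near P0, [/\ a / 2 <= dot (v *m P) (v *m P),
    `|v *m P| <= 2 * `|v| &
    `|(a / dot (v *m P) (v *m P)) *: (v *m P) - v| <= eta].
  near=> P; split.
  - apply: ltW; near: P; by apply: (cvgr_gt _ lN); have := a_gt0; lra.
  - apply: ltW; near: P; by apply: (cvgr_lt _ (cvg_norm lu)); lra.
  - rewrite distrC; near: P.
    have : (a / dot (v *m P) (v *m P)) *: (v *m P) @[P --> P0] --> v.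
      rewrite -[X in _ --> X]scale1r -(divff (lt0r_neq0 a_gt0)).
      have li : (dot (v *m P) (v *m P))^-1 @[P --> P0] --> a^-1.
        exact: (cvgV (lt0r_neq0 a_gt0) lN).
      exact: (cvgZ (cvgM (cvg_cst a) li) lu).
    by move/cvgrPdist_le/(_ _ eta0).
move=> /nbhs_ballP[tau /= tau0 H]; exists tau => // z hz.
by apply: H; rewrite -ball_normE /= distrC.
Unshelve. all: by end_near. Qed.

(** Recovers x - x0 from s and y; b is the level from which s is measured, 0 at the start of the
    bump and a at its end. *)
Let decompose z (b : R) : N z != 0 ->
  z.1 - x0 = (N z)^-1 *: ((s z - b) *: u z + y z) + (b / N z) *: u z.
Proof.
move=> N0; rewrite /y scalerDl scaleNr [_ - b *: _]addrC addrA addrAC.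
rewrite addrK scalerDr scalerN !scalerA mulVf// scale1r (mulrC b).
by rewrite addrAC addNr add0r.
Qed.

Let in_ball d z b tau : 0 < d -> a / 2 <= N z -> `|u z| <= 2 * `|v| ->
  `|y z| <= d -> `|s z - b| <= tau ->
  `|(N z)^-1 *: ((s z - b) *: u z + y z)| <= (2 / a) * (tau * (2 * `|v|) + d).
Proof.
move=> d0 hN hu hy hs; have N0 : 0 < N z by have := a_gt0; lra.
rewrite normrZ gtr0_norm ?invr_gt0//; apply: ler_pM => //.
- by rewrite invr_ge0 ltW.
- by rewrite -(invf_div a 2) lef_pV2// posrE// divr_gt0.
- apply: (le_trans (ler_normD _ _)); apply: lerD => //.
  by rewrite normrZ; apply: ler_pM.
Qed.

(** The derivative of psi along u is a hat near x0 minus a hat near x0 + v. Its integral vanishes in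
    the limit because psi is supported near (x0, P0), away from conormal pairs; the second hat lives
    in the null set U. Hence the first hat is [vanishing] too, and it is positive at (x0, P0). Read
    contrapositively, being non-null passes from x0 to x0 + v. *)
Lemma null_at_transport r0 :
  (forall z : phase, `|z.1 - x0| < r0 -> `|z.2 - P0| < r0 -> ~ conormal Omega z) ->
  16 * `|v| < r0 -> @null_at R n m Omega (x0 + v, P0) ->
  @null_at R n m Omega (x0, P0).
Proof.
move=> hE hr [U [oU Uz nU]].
have r00 : 0 < r0 by apply: le_lt_trans hr; rewrite mulr_ge0.
have nv : 0 < `|v| by rewrite normr_gt0.
have [rho rho0 hU] : exists2 rho, 0 < rho & forall z : phase,
    `|z.1 - (x0 + v)| < rho -> `|z.2 - P0| < rho -> U z.
  move: oU; rewrite openE => /(_ _ Uz)/nbhs_ballP[rho /= rho0 H].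
  exists rho => // z h1 h2; apply: H.
  by split; rewrite -ball_normE /ball_/= distrC.
have [tau tau0 htau] := near_plane (divr_gt0 rho0 (ltr0n _ 4)).
have a0 := a_gt0.
have c1 : 0 < a * rho / (32 * `|v| + 32).
  by rewrite divr_gt0 ?mulr_gt0// addr_gt0// mulr_gt0.
have c2 : 0 < a * r0 / 16 by rewrite divr_gt0 ?mulr_gt0.
(* [d < a] keeps the bump within |s| < 2 a, where x - x0 has norm at most 8 |v| + 2 d / a; this
   stays below r0 because 16 |v| < r0. The remaining bounds place the end hat inside U. *)
have [d [d0 dtau dr drho [da hd1 hd2]]] : exists d, [/\ 0 < d, d < tau, d < r0,
    d < rho & [/\ d < a, d < a * rho / (32 * `|v| + 32) & d < a * r0 / 16]].
  apply: (@filter_ex _ (0 : R)^'+); near=> d.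
  by split; [| | | |split]; near: d; try exact: nbhs_right_lt; exact: nbhs_right_gt.
have hd1' : (2 / a) * (d * (2 * `|v|) + d) < rho / 2.
  move: hd1; rewrite ltr_pdivlMr; last by rewrite addr_gt0// mulr_gt0.
  move=> hd1; rewrite mulrAC ltr_pdivrMr//; nra.
have hd2' : (2 / a) * ((2 * a) * (2 * `|v|) + d) < r0.
  rewrite mulrAC ltr_pdivrMr//; move: hd2; rewrite ltr_pdivlMr// => hd2; nra.
have supp z : cutoff d z != 0 -> [/\ 0 < N z, `|z.2 - P0| < d + d,
    `|s z| < 2 * a -> `|z.1 - x0| < r0 &
    `|s z - a| < d -> `|z.1 - (x0 + v)| < rho].
  move=> /(cutoff_supp d0)[hy hq]; have [h1 h2 h3] := htau z (le_lt_trans hq dtau).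
  have N0 : 0 < N z by lra.
  split=> //; first by lra.
    move=> hs; rewrite (@decompose z 0) ?gt_eqF// mul0r scale0r addr0.
    apply: le_lt_trans hd2'; apply: in_ball => //; rewrite subr0; exact: ltW.
  move=> hs; have -> : z.1 - (x0 + v) = (N z)^-1 *: ((s z - a) *: u z + y z) +
      ((a / N z) *: u z - v).
    rewrite opprD [LHS]addrA [RHS]addrA; congr (_ - v).
    by apply: decompose; rewrite gt_eqF.
  apply: (le_lt_trans (ler_normD _ _)).
  have := in_ball d0 h1 h2 hy (ltW hs); lra.
(* The hat at level b; the derivative of psi along u is [g 0 - g a]. *)
pose g b z := 2 * tent d (s z - b) * N z * cutoff d z.
have cg b : continuous (g b).
  move=> z; apply: cvgM; last exact: (C1_continuous (C1cutoff d)).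
  apply: cvgM; last exact: (C1_continuous C1N').
  apply: cvgM; first exact: cvg_cst.
  apply: (@continuous_comp _ _ _ (fun z => s z - b) (tent d)).
    exact: (C1_continuous (C1B C1s (C1_cst b))).
  exact: tent_continuous.
have v1 : @vanishing R n m Omega (fun z => 'D_((v *m z.2, 0) : phase) (psi d) z).
  apply: (first_variation_vanishing bO (C1psi d)) => z hz; apply/eqP; rewrite mulf_eq0.
  apply/orP; left; apply: contrapT => /negP; rewrite mulf_eq0 negb_or => /andP[hb hc].
  have [N0 h1 h2 _] := supp z hc; apply: (hE z) => //; last first.
    by have [_ hq] := cutoff_supp d0 hc; exact: le_lt_trans hq dr.
  apply: h2; rewrite ltr_norml; apply/andP; split.
    rewrite ltNge; apply: contra hb => hs; apply/eqP.
    by apply: (bump_out (ltW d0) (ltW a0)); left; lra.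
  rewrite ltNge; apply: contra hb => hs; apply/eqP.
  by apply: (bump_out (ltW d0) (ltW a0)); right; lra.
have v2 : @vanishing R n m Omega (g a).
  apply: null_vanishing => // eta eta0; exists U; split => //.
    exact: open_measurable_phase.
  move=> z _ hz; have gz : g a z != 0 by rewrite -normr_gt0; exact: lt_trans hz.
  have hc : cutoff d z != 0 by apply: contra gz => /eqP h; rewrite /g h mulr0.
  have ht : tent d (s z - a) != 0.
    by apply: contra gz => /eqP h; rewrite /g h mulr0 !mul0r.
  have [_ _ _ h] := supp z hc; apply: hU.
    apply: h; rewrite ltNge; apply: contra ht => hs.
    by apply/eqP; apply: tent_out => //; exact: ltW.
  by have [_ hq] := cutoff_supp d0 hc; exact: le_lt_trans hq drho.
have v3 : @vanishing R n m Omega (g 0).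
  have -> : g 0 = fun z => 'D_((v *m z.2, 0) : phase) (psi d) z + g a z.
    by apply/funext => z; rewrite derive_psi /g subr0 -/a; ring.
  exact: (vanishingD bO (Dx_continuous (w := v) (C1psi d)) (cg a) v1 v2).
apply: (vanishing_null_at bO (cg 0) _ v3).
  move=> z _; apply: mulr_ge0; last by apply: mulr_ge0; exact: sqramp_ge0.
  apply: mulr_ge0; last exact: dot_ge0.
  by apply: mulr_ge0 => //; apply: tent_ge0; exact: ltW.
have uE : u (x0, P0) = v by rewrite /u.
have sE : s (x0, P0) = 0 by rewrite /s /= subrr dot0l.
have yE : y (x0, P0) = 0 by rewrite /y sE /= subrr scaler0 scale0r subr0.
have qE : q (x0, P0) = 0.
  by rewrite /q big1// => i _; rewrite big1// => j _; rewrite subrr expr0n.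
have c0 : 0 < cutoff d (x0, P0).
  by rewrite /cutoff yE qE dot0l !subr0 mulr_gt0 ?sqramp_gt0 ?exprn_gt0.
rewrite /g sE subr0 tent0 ?(ltW d0)// /N uE.
by apply: mulr_gt0 => //; apply: mulr_gt0 => //; apply: mulr_gt0.
Unshelve. all: by end_near. Qed.

End Transport.

(** * The slice through a non-null, non-conormal point *)

Section SliceDichotomy.
Context {R : realType} {n m : nat}.
Variable Omega : set 'rV[R]_n.
Hypotheses (oO : open Omega) (bO : bounded_set Omega) (cO : C2_boundary Omega).
Local Notation phase := (phase R n).
Local Notation bphase := (borel_phase R n).
Local Notation K := (@support R n m Omega).
Local Notation nullz := (@null_at R n m Omega).

Lemma null_at_out z : ~ K z -> nullz z.
Proof.
move=> nK; exists (~` K); split => //.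
  exact: closed_openC (@support_closed R n m Omega bO).
move=> eps e0; exists 1 => // V B Gamma [[_ V0 _ _ _] _ _].
by rewrite [V _]V0 lee_fin ltW.
Qed.

Lemma null_at_open : open nullz.
Proof.
rewrite openE => z [U [oU Uz nU]].
by move: (oU); rewrite openE => /(_ _ Uz); apply: filterS => y Uy; exists U.
Qed.

Lemma null_at_section_closed (P0 : 'M[R]_n) : closed [set x | ~ nullz (x, P0)].
Proof.
have cp : continuous (fun x : 'rV[R]_n => ((x, P0) : phase)).
  move=> y.
  exact: (@cvg_pair _ _ _ (nbhs y) (nbhs y) (nbhs P0) _ _ _ id (fun=> P0) cvg_id (cvg_cst P0)).
have -> : [set x | ~ nullz (x, P0)] = ~` ((fun x : 'rV[R]_n => ((x, P0) : phase)) @^-1` nullz).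
  by [].
by apply: open_closedC; apply: preim_open => //; exact: null_at_open.
Qed.

Lemma not_null_at_near x P0 : P0 *m P0 = P0 -> ~ nullz (x, P0) ->
  ~ conormal Omega (x, P0) ->
  exists2 r, 0 < r & forall v, v *m P0 = v -> `|v| < r -> ~ nullz (x + v, P0).
Proof.
move=> PP nz nc; have := closed_openC (conormal_closed oO cO).
rewrite openE => /(_ _ nc)/nbhs_ballP[r0 /= r00 H].
exists (r0 / 16); first exact: divr_gt0.
move=> v vP vr; have [->|v0] := eqVneq v 0; first by rewrite addr0.
move=> h; apply: nz; apply: (null_at_transport bO v0 vP (r0 := r0)) h.
  move=> z h1 h2; apply: (H z); split; rewrite -ball_normE /ball_/= distrC//.
by rewrite -ltr_pdivlMl// mulrC.
Qed.

(** If the normal lay in P0, a short step along minus the gradient would remain in the disc, while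
    the defining function would become negative and the point leave the closure of Omega. *)
Lemma interior_not_conormal x P0 r : 0 < r ->
  (forall v, v *m P0 = v -> `|v| < r -> closure Omega (x + v)) ->
  ~ conormal Omega (x, P0).
Proof.
move=> r0 hr hc; have [Sx _] := hc; have [f [e [cf hx]]] := C2_chart cO Sx.
have [fx NP] := conormal_grad oO cf hx hc; rewrite /= in fx NP.
set N := grad f x in NP; have N0 : 0 < dot N N.
  by apply: dot_gt0; exact: (grad_neq0 cf.1 cf.2).
have D0 : 0 < 'D_(- N) (fun y => - f y) x.
  rewrite deriveN; last by apply: diff_derivable; exact: cf.1.1.
  by rewrite grad_dot ?(dotC (grad f x)) ?dotNl ?opprK//; exact: cf.1.
have h1 := derive_gt0_near (C1N cf.1) (etrans (congr1 -%R fx) (oppr0 R)) D0.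
have h2 : \forall t \near (0 : R)^'+, region_above Omega f (x + t *: - N).
  apply: cvg_within; apply: (near_line (- N) (P := region_above Omega f)).
  exact: region_above_near.
have h3 : \forall t \near (0 : R)^'+, `|t *: - N| < r.
  apply: cvg_within.
  have l0 : t *: - N @[t --> (0 : R)] --> (0 : 'rV[R]_n).
    by rewrite -(scale0r (- N)); exact: cvgZr_tmp.
  by apply: (cvgr_lt _ (cvg_norm l0)); rewrite normr0.
have [t [/= f_neg tN tr]] : exists t, [/\ 0 < - f (x + t *: - N),
    region_above Omega f (x + t *: - N) & `|t *: - N| < r].
  by apply: (@filter_ex _ (0 : R)^'+); near=> t; split; near: t.
have : 0 <= f (x + t *: - N).
  apply: (closure_chart cf.1 tN); apply: hr => //.
  by rewrite -scalemxAl mulNmx NP.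
by move: f_neg; lra.
Unshelve. all: by end_near. Qed.

Section Slice.
Variables (x0 : 'rV[R]_n) (P0 : 'M[R]_n).
Hypothesis gP : Grass m P0.

Let PP : P0 *m P0 = P0. Proof. by case: gP. Qed.

Let A := affine_plane x0 P0.
Let I := @interior (subspace A) (closure Omega `&` A).

Let planeP (v : 'rV[R]_n) : (v <= P0)%MS <-> v *m P0 = v.
Proof.
split=> [/submxP[a ->]|<-]; last exact: submxMl.
by rewrite -mulmxA PP.
Qed.

Let plane_move x y : A x -> (y - x) *m P0 = y - x -> A y.
Proof.
move=> Ax h; rewrite /A /affine_plane /=; apply/planeP.
have /planeP h' := Ax; rewrite -(subrK x y) -addrA mulmxDl h.
by rewrite h'.
Qed.

Let plane_diff x y : A x -> A y -> (y - x) *m P0 = y - x.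
Proof.
move=> /planeP hx /planeP hy.
have -> : y - x = (y - x0) - (x - x0) by rewrite opprB addrA subrK.
by rewrite mulmxBl hx hy.
Qed.

Let nbhsA (y : 'rV[R]_n) (B : set 'rV[R]_n) : A y ->
  nbhs (y : subspace A) B <-> \forall x \near y, A x -> B x.
Proof. by move=> Ay; rewrite -[nbhs (y : subspace A)]nbhs_subspace_in. Qed.

Let interiorP (y : 'rV[R]_n) : I y <-> A y /\ exists2 r, 0 < r &
  forall v, v *m P0 = v -> `|v| < r -> closure Omega (y + v).
Proof.
split=> [Iy|[Ay [r r0 hr]]].
  have [_ Ay] : (closure Omega `&` A) y := interior_subset Iy.
  split=> //; have := (nbhsA (closure Omega `&` A) Ay).1 Iy.
  move=> /nbhs_ballP[r /= r0 H]; exists r => // v vP vr.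
  have [] // := H (y + v) _ (plane_move Ay _); last by rewrite addrC addKr.
  by rewrite -ball_normE /ball_/= opprD addNKr normrN.
apply/(nbhsA (closure Omega `&` A) Ay)/nbhs_ballP; exists r => //= x.
rewrite -ball_normE /ball_/= distrC => xr Ax; split=> //.
by rewrite -(subrK y x) addrC; apply: hr => //; exact: plane_diff.
Qed.

Hypotheses (nz0 : ~ nullz (x0, P0)) (nc0 : ~ conormal Omega (x0, P0)).

Let Delta := @connected_component 'rV[R]_n I x0.

Let Z : set 'rV[R]_n := [set x | ~ nullz (x, P0)].

Let Z_closure x : Z x -> closure Omega x.
Proof. by move=> hx; apply: contrapT => nx; apply: hx; apply: null_at_out => -[]. Qed.

Let interior_Z x : A x -> Z x -> ~ conormal Omega (x, P0) -> I x.
Proof.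
move=> Ax Zx nc; apply/interiorP; split=> //.
have [r r0 hr] := not_null_at_near PP Zx nc.
by exists r => // v vP vr; apply: Z_closure; exact: hr.
Qed.

Let A_base : A x0.
Proof. by rewrite /A /affine_plane /= subrr sub0mx. Qed.

Let I_base : I x0. Proof. exact: interior_Z. Qed.

Let I_not_conormal x : I x -> ~ conormal Omega (x, P0).
Proof. by move=> /interiorP[_ [r r0 hr]]; exact: interior_not_conormal hr. Qed.

(** Being non-null is a closed condition on x. It is also open relative to the plane at points of I,
    which are never conormal, by transport. Connectedness spreads it from x0 over the whole
    component. *)
Let Delta_Z : Delta `<=` Z.
Proof.
suff -> : Delta = Delta `&` Z by move=> x [].
apply/esym; apply: (@component_connected 'rV[R]_n I x0).
- by exists x0; split=> //; exact: connected_component_refl.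
(* Connectedness is taken in the ambient space, so the planar discs contained in Z are thickened to
   balls; within the plane the union of these balls still lies in Z. *)
- pose C := [set x : 'rV[R]_n | exists y r, [/\ 0 < r, `|x - y| < r, A y
    & forall v, v *m P0 = v -> `|v| < r -> Z (y + v)]].
  exists C.
    rewrite openE => x [y [r [r0 xy Ay hr]]]; apply/nbhs_ballP.
    exists (r - `|x - y|); first by rewrite /= subr_gt0.
    move=> x' /=; rewrite -ball_normE /ball_/= => hx'; exists y, r; split=> //.
    have -> : x' - y = (x - y) - (x - x') by apply/rowP => i; rewrite !mxE; ring.
    by apply: (le_lt_trans (ler_normB _ _)); rewrite -ltrBrDl.
  apply/seteqP; split=> x [Dx hx]; split => //.
    have Ix := connected_component_sub Dx; have [Ax _] := (interiorP x).1 Ix.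
    have [r r0 hr] := not_null_at_near PP hx (I_not_conormal Ix).
    by exists x, r; split => //; rewrite subrr normr0.
  have Ix := connected_component_sub Dx; have [Ax _] := (interiorP x).1 Ix.
  have [y [r [r0 xy Ay hr]]] := hx.
  by rewrite -(subrK y x) addrC; apply: hr => //; exact: plane_diff.
- by exists Z => //; exact: null_at_section_closed.
Qed.

Let segment_in_component y y' : Delta y ->
  (forall t : R, 0 <= t <= 1 -> I (y + t *: (y' - y))) -> Delta y'.
Proof.
move=> Dy hI; rewrite /Delta (@same_connected_component 'rV[R]_n I x0 y Dy).
pose S := (fun t : R => y + t *: (y' - y)) @` [set` `[0 : R, 1]].
apply: (@connected_component_max 'rV[R]_n I S).
- by exists 0; rewrite /= ?in_itv/= ?lexx ?ler01// scale0r addr0.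
- by move=> _ [t + <-]; rewrite /= in_itv/= => /hI.
- apply: connected_continuous_connected; first exact: segment_connected.
  apply: continuous_subspaceT => t.
  by apply: cvgD; [exact: cvg_cst|exact: cvgZr_tmp].
- by exists 1; rewrite /= ?in_itv/= ?lexx ?ler01// scale1r addrC subrK.
Qed.

(** x is non-null as a limit of points of Delta. Were it not conormal, a whole disc around it would
    lie in I; segments would join this disc to a point of Delta, making x interior to Delta. *)
Let frontier_normal_in (x : 'rV[R]_n) : @closure (subspace A) Delta x ->
  ~ @interior (subspace A) Delta x -> (inner_normal Omega x <= P0)%MS.
Proof.
move=> cx nx.
have Ax : A x.
  apply: contrapT => nAx.
  have [y [Dy yx]] : Delta `&` [set x] !=set0.
    by apply: cx; rewrite -[nbhs _]nbhs_subspace_out.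
  by apply: nAx; rewrite -yx; have [] := (interiorP y).1 (connected_component_sub Dy).
have clx r : 0 < r -> exists2 y, Delta y & `|y - x| < r.
  move=> r0; have [|y [Dy yx]] := cx [set y | `|y - x| < r].
    apply/(nbhsA _ Ax)/nbhs_ballP; exists r => //= y.
    by rewrite -ball_normE /ball_/= distrC => yx _.
  by exists y.
have Zx : Z x.
  apply: null_at_section_closed => B /nbhs_ballP[r /= r0 hB].
  have [y Dy yx] := clx r r0; exists y; split; first exact: Delta_Z.
  by apply: hB; rewrite -ball_normE /ball_/= distrC.
have [[_ hc]|nc] := pselect (conormal Omega (x, P0)); first by rewrite -hc; exact: submxMl.
exfalso; apply: nx.
have /interiorP[_ [r r0 hr]] := interior_Z Ax Zx nc.
have Ir y : A y -> `|y - x| < r -> I y.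
  move=> Ay yx; apply/interiorP; split=> //; exists (r - `|y - x|).
    by rewrite subr_gt0.
  move=> v vP vr; have -> : y + v = x + ((y - x) + v).
    by rewrite addrA [x + _]addrC subrK.
  apply: hr.
    by rewrite mulmxDl vP (plane_diff Ax Ay).
  by apply: (le_lt_trans (ler_normD _ _)); rewrite -ltrBrDl.
have [y Dy yx] := clx r r0.
have [Ay _] := (interiorP y).1 (connected_component_sub Dy).
apply/(nbhsA _ Ax)/nbhs_ballP; exists r => //= y'.
rewrite -ball_normE /ball_/= distrC => y'x Ay'.
apply: (segment_in_component Dy) => t /andP[t0 t1]; apply: Ir.
  apply: (plane_move Ay); rewrite addrC addKr -scalemxAl.
  by rewrite (plane_diff Ay Ay').
have -> : y + t *: (y' - y) - x = (1 - t) *: (y - x) + t *: (y' - x).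
  by rewrite scalerBl scale1r !scalerBr; apply/rowP => i; rewrite !mxE; ring.
apply: (le_lt_trans (ler_normD _ _)); rewrite !normrZ ger0_norm ?subr_ge0// (ger0_norm t0).
have [->|tn0] := eqVneq t 0; first by rewrite subr0 mul1r mul0r addr0.
have h1 : t * `|y' - x| < t * r by rewrite ltr_pM2l// lt_def tn0.
have h2 : (1 - t) * `|y - x| <= (1 - t) * r by rewrite ler_wpM2l ?subr_ge0// ltW.
lra.
Qed.

Lemma orthogonal_slice_component : orthogonal_slice Omega m Delta.
Proof.
exists x0, P0; split=> //; first by exists x0.
by move=> x [cx nx]; exact: frontier_normal_in.
Qed.

End Slice.

Lemma not_null_conormal : ~ (exists Delta, orthogonal_slice Omega m Delta) ->
  forall z, K z -> ~ nullz z -> conormal Omega z.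
Proof.
move=> hno [x0 P0] [_ gP] nz; apply: contrapT => nc; apply: hno.
by eexists; exact: (orthogonal_slice_component gP nz nc).
Qed.

End SliceDichotomy.

(** * Nullity at conormal points and the curvature gap *)

Section ConormalNull.
Context {R : realType} {n m : nat}.
Variable Omega : set 'rV[R]_n.
Hypotheses (oO : open Omega) (bO : bounded_set Omega) (cO : C2_boundary Omega).
Local Notation phase := (phase R n).
Local Notation bphase := (borel_phase R n).
Local Notation K := (@support R n m Omega).
Local Notation nullz := (@null_at R n m Omega).

Lemma C1_comp_fst (f : 'rV[R]_n -> R) : C1 f ->
  C1 (fun z : phase => f z.1) /\
  forall v z, 'D_v (fun z : phase => f z.1) z = 'D_(v.1) f z.1.
Proof.
move=> [df cf].
have dF z : differentiable (fst : phase -> 'rV[R]_n) z.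
  by apply: (linear_differentiable (f := @fst 'rV[R]_n 'M[R]_n)); exact: fst_continuous.
have dfF z : differentiable (f \o (fst : phase -> 'rV[R]_n)) z.
  by apply: differentiable_comp => //; exact: df.
have E (v z : phase) : 'D_v (fun z : phase => f z.1) z = 'D_(v.1) f z.1.
  rewrite (deriveE _ (dfF z)) diff_comp//=.
  rewrite (diff_lin (f := @fst 'rV[R]_n 'M[R]_n))/=; last exact: fst_continuous.
  by rewrite -deriveE.
split; last exact: E.
split=> [z|v]; first exact: dfF.
have -> : 'D_v (fun z : phase => f z.1) = fun z : phase => 'D_(v.1) f z.1.
  by apply/funext => z; exact: E.
move=> z; apply: (@continuous_comp _ _ _ fst ('D_(v.1) f)).
  exact: fst_continuous.
exact: cf.
Qed.

Hypothesis HN : forall z, K z -> ~ nullz z -> conormal Omega z.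

(** The field has zero boundary term because f = 0 on S. At conormal pairs of the support the
    positive factor is exactly 1: f vanishes, and P fixes the gradient, so <grad f, P e> = <grad f,
    e> = 1. *)
Lemma conormal_null_at z0 : conormal Omega z0 -> nullz z0.
Proof.
move=> hz0; have [Sx _] := hz0; have [f [e [cf hx]]] := C2_chart cO Sx.
have [r /= r0 hr] := (nbhs_ballP _ _).1 (region_above_near hx).
pose d2 (z : phase) := \sum_i (z.1 ord0 i - z0.1 ord0 i) * (z.1 ord0 i - z0.1 ord0 i).
have C1d : C1 d2.
  apply: C1_sum => i; have h := C1B (C1_fst i) (C1_cst (z0.1 ord0 i)).
  exact: (C1M h h).
have [hchi dchi] := C1_sqramp (C1B (C1_cst ((r / 2) ^+ 2)) C1d).
set chi := (fun z : phase => _) in hchi dchi.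
have chi_near z : chi z != 0 -> region_above Omega f z.1.
  move=> h; apply: hr; rewrite -ball_normE /ball_/= distrC.
  apply: (@le_lt_trans _ _ (r / 2)); last by lra.
  apply: norm_le_dot; first by rewrite divr_ge0// ltW.
  rewrite (_ : dot _ _ = d2 z); last by apply: eq_bigr => i _; rewrite !mxE.
  rewrite leNgt; apply: contra h => h.
  by rewrite /chi /sqramp ramp_neg ?expr0n// subr_le0 ltW.
have [hF dF] := C1_comp_fst cf.1.
pose psi (z : phase) := f z.1 * chi z.
have hpsi : C1 psi by exact: (C1M hF hchi).
have chi_cont := C1_continuous hchi.
have v1 : @vanishing R n m Omega (fun z => 'D_((e *m z.2, 0) : phase) psi z).
  apply: (first_variation_vanishing bO hpsi) => z hz.
  have [c0|/chi_near hc] := eqVneq (chi z) 0; first by rewrite /psi c0 mulr0 mul0r.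
  by have [fz _] := conormal_grad oO cf hc hz; rewrite /psi fz !mul0r.
have cD := Dx_continuous (w := e) hpsi.
have dpsi z : K z -> conormal Omega z -> 'D_((e *m z.2, 0) : phase) psi z = chi z.
  move=> [_ [Ps _ _]] hz.
  have dd (g : phase -> R) : C1 g -> forall v x, derivable g x v.
    by case=> dg _ v' x; exact: diff_derivable.
  rewrite /psi (deriveM (dd _ hF _ _) (dd _ hchi _ _)) dF /= dchi.
  (* Where the cutoff is 0 nothing relates f to Omega, but the derivative of the cutoff contains the
     factor [ramp] and is 0 as well. *)
  have [c0|cn0] := eqVneq (chi z) 0.
    move/eqP: (c0); rewrite /chi /sqramp expf_eq0/= => /eqP ->.
    by rewrite expr0n/= scale0r mulr0 mul0r scaler0 addr0.
  have [fz NP] := conormal_grad oO cf (chi_near z cn0) hz.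
  rewrite fz /GRing.scale/= mul0r add0r (grad_dot _ _ cf.1) dotC dot_mulmx Ps NP dotC.
  by rewrite -(grad_dot _ _ cf.1) (derive_chart cf.2) mulr1.
have cdiff : continuous (fun z => chi z - 'D_((e *m z.2, 0) : phase) psi z).
  by move=> z; apply: cvgB; [exact: chi_cont|exact: cD].
have v2 : @vanishing R n m Omega (fun z => chi z - 'D_((e *m z.2, 0) : phase) psi z).
  apply: null_vanishing => // eta eta0.
  (* A compact set of null points: a non-null point of the support is conormal, and there the
     difference is 0. *)
  pose A := K `&` (fun z => `|chi z - 'D_((e *m z.2, 0) : phase) psi z|) @^-1` [set t | eta <= t].
  have cA : closed ((fun z => `|chi z - 'D_((e *m z.2, 0) : phase) psi z|) @^-1` [set t | eta <= t]).
    apply: preimage_closed; last exact: closed_ge.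
    by move=> z _; apply: cvg_norm; exact: cdiff.
  have clA : closed A by apply: closedI => //; exact: support_closed.
  exists A; split.
  - exact: closed_measurable_phase.
  - apply: null_compact.
    + by apply: (subclosed_compact clA (@support_compact R n m Omega bO)) => z [].
    + exact: closed_measurable_phase.
    + move=> z [Kz hz]; apply: contrapT => /(HN Kz)/(dpsi _ Kz) E.
      by move: hz; rewrite /= E subrr normr0 leNgt eta0.
  - by move=> z Kz hz; split => //; exact: ltW.
have v3 : @vanishing R n m Omega chi.
  have -> : chi = fun z => (chi z - 'D_((e *m z.2, 0) : phase) psi z) +
      'D_((e *m z.2, 0) : phase) psi z by apply/funext => z; rewrite subrK.
  exact: (vanishingD bO cdiff cD v2 v1).
apply: (vanishing_null_at bO chi_cont _ v3); first by move=> z _; exact: sqramp_ge0.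
rewrite /chi sqramp_gt0 subr_gt0 /d2 big1; last by move=> i _; rewrite subrr mulr0.
by rewrite exprn_gt0// divr_gt0.
Qed.

Lemma curvature_gap : exists2 delta, 0 < delta &
  forall V B Gamma, CV_perp Omega m V B Gamma -> mass V = 1%E ->
    delta <= @total_curv R n m Omega V B.
Proof.
have hK z : K z -> nullz z.
  by move=> Kz; apply: contrapT => nz; exact: (nz (conormal_null_at (HN Kz nz))).
have : null (m := m) Omega K.
  apply: null_compact hK; first exact: support_compact.
  exact: support_measurable.
move=> /(_ (1 / 2))[|delta d0 h]; first by lra.
exists delta => // V B Gamma H V1; rewrite leNgt; apply/negP => lt.
have := h V B Gamma (And3 H V1 (ltW lt)).
rewrite -(mass_support bO H) V1 lee_fin; lra.
Qed.

End ConormalNull.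

(** * Bounding the boundary mass by mass and total curvature *)

Import HBNNSimple.

Section BoundaryMass.
Context {R : realType} {n m : nat}.
Variable Omega : set 'rV[R]_n.
Hypotheses (oO : open Omega) (bO : bounded_set Omega) (cO : C2_boundary Omega).
Local Notation phase := (phase R n).
Local Notation bphase := (borel_phase R n).
Local Notation K := (@support R n m Omega).
Local Notation bd := (GT (frontier Omega) m.-1).

(** The integral of a non-negative function is a supremum over simple functions below it, and c
    times the indicator of A is one of them. No measurability of f is asked, which suits a boundary
    integrand containing the normal and [wedge]. *)
Lemma ge0_integral_lower_bound d (T : measurableType d)
    (mu : {measure set T -> \bar R}) (D A : set T) (f : T -> \bar R) (c : R) :
  measurable A -> A `<=` D -> 0 <= c -> (forall x, D x -> (0 <= f x)%E) ->
  (forall x, A x -> (c%:E <= f x)%E) ->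
  (c%:E * mu A <= \int[mu]_(x in D) f x)%E.
Proof.
move=> mA AD c0 f0 fc; rewrite ge0_integralE//.
have -> : (c%:E * mu A)%E = sintegral mu (scale_nnsfun (indic_nnsfun R mA) c0).
  by rewrite sintegralrM sintegral_indic// setIT.
apply: ereal_sup_ubound; exists (scale_nnsfun (indic_nnsfun R mA) c0) => // x.
rewrite /= /patch; have [Ax|Ax] := pselect (A x).
  by rewrite /mindic indicE !mem_set ?mulr1 ?fc//; exact: AD.
rewrite /mindic indicE memNset// mulr0; case: ifPn => // /set_mem; exact: f0.
Qed.

Let mass_bound (U : set 'rV[R]_n) := exists2 C, 0 <= C &
  forall (V : {measure set bphase -> \bar R}) B Gamma,
    CV_perp Omega m V B Gamma ->
    (Gamma ((U `*` setT) `&` bd) <=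
      (C * (fine (mass V) + @total_curv R n m Omega V B))%:E)%E.

Let bd_measurable : measurable (bd : set bphase).
Proof. by apply: closed_measurable_phase; exact: GT_closed. Qed.

Lemma open_cylinder (U : set 'rV[R]_n) : open U ->
  measurable ((U `*` setT) : set bphase).
Proof.
move=> oU; apply: open_measurable_phase.
have -> : (U `*` [set: 'M[R]_n]) = fst @^-1` U by apply/seteqP; split => z // [].
by apply: preim_open => //; exact: fst_continuous.
Qed.

(** The test field is a cutoff times e. On S one has <nu, e> = 1 / |grad f|, bounded below near x0
    by [k0], so the boundary term dominates Gamma over a smaller neighbourhood. *)
Lemma boundary_mass_local x0 : frontier Omega x0 ->
  exists U, [/\ open U, U x0 & mass_bound U].
Proof.
move=> Sx; have [f [e [cf hx]]] := C2_chart cO Sx.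
pose D := dot (grad f x0) (grad f x0) + 1.
have D0 : 0 < D by rewrite ltr_wpDl// dot_ge0.
have cg := grad_continuous cf.1.
have hD : \forall y \near x0, dot (grad f y) (grad f y) < D.
  have lN : dot (grad f y) (grad f y) @[y --> x0] --> dot (grad f x0) (grad f x0).
    exact: (dot_continuous_comp cg cg).
  apply: (cvgr_lt _ lN).
  by rewrite /D ltrDl.
have : \forall y \near x0, region_above Omega f y /\ dot (grad f y) (grad f y) < D.
  by apply: filterI => //; exact: region_above_near.
move=> /nbhs_ballP[r /= r0 hr].
pose d2 (z : phase) := \sum_i (z.1 ord0 i - x0 ord0 i) * (z.1 ord0 i - x0 ord0 i).
have C1d : C1 d2.
  apply: C1_sum => i; have h := C1B (C1_fst i) (C1_cst (x0 ord0 i)).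
  exact: (C1M h h).
have [hchi _] := C1_sqramp (C1B (C1_cst ((r / 2) ^+ 2)) C1d).
set chi := (fun z : phase => _) in hchi.
have chi_near z : chi z != 0 ->
    region_above Omega f z.1 /\ dot (grad f z.1) (grad f z.1) < D.
  move=> h; apply: hr; rewrite -ball_normE /ball_/= distrC.
  apply: (@le_lt_trans _ _ (r / 2)); last by lra.
  apply: norm_le_dot; first by rewrite divr_ge0// ltW.
  rewrite (_ : dot _ _ = d2 z); last by apply: eq_bigr => i _; rewrite !mxE.
  rewrite leNgt; apply: contra h => h.
  by rewrite /chi /sqramp ramp_neg ?expr0n// subr_le0 ltW.
pose k0 := (Num.sqrt D)^-1.
have k00 : 0 < k0 by rewrite invr_gt0 sqrtr_gt0.
have nu_e z : chi z != 0 -> frontier Omega z.1 -> k0 <= dot (inner_normal Omega z.1) e.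
  move=> /chi_near[hz hN] /(frontier_chart oO cf.1 cf.2 hz) fz.
  rewrite (inner_normal_chart oO cf.1 cf.2 hz fz) dotZl.
  rewrite -[dot (grad f z.1) e](grad_dot _ _ cf.1).
  have N0 := dot_gt0 (grad_neq0 cf.1 cf.2 z.1).
  rewrite (derive_chart cf.2) mulr1 /k0 lef_pV2 ?posrE ?sqrtr_gt0//.
  by apply: ler_wsqrtr; exact: ltW.
(* Half the squared radius of the cutoff: on U the argument of [sqramp] is at least c2, and the
   cutoff at least [c2 ^+ 2]. *)
pose c2 := (r / 2) ^+ 2 / 2; have c20 : 0 < c2 by rewrite divr_gt0 ?exprn_gt0 ?divr_gt0.
pose dd (x : 'rV[R]_n) := \sum_i (x ord0 i - x0 ord0 i) * (x ord0 i - x0 ord0 i).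
have C1dd : C1 dd.
  apply: C1_sum => i; have h := C1B (C1_rV i) (C1_cst (x0 ord0 i)).
  exact: (C1M h h).
pose U : set 'rV[R]_n := [set x | dd x < c2].
have oU : open U.
  apply: (preim_open (A := [set t | t < c2]) (C1_continuous C1dd)).
  exact: open_lt.
exists U; split=> //.
  by rewrite /U /= /dd big1// => i _; rewrite subrr mulr0.
pose c := k0 * c2 ^+ 2; have c0 : 0 < c by rewrite mulr_gt0 ?exprn_gt0.
have [C1' C10 hC1] := curv_term_bound e (@support_compact R n m Omega bO) hchi.
have [M2 M20 hM2] := continuous_compact_bounded (@support_compact R n m Omega bO)
  (Dx_continuous (w := e) hchi).
exists (c^-1 * (C1' + M2)); first by rewrite mulr_ge0 ?invr_ge0 ?(ltW c0)// addr_ge0.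
move=> V B Gamma H; have mK := @support_measurable R n m Omega bO.
have i1 := curv_term_integrable bO H e hchi.
have i2 := continuous_integrable bO H (Dx_continuous (w := e) hchi).
have i3 := norm_curv_integrable bO H.
have mA : measurable (((U `*` setT) `&` bd) : set bphase).
  by apply: measurableI => //; exact: open_cylinder.
have := @ge0_integral_lower_bound _ _ Gamma (bd : set bphase)
  ((U `*` setT) `&` bd : set bphase) (fun z =>
  (chi (z.1, wedge (inner_normal Omega z.1) z.2) *
      dot (inner_normal Omega z.1) e)%:E) c mA.
move=> /(_ _ (ltW c0)) h.
have {}h := h (@subIsetr _ _ _); rewrite (first_variation bO H e hchi) in h.
(* The cutoff depends on x only, so the plane spanned by nu and Q disappears from the boundary
   term. *)
have chiE z P : chi (z.1, P) = chi z by [].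
have : (c%:E * Gamma ((U `*` setT) `&` bd) <=
    ((C1' + M2) * (fine (mass V) + @total_curv R n m Omega V B))%:E)%E.
  apply: le_trans (h _ _) _.
  - move=> z [Sz _ _]; rewrite lee_fin chiE.
    have [->|cz] := eqVneq (chi z) 0; first by rewrite mul0r.
    apply: mulr_ge0; first exact: sqramp_ge0.
    by apply: le_trans (nu_e z cz Sz); exact: ltW.
  - move=> z [[Uz _] [Sz _ _]]; rewrite lee_fin chiE.
    have hz : c2 <= (r / 2) ^+ 2 - d2 z.
      by rewrite -[d2 z]/(dd z.1); move: Uz; rewrite /U /= /c2; lra.
    have cz : c2 ^+ 2 <= chi z.
      rewrite /chi /sqramp ramp_pos; last by apply: le_trans hz; exact: ltW.
      by rewrite lerXn2r ?nnegrE// ?(ltW c20)// (le_trans (ltW c20) hz).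
    have c22 : 0 < c2 ^+ 2 by rewrite exprn_gt0.
    rewrite /c mulrC; apply: ler_pM => //; try exact: ltW.
    by apply: nu_e => //; rewrite gt_eqF// (lt_le_trans c22 cz).
  - rewrite lee_fin; apply: (le_trans (ler_norm _)); rewrite normrN.
    have b1 := le_normr_Rintegral mK i1.
    have b2 := le_normr_Rintegral mK i2.
    have b1' : \int[V]_(z in (K : set bphase)) `|curv_term B chi e z| <=
        C1' * @total_curv R n m Omega V B.
      rewrite /total_curv -RintegralZl//; apply: le_Rintegral => //.
      + exact: (integrable_norm i1).
      + by have := integrableZl mK C1' i3; exact.
      + by move=> z /hC1.
    have iM : V.-integrable (K : set bphase) (EFin \o cst M2).
      by apply: (continuous_integrable bO H); move=> z; exact: cvg_cst.
    have b2' : \int[V]_(z in (K : set bphase))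
        `|'D_((e *m z.2, 0) : phase) chi z| <= M2 * fine (mass V).
      rewrite (mass_support bO H) -Rintegral_cst//; apply: le_Rintegral => //.
      exact: (integrable_norm i2).
    have t0 := total_curv_ge0 (m := m) Omega V B.
    have f0 : 0 <= fine (mass V) by rewrite fine_ge0// measure_ge0.
    apply: (le_trans (ler_normD _ _)).
    apply: (le_trans (lerD (le_trans b1 b1') (le_trans b2 b2'))).
    rewrite mulrDl !mulrDr; apply: lerD; first by rewrite lerDr mulr_ge0.
    by rewrite lerDl mulr_ge0.
rewrite -lee_pdivlMl// -EFinM mulrA; exact.
Qed.

Lemma boundary_mass : exists2 C, 0 <= C &
  forall (V : {measure set bphase -> \bar R}) B Gamma,
    CV_perp Omega m V B Gamma ->
    (mass Gamma <= (C * (fine (mass V) + @total_curv R n m Omega V B))%:E)%E.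
Proof.
have cS : compact (frontier Omega).
  apply: (subclosed_compact _ (bounded_closure_compact bO)).
    exact: frontier_closed.
  by move=> x [].
have [||U [oU SU [C C0 hC]]] := compact_open_induction (P := mass_bound) cS _ _ boundary_mass_local.
- exists 0 => // V B Gamma _; rewrite mul0r.
  by rewrite (_ : _ `&` _ = set0) ?measure0//; apply/seteqP; split => z // [[]].
- move=> U W oU oW [C C0 hC] [C' C0' hC']; exists (C + C'); first exact: addr_ge0.
  move=> V B Gamma H; rewrite mulrDl EFinD.
  apply: le_trans (leeD (hC _ _ _ H) (hC' _ _ _ H)).
  rewrite (_ : ((U `|` W) `*` setT) `&` bd =
    (((U `*` setT) `&` bd) `|` ((W `*` setT) `&` bd))).
    by apply: measureU2; apply: measurableI => //; exact: open_cylinder.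
  by apply/seteqP; split => z; rewrite /setX /=; tauto.
exists C => // V B Gamma H; apply: le_trans (hC V B Gamma H).
have [_ _ _ [G0 _] _] := H.
have mA : measurable (((U `*` setT) `&` bd) : set bphase).
  by apply: measurableI => //; exact: open_cylinder.
rewrite /mass -[leRHS]adde0 -G0.
apply: le_trans (measureU2 Gamma mA (measurableC bd_measurable)).
apply: le_measure; rewrite ?inE//.
  by apply: measurableU => //; exact: measurableC.
move=> z _; have [hz|hz] := pselect (bd z); last by right.
by left; split=> //; split => //; case: hz => /SU.
Qed.

End BoundaryMass.

(** * Scaling, and total curvature against the L^p norm *)

Section Scaling.
Context d (T : measurableType d) {R : realType}.
Variables (k : {nonneg R}) (mu : {measure set T -> \bar R}).
Hypothesis k0 : 0 < k%:num.

Lemma sintegral_mscale (h : {nnsfun T >-> R}) :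
  sintegral (mscale k mu) h = (k%:num%:E * sintegral mu h)%E.
Proof.
rewrite !sintegralET ge0_mule_fsumr; last by move=> r; exact: nnsfun_mulemu_ge0.
by apply: eq_fsbigr => r _; rewrite /= /mscale muleCA.
Qed.

Let ge0_mscale (D : set T) (f : T -> \bar R) : (forall x, D x -> (0 <= f x)%E) ->
  (\int[mscale k mu]_(x in D) f x = k%:num%:E * \int[mu]_(x in D) f x)%E.
Proof.
move=> f0; rewrite !ge0_integralE// -ereal_sup_pZl//; congr ereal_sup.
rewrite image_comp; apply/seteqP; split => x [h hf <-]; exists h => //=;
  by rewrite sintegral_mscale.
Qed.

(** Valid for every f, measurable or not, as the boundary integrand requires: each part has as
    integral a supremum over simple functions, and multiplication by k > 0 commutes with it. *)
Lemma integral_mscale (D : set T) (f : T -> \bar R) :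
  (\int[mscale k mu]_(x in D) f x = k%:num%:E * \int[mu]_(x in D) f x)%E.
Proof.
rewrite [LHS]integralE (integralE mu D f) !ge0_mscale//.
move: (integral _ _ _) (integral _ _ _) => a b.
case: a => [a||]; case: b => [b||] //=;
  rewrite ?(gt0_muley, gt0_muleNy) ?lte_fin// -?EFinM -?EFinN -?EFinD ?mulrBr//.
Qed.

End Scaling.

Section ScaledVarifold.
Context {R : realType} {n m : nat}.
Variable Omega : set 'rV[R]_n.
Local Notation bphase := (borel_phase R n).

Lemma radon_on_mscale (E : set (phase R n)) (k : {nonneg R})
    (mu : {measure set bphase -> \bar R}) :
  radon_on E mu -> radon_on E (mscale k mu).
Proof.
move=> [h0 hK]; split; first exact: etrans (congr1 (mule k%:num%:E) h0) (mule0 _).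
by move=> K /hK h; rewrite /mscale lte_mul_pinfty.
Qed.

(** The defining conditions are homogeneous in (V, Gamma) for fixed B; this serves to normalise the
    mass to 1. *)
Lemma CV_perp_mscale V B Gamma (k : {nonneg R}) : 0 < k%:num ->
  CV_perp Omega m V B Gamma -> CV_perp Omega m (mscale k V) B (mscale k Gamma).
Proof.
move=> k0 [h1 h2 h3 h4 h5]; split.
- exact: radon_on_mscale.
- exact: etrans (congr1 (mule k%:num%:E) h2) (mule0 _).
- move=> i j l; have /integrableP[mf hf] := h3 i j l; apply/integrableP; split=> //.
  by rewrite integral_mscale// lte_mul_pinfty// integral_ge0.
- exact: radon_on_mscale.
- by move=> phi hphi; rewrite !integral_mscale// h5// muleN.
Qed.

Lemma Lp_norm_powE (V : {measure set bphase -> \bar R}) (p : R) B : p != 0 ->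
  Lp_norm_pow V p B = (\int[V]_z (norm_curv B z `^ p)%:E)%E.
Proof.
move=> p0; rewrite /Lp_norm_pow (poweR_Lnorm V _ p0); apply: eq_integral => z _ /=.
by rewrite ger0_norm ?sqrtr_ge0.
Qed.

Lemma Lp_norm_pow_ge0 (V : {measure set bphase -> \bar R}) (p : R) B :
  (0 <= Lp_norm_pow V p B)%E.
Proof. by rewrite /Lp_norm_pow poweR_ge0. Qed.

(** Either b <= t, or b / t >= 1 and then b / t <= (b / t)^p. *)
Lemma le_powR_tangent (t b p : R) : 0 < t -> 0 <= b -> 1 <= p ->
  b <= t + t / t `^ p * b `^ p.
Proof.
move=> t0 b0 p1; have tp : 0 < t `^ p by exact: powR_gt0.
have [bt|tb] := leP b t.
  by rewrite (le_trans bt)// lerDl mulr_ge0 ?powR_ge0// divr_ge0// ltW.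
apply: (@le_trans _ _ (t / t `^ p * b `^ p)); last by rewrite lerDr ltW.
have bt1 : 1 <= b / t by rewrite ler_pdivlMr// mul1r ltW.
have := le1r_powR bt1 p1; rewrite ler_pdivrMr// => h.
apply: (le_trans h); rewrite powRM ?invr_ge0 ?(ltW t0)//.
rewrite -(powR_inv1 (ltW t0)) -powRrM mulN1r powRN mulrC mulrA.
by rewrite mulrAC.
Qed.

Hypothesis bO : bounded_set Omega.

Lemma total_curv_le_Lp V B Gamma t p : CV_perp Omega m V B Gamma -> 0 < t ->
  1 <= p -> ((@total_curv R n m Omega V B)%:E <=
    t%:E * mass V + (t / t `^ p)%:E * Lp_norm_pow V p B)%E.
Proof.
move=> H t0 p1; have p0 : p != 0 by rewrite gt_eqF// (lt_le_trans ltr01).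
have mB := norm_curv_measurable H.
have mK := @support_measurable R n m Omega bO.
have hi := norm_curv_integrable bO H.
have c0 : 0 <= t / t `^ p by rewrite divr_ge0 ?powR_ge0// ltW.
have mBp : measurable_fun setT (fun z : bphase => (norm_curv B z `^ p)%:E).
  by apply/measurable_EFinP; apply: (measurableT_comp (measurable_powR _)).
rewrite /total_curv /Rintegral fineK; last exact: (integrable_fin_num mK hi).
apply: (@le_trans _ _ (\int[V]_z (norm_curv B z)%:E)%E).
  apply: ge0_subset_integral => //.
    exact/measurable_EFinP.
  by move=> z _; rewrite lee_fin; exact: norm_curv_ge0.
rewrite Lp_norm_powE// /mass -integral_cst//.
rewrite -ge0_integralZl_EFin//; last first.
  by move=> z _; rewrite lee_fin powR_ge0.
rewrite -ge0_integralD//; last 3 first.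
- by move=> z _; rewrite lee_fin ltW.
- by move=> z _; rewrite -EFinM lee_fin mulr_ge0// powR_ge0.
- exact: measurable_funeM.
apply: ge0_le_integral => //.
- by move=> z _; rewrite lee_fin; exact: norm_curv_ge0.
- exact/measurable_EFinP.
- by apply: emeasurable_funD => //; exact: measurable_funeM.
- move=> z _ /=; rewrite -EFinM -EFinD lee_fin; apply: le_powR_tangent => //.
  exact: norm_curv_ge0.
Qed.

End ScaledVarifold.

(** * Positivity of kappa and the two mass bounds *)

Section MassBounds.
Context {R : realType} {n m : nat}.
Variable Omega : set 'rV[R]_n.
Hypotheses (oO : open Omega) (bO : bounded_set Omega) (cO : C2_boundary Omega).
Hypothesis noslice : ~ (exists Delta, orthogonal_slice Omega m Delta).
Variable p : R.
Hypothesis p1 : 1 <= p.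
Local Notation bphase := (borel_phase R n).

Lemma kappa_gt0 : (0 < kappa Omega m p)%E.
Proof.
have [delta d0 hd] := curvature_gap oO bO cO (not_null_conormal oO bO cO noslice).
(* At mass 1 the term t absorbs half of the gap delta; what remains gives kappa >= (delta / 2)^p. *)
pose t := delta / 2; have t0 : 0 < t by rewrite divr_gt0.
have c0 : 0 < t / t `^ p by rewrite divr_gt0// powR_gt0.
apply: (@lt_le_trans _ _ ((t / t `^ p)^-1 * t)%:E).
  by rewrite lte_fin mulr_gt0// invr_gt0.
apply: le_ereal_inf_tmp => e [V [B [Gamma [H V1 ->]]]].
have := total_curv_le_Lp bO H t0 p1; rewrite V1 mule1 => h.
have : ((t + t)%:E <= t%:E + (t / t `^ p)%:E * Lp_norm_pow V p B)%E.
  by apply: le_trans h; rewrite lee_fin -splitr; exact: hd H V1.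
rewrite [(t + t)%:E]EFinD leeD2lE// => h2.
by rewrite EFinM lee_pdivrMl.
Qed.

(** Both sides scale linearly, which reduces the claim to mass 1. The product form also covers kappa
    = +oo, and is reused to rule that value out. *)
Lemma mass_kappa V B Gamma : CV_perp Omega m V B Gamma ->
  (mass V * kappa Omega m p <= Lp_norm_pow V p B)%E.
Proof.
move=> H; have p0 : p != 0 by rewrite gt_eqF// (lt_le_trans ltr01).
have fV : mass V \is a fin_num by rewrite ge0_fin_numE ?measure_ge0// (mass_fin bO H).
have [V0|V0] := eqVneq (mass V) 0%E; first by rewrite V0 mul0e Lp_norm_pow_ge0.
have M0 : 0 < fine (mass V).
  by rewrite fine_gt0// lt_def V0 measure_ge0 /= ltey_eq fV.
have k0 : 0 <= (fine (mass V))^-1 by rewrite invr_ge0 ltW.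
pose k : {nonneg R} := NngNum k0.
have kpos : 0 < k%:num by rewrite invr_gt0.
have H' := CV_perp_mscale kpos H.
have h : (kappa Omega m p <= Lp_norm_pow (mscale k V) p B)%E.
  apply: ereal_inf_lbound; exists (mscale k V), B, (mscale k Gamma); split=> //.
  by rewrite /mass /= /mscale -[V setT](fineK fV) -EFinM mulVf// gt_eqF.
rewrite Lp_norm_powE// integral_mscale// -Lp_norm_powE// in h.
by rewrite -(fineK fV) -lee_pdivlMl.
Qed.

Lemma mass_le V B Gamma : (kappa Omega m p < +oo)%E ->
  CV_perp Omega m V B Gamma ->
  (mass V <= (kappa Omega m p)^-1 * Lp_norm_pow V p B)%E.
Proof.
move=> koo H; have k0 := kappa_gt0; have := mass_kappa H.
have kf : kappa Omega m p \is a fin_num by rewrite ge0_fin_numE// ltW.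
rewrite -(fineK kf) in k0 *; rewrite inver gt_eqF//.
by rewrite muleC lee_pdivlMl.
Qed.

Lemma mass_boundary_le : (kappa Omega m p < +oo)%E -> exists C : R,
  forall (V : {measure set bphase -> \bar R}) B Gamma,
    CV_perp Omega m V B Gamma -> (mass Gamma <= C%:E * Lp_norm_pow V p B)%E.
Proof.
move=> koo; have k0 := kappa_gt0.
have kf : kappa Omega m p \is a fin_num by rewrite ge0_fin_numE// ltW.
have [C C0 hC] := boundary_mass (m := m) oO bO cO.
pose K := (fine (kappa Omega m p))^-1.
have K0 : 0 < K by rewrite invr_gt0 fine_gt0// k0.
(* With L the p-th power of the norm, the mass is at most K L and, taking t = 1, the total curvature
   at most mass + L; together at most (2 K + 1) L. [C + 1] keeps the factor positive for the case L
   = +oo. *)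
exists ((C + 1) * (K + K + 1)) => V B Gamma H.
have hm := mass_le koo H.
have hK : ((kappa Omega m p)^-1 = K%:E)%E.
  by rewrite -(fineK kf) inver gt_eqF// fine_gt0// k0.
rewrite hK in hm.
have ht := total_curv_le_Lp bO H ltr01 p1.
rewrite powR1 divr1 !mul1e in ht.
have L0 := Lp_norm_pow_ge0 V p B.
apply: le_trans (hC V B Gamma H) _.
have fV : mass V \is a fin_num by rewrite ge0_fin_numE ?measure_ge0// (mass_fin bO H).
have [Lf|Loo] := eqVneq (Lp_norm_pow V p B) +oo%E.
  rewrite Lf gt0_muley ?leey// lte_fin mulr_gt0//; lra.
have fL : Lp_norm_pow V p B \is a fin_num by rewrite ge0_fin_numE// ltey.
move: hm ht L0; rewrite -(fineK fV) -(fineK fL) -!EFinM -EFinD !lee_fin /=.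
set x := fine (mass V); set y := total_curv _ _ _; set z := fine (Lp_norm_pow _ _ _).
have x0 : 0 <= x by rewrite fine_ge0// measure_ge0.
have y0 : 0 <= y by exact: total_curv_ge0.
move=> hm ht L0; apply: (@le_trans _ _ ((C + 1) * (x + y))).
  by apply: ler_wpM2r; lra.
rewrite -mulrA; apply: ler_wpM2l; lra.
Qed.

End MassBounds.

(** * Measurability by coordinates and image measures *)

Section MeasurableCoordinates.
Lemma measurable_generated d (X : measurableType d) (T : pointedType)
    (G : set (set T)) (F : X -> T) :
  (forall U, G U -> measurable (F @^-1` U)) ->
  measurable_fun setT (F : X -> g_sigma_algebraType G).
Proof.
move=> hG; apply: (@measurability _ _ X (g_sigma_algebraType G) setT F G erefl) => _ [U GU <-].
by rewrite setTI; exact: hG.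
Qed.

Context {R : realType}.

(* A topology whose neighbourhoods are generated by finitely many coordinates is
   second countable, so that measurability can be checked on coordinates. *)
Lemma measurable_coordinates d (X : measurableType d) (W : topologicalType)
    (K : finType) (coord : K -> W -> R) (F : X -> W) :
  (forall w0 (U : set W), nbhs w0 U -> exists2 r : R, 0 < r &
     forall w, (forall k, `|coord k w - coord k w0| < r) -> U w) ->
  (forall k, measurable_fun setT (fun x => coord k (F x))) ->
  forall U : set W, open U -> measurable (F @^-1` U).
Proof.
move=> hW mF U oU.
pose box (q : {ffun K -> rat} * nat) : set W :=
  [set w | forall k, `|coord k w - ratr (q.1 k)| < q.2.+1%:R^-1].
have -> : F @^-1` U =
    \bigcup_(q : {ffun K -> rat} * nat)
      (if `[< box q `<=` U >] then F @^-1` (box q) else set0).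
  apply/seteqP; split => x /=.
    move: oU; rewrite openE => oU /oU /hW[r r0 hr].
    have [N] := ltr_add_invr (divr_gt0 r0 (ltr0n _ 2)); rewrite add0r => hN.
    have hq k : exists q : rat, `|coord k (F x) - ratr q| < N.+1%:R^-1.
      have [|q] := @rat_in_itvoo R (coord k (F x) - N.+1%:R^-1) (coord k (F x) + N.+1%:R^-1).
        by rewrite ltrD2l gtrN// invr_gt0.
      rewrite in_itv/= => hq; by exists q; rewrite ltr_distlC.
    have [q hq'] := choice hq.
    exists ([ffun k => q k], N) => //.
    case: asboolP => hb.
      by move=> k; rewrite /= ffunE.
    exfalso; apply: hb => w hw; apply: hr => k.
    have h1 := hw k; have h2 := hq' k; rewrite /= ffunE in h1.
    have -> : coord k w - coord k (F x) =
      (coord k w - ratr (q k)) - (coord k (F x) - ratr (q k)) by ring.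
    apply: (le_lt_trans (ler_normB _ _)); rewrite [ltRHS]splitr.
    by apply: ltrD; apply: lt_trans hN.
  by move=> [q _]; case: asboolP => // hb /hb.
apply: countable_bigcupT_measurable => [|q]; first exact: countableP.
case: ifP => _; last exact: measurable0.
have -> : F @^-1` box q =
    \bigcap_(k in [set: K]) [set x | `|coord k (F x) - ratr (q.1 k)| < q.2.+1%:R^-1].
  by apply/seteqP; split => x /= h k; [move=> _; exact: h|exact: h].
apply: fin_bigcap_measurable => // k _.
rewrite -[X in measurable X]setTI.
have mg : measurable_fun setT (fun x => `|coord k (F x) - ratr (q.1 k)| : R).
  apply: measurableT_comp; first exact: normr_measurable.
  exact: measurable_funB.
rewrite [X in measurable (_ `&` X)](_ : _ =
  (fun x => `|coord k (F x) - ratr (q.1 k)|) @^-1` [set t | t < q.2.+1%:R^-1])//.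
by apply: mg => //; apply: open_measurable; exact: open_lt.
Qed.

Context {n : nat}.

Definition borel_rV := g_sigma_algebraType (@open 'rV[R]_n).

Lemma measurable_rV d (X : measurableType d) (F : X -> 'rV[R]_n) :
  (forall i, measurable_fun setT (fun x => F x ord0 i)) ->
  measurable_fun setT (F : X -> borel_rV).
Proof.
move=> mF; apply: measurable_generated => U oU.
apply: (measurable_coordinates (coord := fun i (x : 'rV[R]_n) => x ord0 i)) => //.
move=> w0 V /nbhs_ballP[r /= r0 hr]; exists r => // w hw; apply: hr; split=> // i j.
by rewrite ord1 -ball_normE /ball_/= distrC; exact: hw.
Qed.

Lemma measurable_phase d (X : measurableType d) (F : X -> phase R n) :
  (forall i, measurable_fun setT (fun x => (F x).1 ord0 i)) ->
  (forall i j, measurable_fun setT (fun x => (F x).2 i j)) ->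
  measurable_fun setT (F : X -> borel_phase R n).
Proof.
move=> mF1 mF2.
apply: measurable_generated => U oU.
apply: (measurable_coordinates
  (coord := fun (k : 'I_n + 'I_n * 'I_n) (z : phase R n) =>
    match k with inl i => z.1 ord0 i | inr ij => z.2 ij.1 ij.2 end)) => //.
  move=> w0 V /nbhs_ballP[r /= r0 hr]; exists r => // w hw; apply: hr.
  split; split=> // i j; rewrite ?ord1 -ball_normE /ball_/= distrC.
    exact: (hw (inl j)).
  exact: (hw (inr (i, j))).
by case=> [i|[i j]].
Qed.

Lemma continuous_measurable_rV (f : 'rV[R]_n -> R) : continuous f ->
  measurable_fun setT (f : borel_rV -> R).
Proof.
move=> /continuousP cf; apply: (measurability _ (RGenOpens.measurableE R)).
move=> _ [_ [a [b ->] <-]]; rewrite setTI.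
by apply: sub_gen_smallest; apply: cf; exact: interval_open.
Qed.

End MeasurableCoordinates.

Section FiniteMeasure.
Context d (Y : measurableType d) {R : realType}.
Variable (nu : {measure set Y -> \bar R}).
Hypothesis fin : fin_num_fun nu.

(** A copy of nu indexed by the proof of its finiteness, to which the finite-measure instance is
    attached. *)
Definition fin_measure (h : fin_num_fun nu) : set Y -> \bar R := nu.
HB.instance Definition _ := Measure.on (fin_measure fin).
HB.instance Definition _ := Measure_isFinite.Build d Y R (fin_measure fin) fin.

Lemma finite_measure_of : exists nu' : {finite_measure set Y -> \bar R},
  forall A, nu' A = nu A.
Proof. by exists (fin_measure fin). Qed.

End FiniteMeasure.

Section ImageMeasure.
Context d1 d2 (X : measurableType d1) (Y : measurableType d2) {R : realType}.

Lemma exists_pushforward (mu : {measure set X -> \bar R}) (phi : X -> Y) :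
  measurable_fun setT phi -> exists nu : {measure set Y -> \bar R},
    (forall A, nu A = mu (phi @^-1` A)) /\
    forall f : Y -> \bar R, measurable_fun setT f ->
      mu.-integrable setT (f \o phi) ->
      (\int[nu]_y f y = \int[mu]_x f (phi x))%E.
Proof.
move=> mphi.
exists (measure_function_pushforward__canonical__measure_function_Measure mu mphi).
by split=> // f mf fi; apply: (integral_pushforward mphi).
Qed.

(** The image of mu restricted to D. For integrands bounded along D, integrability follows from the
    finiteness of [mu D]. *)
Lemma exists_image_measure (mu : {measure set X -> \bar R}) (D : set X)
    (phi : X -> Y) : measurable D -> measurable_fun setT phi ->
  (mu D < +oo)%E ->
  exists nu : {finite_measure set Y -> \bar R},
    (forall A, nu A = mu (phi @^-1` A `&` D)) /\
    forall (f : Y -> R) (M : R), measurable_fun setT f ->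
      (forall x, D x -> `|f (phi x)| <= M) ->
      (\int[nu]_y (f y)%:E = \int[mu]_(x in D) (f (phi x))%:E)%E.
Proof.
move=> mD mphi muD; pose mu' : {measure set X -> \bar R} := mrestr mu mD.
have [nu [hnu inu]] := exists_pushforward mu' mphi.
have fin : fin_num_fun nu.
  move=> A mA; rewrite ge0_fin_numE ?measure_ge0// hnu; apply: le_lt_trans muD.
  rewrite /mu' /= /mrestr; apply: le_measure; rewrite ?inE//.
  by apply: measurableI => //; rewrite -[X in measurable X]setTI; exact: mphi.
have [nu' nu'E] := finite_measure_of fin.
exists nu'; split; first by move=> A; rewrite nu'E hnu.
move=> f M mf hM; have mfp : measurable_fun setT (fun x => (f (phi x))%:E).
  by apply/measurable_EFinP; exact: measurableT_comp.
have mu'E : (\int[mu']_(x in D) (f (phi x))%:E = \int[mu]_(x in D) (f (phi x))%:E)%E.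
  by apply: eq_measure_integral => A mA AD; rewrite /mu' /= /mrestr setIidl.
have mu'D : mu' (~` D) = 0%E by rewrite /mu' /= /mrestr setICl measure0.
have iD : mu'.-integrable D (EFin \o (f \o phi)).
  apply: measurable_bounded_integrable => //.
  - by rewrite /mu' /= /mrestr setIid.
  - by apply: measurable_funTS; exact: measurableT_comp.
  - by exists M; split; [exact: num_real|move=> M' MM' x Dx; exact: le_trans (hM x Dx) (ltW MM')].
have setTDC : setT `\` ~` D = D by rewrite setDE setCK setTI.
have iT : mu'.-integrable setT (EFin \o (f \o phi)).
  have := @negligible_integrable _ _ _ mu' setT (~` D) (EFin \o (f \o phi)).
  by rewrite setTDC; move=> -> //; exact: measurableC.
rewrite (eq_measure_integral nu) => [|A _ _]; last exact: nu'E.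
rewrite (inu (EFin \o f))//; last exact/measurable_EFinP.
rewrite -mu'E (@negligible_integral _ _ _ mu' _ (~` D))//; last exact: measurableC.
by rewrite setTDC.
Qed.

End ImageMeasure.

(** * Chain rule for finite combinations of fixed vectors *)

Section ChainRule.
Context {R : realType} {V W : normedModType R}.

Lemma diff_combination (K : Type) (s : seq K) (tau : K -> V -> R) (b : K -> W)
    (w0 : W) (x : V) : (forall k, C1 (tau k)) ->
  differentiable (fun y => w0 + \sum_(k <- s) tau k y *: b k) x /\
  forall v, 'D_v (fun y => w0 + \sum_(k <- s) tau k y *: b k) x =
            \sum_(k <- s) 'D_v (tau k) x *: b k.
Proof.
move=> tC; elim: s => [|k s [dT DT]].
  under eq_fun do rewrite big_nil addr0; split=> [|v]; first exact: differentiable_cst.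
  by rewrite big_nil; exact: (derive_cst w0 x v).
have dk : differentiable (fun y => tau k y *: b k) x.
  by apply: differentiableZl; case: (tC k).
have E : (fun y => w0 + \sum_(j <- k :: s) tau j y *: b j) =
    (fun y => tau k y *: b k) + (fun y => w0 + \sum_(j <- s) tau j y *: b j).
  by apply/funext => y; rewrite big_cons /= addrCA.
rewrite E; split=> [|v]; first exact: differentiableD.
rewrite deriveD; [|exact: diff_derivable|exact: diff_derivable].
rewrite big_cons DT; congr (_ + _).
have dtk : differentiable (tau k) x by case: (tC k).
by rewrite (deriveE _ dk) diffZl//= -deriveE.
Qed.

(** The derivative comes out in terms of f differentiated along the fixed vectors b, chosen later as
    the coordinate directions that occur in the first variation. *)
Lemma C1_comp_combination (K : Type) (s : seq K) (tau : K -> V -> R) (b : K -> W)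
    (w0 : W) (T : V -> W) (f : W -> R) : C1 f -> (forall k, C1 (tau k)) ->
  (forall y, T y = w0 + \sum_(k <- s) tau k y *: b k) ->
  C1 (fun x => f (T x)) /\ forall v x,
    'D_v (fun x => f (T x)) x = \sum_(k <- s) 'D_v (tau k) x * 'D_(b k) f (T x).
Proof.
move=> fC tC TE; have [df cf] := fC.
have {}TE : T = fun y => w0 + \sum_(k <- s) tau k y *: b k by apply/funext.
have dT x : differentiable T x by rewrite TE; case: (diff_combination s b w0 x tC).
have DT v x : 'D_v T x = \sum_(k <- s) 'D_v (tau k) x *: b k.
  by rewrite TE; case: (diff_combination s b w0 x tC).
have dfT x : differentiable (f \o T) x by exact: differentiable_comp.
have E v x : 'D_v (fun x => f (T x)) x =
    \sum_(k <- s) 'D_v (tau k) x * 'D_(b k) f (T x).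
  rewrite (deriveE v (dfT x)) diff_comp//= -(deriveE v (dT x)) DT.
  rewrite linear_sum; apply: eq_bigr => k _.
  by rewrite linearZ/= -deriveE.
split; last exact: E.
split=> [x|v]; first exact: dfT.
rewrite (_ : 'D_v _ = fun x => \sum_(k <- s) 'D_v (tau k) x * 'D_(b k) f (T x)).
  apply: continuous_sumR => k x; apply: cvgM; first by case: (tC k) => _; exact.
  apply: (@continuous_comp _ _ _ T ('D_(b k) f)); last exact: cf.
  exact: differentiable_continuous.
exact/funext/E.
Qed.

End ChainRule.

(** * Integration over a coordinate cube *)

Section SetCoordinate.
Context {R : realType} {n : nat}.
Implicit Types (y : 'rV[R]_n) (i j : 'I_n) (t : R).

Definition set_coord i t y : 'rV[R]_n := \row_k (if k == i then t else y ord0 k).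

Lemma derive_coord (v y : 'rV[R]_n) i : 'D_v (fun y => y ord0 i) y = v ord0 i.
Proof. by apply: derive_along => t; rewrite !mxE. Qed.

Lemma set_coord_sum i t y : set_coord i t y =
  0 + \sum_k (if k == i then t else y ord0 k) *: delta_mx 0 k.
Proof.
rewrite add0r [LHS]row_sum_delta; apply: eq_bigr => k _.
by rewrite /set_coord mxE.
Qed.

Lemma C1_set_coord i t (f : 'rV[R]_n -> R) : C1 f ->
  C1 (fun y => f (set_coord i t y)) /\
  forall j y, j != i -> 'D_(delta_mx 0 j) (fun y => f (set_coord i t y)) y =
    'D_(delta_mx 0 j) f (set_coord i t y).
Proof.
move=> fC; pose tau (k : 'I_n) (y : 'rV[R]_n) := if k == i then t else y ord0 k.
have tC k : C1 (tau k).
  by rewrite /tau; case: (k == i); [exact: (C1_cst t)|exact: C1_rV].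
have [h E] := C1_comp_combination fC tC (@set_coord_sum i t).
split=> [|j y ji]; first exact: h.
rewrite E (bigD1 j)//= [X in _ + X]big1 => [|k kj].
  by rewrite addr0 /tau (negbTE ji) derive_coord mxE !eqxx mul1r.
rewrite /tau; case: (k == i); last by rewrite derive_coord mxE (negbTE kj) andbF mul0r.
by rewrite (derive_cst t y (delta_mx 0 j)) mul0r.
Qed.

Lemma is_derive_set_coord i t y (f : 'rV[R]_n -> R) : C1 f ->
  is_derive t 1 (fun s => f (set_coord i s y)) ('D_(delta_mx 0 i) f (set_coord i t y)).
Proof.
move=> [df _]; apply: is_derive_curve; last exact: df.
rewrite (_ : (fun s => _) = fun s => set_coord i 0 y + s *: delta_mx 0 i).
  exact: is_derive_line.
apply/funext => s; apply/rowP => k; rewrite !mxE eqxx/=.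
by case: (k == i); rewrite ?add0r ?mulr1// mulr0 addr0.
Qed.

Local Notation rV := (@borel_rV R n).
Lemma measurable_set_coord i :
  measurable_fun setT (fun z : @borel_rV R n * R => set_coord i z.2 z.1 : @borel_rV R n).
Proof.
apply: measurable_rV => k.
under eq_fun do rewrite mxE.
case: (k == i); first exact: measurable_snd.
have mk : measurable_fun setT ((fun y : 'rV[R]_n => y ord0 k) : rV -> R).
  by apply: continuous_measurable_rV; apply: C1_continuous; exact: C1_rV.
exact: (measurableT_comp mk measurable_fst).
Qed.

End SetCoordinate.

Section BoxMeasure.
Context {R : realType} {n : nat} {L : R}.
Hypothesis L2 : 2 <= L.
Local Notation rV := (@borel_rV R n).

Lemma exists_interval_measure (c : R) : 0 < c -> exists lam : {finite_measure set R -> \bar R},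
  (forall a b : R, 0 <= a -> a < b -> b <= c -> (0 < lam `[a, b]%classic)%E) /\
  (forall a : R, 0 <= a -> a <= c -> lam `[0%R, a[%classic = a%:E) /\
  forall (f : R -> R) (M : R), measurable_fun setT f ->
    (forall x : R, x \in `[- c, c] -> `|f x| <= M) ->
    (\int[lam]_x (f x)%:E = \int[lebesgue_measure]_(x in `[(- c)%R, c]) (f x)%:E)%E.
Proof.
move=> c0.
have fin : (@lebesgue_measure R `[(- c)%R, c]%classic < +oo)%E.
  by rewrite lebesgue_measure_itv/= lte_fin; case: ifP => _; rewrite ?ltry// -EFinB ltry.
have [lam [hlam ilam]] := @exists_image_measure _ _ _ (R : measurableType _) R
  (@lebesgue_measure R) `[(- c)%R, c]%classic idfun (measurable_itv _)
  (@measurable_id _ _ _) fin.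
exists lam; split; [move=> a b a0 ab bc|split=> [a a0 ac|f M mf hM]]; last exact: (ilam f M).
  2: rewrite hlam preimage_id setIidl => [|x]; last first.
  2:   by rewrite /= !in_itv/= => /andP[h1 h2]; apply/andP; split; lra.
  2: rewrite /= lebesgue_measure_itv/= lte_fin; case: ltP => h; first by rewrite sube0.
  2: by rewrite (@le_anti _ _ a 0)// h a0.
rewrite hlam preimage_id setIidl => [|x]; last first.
  by rewrite /= !in_itv/= => /andP[h1 h2]; apply/andP; split; lra.
by rewrite /= lebesgue_measure_itv/= lte_fin ab -EFinB lte_fin subr_gt0.
Qed.

(** What is needed of Lebesgue measure on the cube [-L, L]^s inside the coordinate subspace of s: it
    lives on that subspace, derivatives of functions vanishing at the faces integrate to 0, and
    [1, 2]^s has positive measure. *)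
Definition box_spec (s : seq 'I_n) (P : {finite_measure set rV -> \bar R}) :=
  [/\ P (~` [set y : 'rV[R]_n | forall i, i \notin s -> y ord0 i = 0]) = 0%E,
      forall (j : 'I_n) (F : 'rV[R]_n -> R) (M : R), j \in s -> C1 F ->
        (forall y : 'rV[R]_n, `|'D_(delta_mx 0 j) F y| <= M) ->
        (forall y : 'rV[R]_n, L <= `|y ord0 j| -> F y = 0) ->
        (\int[P]_y ('D_(delta_mx 0 j) F y)%:E = 0)%E
    & (0 < P [set y : 'rV[R]_n | forall i, i \in s -> (1 <= y ord0 i <= 2)%R])%E].

Lemma measurable_closed_rV (A : set 'rV[R]_n) : closed A -> measurable (A : set rV).
Proof.
move=> cA; rewrite -(setCK A); apply: measurableC; apply: sub_gen_smallest.
exact: closed_openC.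
Qed.

Lemma closed_coords (s : pred 'I_n) (B : set R) : closed B ->
  closed [set y : 'rV[R]_n | forall i, s i -> B (y ord0 i)].
Proof.
move=> cB; rewrite (_ : [set _ | _] =
  \bigcap_(i in [set i | s i]) ((fun y : 'rV[R]_n => y ord0 i) @^-1` B)).
  apply: closed_bigI => i _; apply: closed_comp => // y _.
  by apply: C1_continuous; exact: C1_rV.
by apply/seteqP; split=> y /= h i; exact: h.
Qed.

(** Adds one coordinate by a product with [lam]. Both orders of integration are needed: the new
    coordinate is innermost for derivatives along i, outermost for derivatives along the old
    directions. *)
Lemma box_integral_step (P : {finite_measure set rV -> \bar R})
    (lam : {finite_measure set R -> \bar R}) (i : 'I_n) :
  exists P' : {finite_measure set rV -> \bar R},
   (forall A, P' A = (P \x lam)%E [set z | A (set_coord i z.2 z.1)]) /\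
   forall (f : 'rV[R]_n -> R) (M : R), continuous f -> (forall y : 'rV[R]_n, `|f y| <= M) ->
     (\int[P']_y (f y)%:E = \int[lam]_t \int[P]_y (f (set_coord i t y))%:E)%E /\
     (\int[P']_y (f y)%:E = \int[P]_y \int[lam]_t (f (set_coord i t y))%:E)%E.
Proof.
have fin : ((P \x lam)%E setT < +oo)%E.
  rewrite -setXTT product_measure1E//; apply: lte_mul_pinfty => //.
    by rewrite ge0_fin_numE ?measure_ge0//; exact: fin_num_fun_lty.
  exact: fin_num_fun_lty.
have [P' [hP' iP']] := exists_image_measure measurableT (measurable_set_coord i) fin.
exists P'; split=> [A|f M cf hM]; first by rewrite hP' setIT.
have mf : measurable_fun setT (f : rV -> R) by exact: continuous_measurable_rV.
rewrite (iP' f M)//.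
pose g (z : rV * R) := f (set_coord i z.2 z.1).
have intf : (P \x lam)%E.-integrable setT (EFin \o g).
  apply: measurable_bounded_integrable => //.
  - exact: (measurableT_comp mf (measurable_set_coord i)).
  - by exists M; split; [exact: num_real|move=> M' MM' x _; exact: le_trans (hM _) (ltW MM')].
split.
  exact/esym/(integral21_prod_meas1 intf).
exact/esym/(integral12_prod_meas1 intf).
Qed.

Lemma interval_derivative0 (lam : {finite_measure set R -> \bar R}) (i : 'I_n)
    (F : 'rV[R]_n -> R) (y : 'rV[R]_n) (M : R) :
  (forall (f : R -> R) (M : R), measurable_fun setT f ->
    (forall x : R, x \in `[- L, L] -> `|f x| <= M) ->
    (\int[lam]_x (f x)%:E = \int[lebesgue_measure]_(x in `[(- L)%R, L]) (f x)%:E)%E) ->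
  C1 F -> (forall y : 'rV[R]_n, `|'D_(delta_mx 0 i) F y| <= M) ->
  (forall y : 'rV[R]_n, L <= `|y ord0 i| -> F y = 0) ->
  (\int[lam]_t ('D_(delta_mx 0 i) F (set_coord i t y))%:E = 0)%E.
Proof.
move=> hlam FC FM F0.
pose c t := set_coord i t y; pose g t := 'D_(delta_mx 0 i) F (c t).
have dF (t : R) : is_derive t (1 : R) (fun s => F (c s)) (g t) by exact: is_derive_set_coord.
have cc : continuous c.
  move=> t; apply/differentiable_continuous/derivable1_diffP.
  rewrite (_ : c = fun s => set_coord i 0 y + s *: delta_mx 0 i).
    by case: (is_derive_line (set_coord i 0 y) (delta_mx 0 i) t).
  apply/funext => s; apply/rowP => k; rewrite !mxE eqxx/=.
  by case: (k == i); rewrite ?add0r ?mulr1// mulr0 addr0.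
have cg : continuous g.
  by move=> t; apply: (@continuous_comp _ _ _ c ('D_(delta_mx 0 i) F)); [exact: cc|case: FC => _; exact].
have cF : continuous (fun s => F (c s)).
  by move=> t; apply: (@continuous_comp _ _ _ c F); [exact: cc|exact: C1_continuous].
rewrite (hlam g M (continuous_measurable_fun cg) (fun t _ => FM (c t))).
have e t : L <= `|t| -> F (c t) = 0.
  by move=> h; apply: F0; rewrite /c mxE eqxx.
have L0 : 0 < L by exact: lt_le_trans L2.
rewrite (@continuous_FTC2 _ g (fun s => F (c s)) (- L) L).
- by rewrite !e ?normrN ?(gtr0_norm L0)// subee.
- by rewrite gtrN.
- exact: continuous_subspaceT.
- split=> [t _||]; first by case: (dF t).
  + by apply: cvg_at_right_filter; exact: cF.
  + by apply: cvg_at_left_filter; exact: cF.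
- by move=> t _; rewrite derive1E; exact: derive_val.
Qed.

Lemma exists_box_measure (s : seq 'I_n) : uniq s ->
  exists P : {finite_measure set rV -> \bar R}, box_spec s P.
Proof.
have [lam [lam12 [_ ilam]]] := exists_interval_measure (lt_le_trans (ltr0n R 2) L2).
elim: s => [_|i s IH /= /andP[ins us]].
  exists (dirac (0 : rV)); split=> //.
  - by rewrite /= /dirac indicE memNset//= => h; apply: h => i _; rewrite mxE.
  - by rewrite /= /dirac indicE mem_set//= lte_fin.
have [P [P0 PD P12]] := IH us.
have [P' [hP' iP']] := box_integral_step P lam i.
exists P'; split.
- rewrite hP'; apply/eqP; rewrite eq_le measure_ge0 andbT.
  pose Z := ~` [set y : 'rV[R]_n | forall i, i \notin s -> y ord0 i = 0].
  have mZ : measurable (Z : set rV).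
    apply: measurableC; apply: measurable_closed_rV.
    exact: (@closed_coords [pred i | i \notin s] [set x : R | x = 0] (@closed_eq _ 0)).
  apply: (@le_trans _ _ ((P \x lam)%E (Z `*` setT))); last first.
    have PZ : P Z = 0%E by exact: P0.
    have -> : (P \x lam)%E (Z `*` setT) = (P Z * lam setT)%E.
      exact: product_measure1E.
    by rewrite PZ mul0e.
  apply: le_measure; rewrite ?inE.
  + rewrite -[X in measurable X]setTI.
    apply: (measurable_set_coord i) => //.
    apply: measurableC; apply: measurable_closed_rV.
    exact: (@closed_coords [pred j | j \notin i :: s] [set x : R | x = 0] (@closed_eq _ 0)).
  + exact: measurableX.
  move=> [y t] /= h; split=> //= hy; apply: h => j.
  by rewrite inE negb_or mxE => /andP[/negbTE -> /hy].
- move=> j F M; rewrite inE => /orP[/eqP -> FC FM F0|js FC FM F0].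
    have [_ ->] := iP' _ M (FC.2 (delta_mx 0 i)) FM.
    by apply: integral0_eq => y _; exact: interval_derivative0 FC FM F0.
  have ji : j != i by apply: contraNneq ins => <-.
  have [-> _] := iP' _ M (FC.2 (delta_mx 0 j)) FM.
  apply: integral0_eq => t _; have [h1 h2] := C1_set_coord i t FC.
  under eq_integral do rewrite -h2//.
  apply: (PD j (fun y => F (set_coord i t y)) M) => // y; first by rewrite h2.
  by move=> hy; apply: F0; rewrite mxE (negbTE ji).
- rewrite hP'.
  pose A := [set y : 'rV[R]_n | forall i, i \in s -> 1 <= y ord0 i <= 2].
  have c12 : closed [set x : R | 1 <= x <= 2].
    by rewrite (_ : [set _ | _] = `[1, 2]%classic); [exact: interval_closed|rewrite set_itvE].
  have mA : measurable (A : set rV).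
    apply: measurable_closed_rV.
    exact: (@closed_coords [pred i | i \in s] [set x | 1 <= x <= 2]).
  apply: (@lt_le_trans _ _ ((P \x lam)%E (A `*` `[1, 2]%classic))).
    by rewrite product_measure1E//; apply: mule_gt0 => //; apply: lam12; rewrite ?ler01 ?ltr1n.
  apply: le_measure; rewrite ?inE.
  + exact: measurableX.
  + rewrite -[X in measurable X]setTI.
    apply: (measurable_set_coord i) => //; apply: measurable_closed_rV.
    exact: (@closed_coords [pred j | j \in i :: s] [set x | 1 <= x <= 2]).
  move=> [y t] /= [hA]; rewrite in_itv/= => ht j.
  by rewrite inE mxE; case: eqP => //= _; exact: hA.
Qed.

End BoxMeasure.

(** * Algebra of the tangent planes of spheres *)

Section SphereAlgebra.
Context {R : realType} {n : nat}.
Variables (m : nat) (rho : R).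
Hypothesis mn : (m < n)%N.
Hypothesis rho0 : 0 < rho.
Local Notation inS := (fun j : 'I_n => (j < m.+1)%N).

Lemma sum_delta (F : 'I_n -> R) i : \sum_j (j == i)%:R * F j = F i.
Proof.
rewrite (bigD1 i)//= eqxx mul1r big1 ?addr0// => j /negbTE ->.
by rewrite mul0r.
Qed.

Definition coord_proj : 'M[R]_n := \matrix_(i, j) ((i == j) && (i < m.+1)%N)%:R.

(** For y in the span of the first m + 1 coordinates and k = 1 / |y|^2, the projection to the
    tangent space at y of the m-sphere through y. Keeping k free allows a C1 substitute for 1 /
    |y|^2 near the origin. *)
Definition sphere_proj (k : R) (y : 'rV[R]_n) : 'M[R]_n :=
  coord_proj - k *: (y^T *m y).

Lemma sphere_projE k y i j : sphere_proj k y i j =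
  ((i == j) && (i < m.+1)%N)%:R - k * (y ord0 i * y ord0 j).
Proof. by rewrite !mxE big_ord1 !mxE. Qed.

Lemma sum_inS : \sum_(j < n | inS j) (1 : R) = m.+1%:R.
Proof. by rewrite -(big_ord_widen n (fun=> 1 : R) mn) sumr_const card_ord. Qed.

Variables (y : 'rV[R]_n) (k : R).
Hypothesis yS : forall i : 'I_n, ~~ (i < m.+1)%N -> y ord0 i = 0.
Hypothesis k1 : k * dot y y = 1.
Local Notation P := (sphere_proj k y).

Lemma sphere_proj_sym : P^T = P.
Proof.
apply/matrixP => i j; rewrite mxE !sphere_projE (mulrC (y ord0 j)); congr (_%:R - _).
by rewrite eq_sym; case: eqP => // ->.
Qed.

Lemma coord_proj_fix : y *m coord_proj = y.
Proof.
apply/rowP => j; rewrite mxE; under eq_bigr => i _ do rewrite mxE mulrC.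
under eq_bigr => i _ do rewrite -mulnb natrM -mulrA.
rewrite sum_delta; have := @yS j; case: (j < m.+1)%N => h; first by rewrite mul1r.
by rewrite mul0r h.
Qed.

Lemma coord_proj_idem : coord_proj *m coord_proj = coord_proj.
Proof.
apply/matrixP => i j; rewrite !mxE; under eq_bigr => l _ do rewrite !mxE.
rewrite (bigD1 i)//= eqxx/= big1 ?addr0 => [|l li].
  by case: (i < m.+1)%N; rewrite ?mul1r// mul0r andbF.
by rewrite eq_sym (negbTE li) mul0r.
Qed.

Lemma sphere_proj_kill : y *m P = 0.
Proof.
rewrite mulmxBr coord_proj_fix -scalemxAr mulmxA dotmx mul_scalar_mx scalerA k1.
by rewrite scale1r subrr.
Qed.

Lemma sphere_proj_Grass : Grass m P.
Proof.
rewrite GrassE; split; first split.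
- exact: sphere_proj_sym.
- rewrite /= {1}/sphere_proj mulmxBl -scalemxAl -mulmxA sphere_proj_kill mulmx0.
  rewrite scaler0 subr0 mulmxBr coord_proj_idem -scalemxAr mulmxA.
  have cT : coord_proj^T = coord_proj.
    apply/matrixP => i j; rewrite !mxE eq_sym; congr _%:R.
    by case: eqP => // ->.
  have -> : coord_proj *m y^T = y^T.
    by rewrite -[LHS]trmxK trmx_mul trmxK cT coord_proj_fix.
  by [].
- rewrite /= /mxtrace; under eq_bigr => i _ do rewrite sphere_projE eqxx/=.
  rewrite sumrB -mulr_sumr k1 -[X in X - _ = _]/(\sum_i _).
  rewrite (_ : \sum_(i < n) ((i < m.+1)%N)%:R = m.+1%:R).
    by rewrite -natr1 addrK.
  by rewrite -sum_inS [RHS]big_mkcond; apply: eq_bigr => i _; case: ifP.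
Qed.

Lemma sphere_kill i : \sum_j P i j * y ord0 j = 0.
Proof.
have /rowP/(_ i) := sphere_proj_kill; rewrite !mxE => h.
rewrite -[RHS]h; apply: eq_bigr => j _.
by rewrite -[in LHS]sphere_proj_sym mxE mulrC.
Qed.

Lemma sphere_off (i j : 'I_n) : ~~ (j < m.+1)%N -> P i j = 0.
Proof.
move=> hj; rewrite sphere_projE (yS hj) !mulr0 subr0.
by case: eqP => //= ->; rewrite (negbTE hj).
Qed.

(** Curvature as derivative of the tangent plane: the entry (j, l) of P differentiated along P e_i,
    see [sum_proj_dproj]. The factor 1 / rho converts derivatives in y to derivatives in the point c
    + rho y. *)
Definition sphere_coef (i j l : 'I_n) : R :=
  - (k / rho) * (y ord0 j * P i l + P i j * y ord0 l).

Lemma sphere_trace i : rho * \sum_l sphere_coef l l i = - (m%:R * k * y ord0 i).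
Proof.
rewrite -mulr_sumr big_split/= -mulr_suml.
have -> : \sum_l y ord0 l * P l i = 0.
  rewrite -[RHS](sphere_kill i); apply: eq_bigr => l _.
  by rewrite -[in LHS]sphere_proj_sym mxE mulrC.
have -> : \sum_l P l l = m%:R.
  by have := sphere_proj_Grass; rewrite GrassE => -[_].
rewrite add0r; have r0 : rho != 0 by rewrite gt_eqF.
by field.
Qed.

Variable k' : R.
Hypothesis k'E : k' = - k ^+ 2.

(** The derivative along y_j of the entry (i, l) of [sphere_proj] when k is a function of |y|^2 with
    derivative k'; for k = 1 / s this derivative is [- k ^+ 2]. *)
Definition dproj (i l j : 'I_n) : R :=
  - (k' * (2 * y ord0 j) * (y ord0 i * y ord0 l) +
     k * ((j == i)%:R * y ord0 l + y ord0 i * (j == l)%:R)).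

Lemma sum_dproj i : \sum_(j < n | inS j) dproj i j j = - (m%:R * k * y ord0 i).
Proof.
rewrite /dproj sumrN; congr (- _); rewrite big_split/= -mulr_sumr big_split/=.
have E0 (F : 'I_n -> R) : (forall j : 'I_n, ~~ (j < m.+1)%N -> F j = 0) ->
    \sum_(j < n | inS j) F j = \sum_j F j.
  by move=> hF; rewrite big_mkcond; apply: eq_bigr => j _; case: ifPn => // /hF.
have -> : \sum_(j < n | inS j) k' * (2 * y ord0 j) * (y ord0 i * y ord0 j) =
    2 * k' * y ord0 i * dot y y.
  rewrite E0 => [|j /yS ->]; last by rewrite !mulr0.
  by rewrite /dot mulr_sumr; apply: eq_bigr => j _; ring.
have -> : \sum_(j < n | inS j) (j == i)%:R * y ord0 j = y ord0 i.
  by rewrite E0 ?sum_delta// => j /yS ->; rewrite mulr0.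
have -> : \sum_(j < n | inS j) y ord0 i * (j == j)%:R = y ord0 i * m.+1%:R.
  by rewrite -mulr_sumr -sum_inS; congr (_ * _); apply: eq_bigr => j _; rewrite eqxx.
rewrite k'E -natr1.
have -> : 2 * - k ^+ 2 * y ord0 i * dot y y = - 2 * k * y ord0 i * (k * dot y y) by ring.
by rewrite k1; ring.
Qed.

Lemma sum_proj_dproj i p q :
  \sum_j P i j * dproj p q j = - k * (P i p * y ord0 q + y ord0 p * P i q).
Proof.
have -> : \sum_j P i j * dproj p q j =
    (- (k' * 2 * y ord0 p * y ord0 q)) * (\sum_j P i j * y ord0 j)
    + - k * (y ord0 q * \sum_j (j == p)%:R * P i j + y ord0 p * \sum_j (j == q)%:R * P i j).
  rewrite !mulr_sumr -big_split/= mulr_sumr -big_split/=.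
  by apply: eq_bigr => j _; rewrite /dproj; ring.
by rewrite sphere_kill !sum_delta; ring.
Qed.

(** Here f, X and Q stand for a test field and its derivatives in x and in P. The left side is the
    divergence of the field projected by P: differentiating P yields the trace term, differentiating
    the field through its plane argument yields the D_P term. *)
Lemma sphere_divergence (f : 'I_n -> R) (X : 'I_n -> 'I_n -> R)
    (Q : 'I_n -> 'I_n -> 'I_n -> R) :
  \sum_(j < n | inS j) \sum_i (dproj i j j * f i +
     P i j * (rho * X i j + \sum_p \sum_q dproj p q j * Q i p q)) =
  rho * (\sum_i \sum_j \sum_l Q i l j * sphere_coef i j l +
    \sum_i (\sum_l sphere_coef l l i) * f i + \sum_i \sum_j X i j * P i j).
Proof.
have r0 : rho != 0 by rewrite gt_eqF.
rewrite exchange_big/= !mulrDr !mulr_sumr -!big_split/=; apply: eq_bigr => i _.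
rewrite big_split/= -mulr_suml sum_dproj mulrA sphere_trace addrAC addrC; congr (_ + _).
have -> : \sum_(j < n | inS j) P i j * (rho * X i j + \sum_p \sum_q dproj p q j * Q i p q)
   = \sum_j P i j * (rho * X i j + \sum_p \sum_q dproj p q j * Q i p q).
  rewrite big_mkcond; apply: eq_bigr => j _; case: ifPn => // /(sphere_off i) ->.
  by rewrite mul0r.
under [LHS]eq_bigr => j _ do rewrite mulrDr.
rewrite big_split/= addrC; congr (_ + _); last first.
  by rewrite mulr_sumr; apply: eq_bigr => j _; ring.
under [LHS]eq_bigr => j _ do rewrite mulr_sumr.
rewrite [LHS]exchange_big/= [RHS]mulr_sumr.
under [RHS]eq_bigr => j _ do rewrite mulr_sumr.
rewrite [RHS]exchange_big/=; apply: eq_bigr => p _.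
under [LHS]eq_bigr => j _ do rewrite mulr_sumr.
rewrite [LHS]exchange_big/=; apply: eq_bigr => q _.
under [LHS]eq_bigr => j _ do rewrite mulrA.
rewrite -mulr_suml sum_proj_dproj /sphere_coef.
by field.
Qed.

End SphereAlgebra.

(** * Calculus on the shell of spheres *)

Section C1Derivatives.
Context {R : realType} {V : normedModType R}.
Implicit Types (f g : V -> R) (x v : V).

Lemma C1_derivable f x v : C1 f -> derivable f x v.
Proof. by move=> [df _]; exact: diff_derivable. Qed.

Lemma derive_mul f g x v : C1 f -> C1 g ->
  'D_v (fun x => f x * g x) x = 'D_v f x * g x + f x * 'D_v g x.
Proof.
move=> fC gC; rewrite (_ : (fun x => _) = f * g)//.
by rewrite deriveM /=; [rewrite /GRing.scale/= addrC mulrC|exact: C1_derivable|exact: C1_derivable].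
Qed.

Lemma derive_add f g x v : C1 f -> C1 g ->
  'D_v (fun x => f x + g x) x = 'D_v f x + 'D_v g x.
Proof.
move=> fC gC; rewrite (_ : (fun x => _) = f + g)//.
by rewrite deriveD //; exact: C1_derivable.
Qed.

Lemma derive_opp f x v : C1 f -> 'D_v (fun x => - f x) x = - 'D_v f x.
Proof.
by move=> fC; rewrite (_ : (fun x => _) = - f)// deriveN //; exact: C1_derivable.
Qed.

Lemma derive_sub f g x v : C1 f -> C1 g ->
  'D_v (fun x => f x - g x) x = 'D_v f x - 'D_v g x.
Proof. by move=> fC gC; rewrite (derive_add _ _ fC (C1N gC)) derive_opp. Qed.

Lemma derive_const (c : R) x v : 'D_v (fun=> c) x = 0.
Proof. exact: derive_cst. Qed.

Lemma derive_bigsum (I : Type) (s : seq I) (F : I -> V -> R) x v :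
  (forall i, C1 (F i)) ->
  'D_v (fun x => \sum_(i <- s) F i x) x = \sum_(i <- s) 'D_v (F i) x.
Proof.
move=> FC; elim: s => [|i s IH].
  by rewrite big_nil; under eq_fun do rewrite big_nil; exact: (derive_cst (0 : R) x v).
rewrite big_cons -IH (_ : (fun x => _) = F i + (fun x => \sum_(i <- s) F i x)).
  by rewrite deriveD//; apply: C1_derivable => //; exact: C1_sum.
by apply/funext => y; rewrite big_cons.
Qed.

Lemma C1_row n (phi : V -> 'rV[R]_n) i : C1 phi ->
  C1 (fun z => phi z ord0 i) /\
  forall v x, 'D_v (fun z => phi z ord0 i) x = 'D_v phi x ord0 i.
Proof.
move=> [dphi cphi].
have cc : continuous (fun y : 'rV[R]_n => y ord0 i) by exact: C1_continuous (C1_rV i).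
have [dc _] := @C1_rV R n i.
have df x : differentiable ((fun y : 'rV[R]_n => y ord0 i) \o phi) x.
  exact: differentiable_comp.
have E v x : 'D_v (fun z => phi z ord0 i) x = 'D_v phi x ord0 i.
  rewrite (deriveE v (df x)) diff_comp//= -(deriveE v (dphi x)) -(deriveE _ (dc _)).
  exact: derive_coord.
split; last exact: E.
split=> [x|v]; first exact: df.
rewrite (_ : 'D_v _ = fun x => 'D_v phi x ord0 i); last exact/funext/E.
by apply: coord_comp_continuous; exact: cphi.
Qed.

End C1Derivatives.

Section SphereCalculus.
Context {R : realType} {n : nat}.
Variables (m : nat) (c0 : 'rV[R]_n) (rho : R).
Implicit Types (y : 'rV[R]_n) (s : R).

(** Bounds of the shell in terms of |y|^2. On the cube [1, 2]^(m+1) one has m + 1 <= |y|^2 <= 4 (m +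
    1), well between [lo] and [hi], so the density is bounded below there; [lo] > 0 keeps the shell
    off the origin. *)
Definition lo : R := m.+1%:R / 2.
Definition hi : R := 5 * m.+1%:R.

Definition radial s : R := sqramp (s - lo) * sqramp (hi - s).
Definition dradial s : R :=
  2 * ramp (s - lo) * sqramp (hi - s) - sqramp (s - lo) * (2 * ramp (hi - s)).

(* Equal to 1 / s for s >= lo, and smooth for all s. *)
Definition recip s : R := (s + sqramp (lo - s))^-1.
Definition drecip s : R := - recip s ^+ 2 * (1 - 2 * ramp (lo - s)).

Lemma lo_ge : 2^-1 <= lo.
Proof. by rewrite /lo -[leLHS]mul1r ler_pM2r ?invr_gt0// ler1n. Qed.

Lemma recip_den_gt0 s : 0 < s + sqramp (lo - s).
Proof.
have l := lo_ge; have [sl|sl] := leP lo s.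
  by apply: ltr_wpDr; [exact: sqramp_ge0|lra].
rewrite /sqramp ramp_pos ?subr_ge0 ?ltW//.
(* Completing the square: s + (lo - s)^2 >= lo - 1/4 > 0. *)
have : 0 <= (lo - s - 2^-1) ^+ 2 by exact: sqr_ge0.
by nra.
Qed.

Lemma recip_mul s : lo <= s -> recip s * s = 1.
Proof.
move=> ls; rewrite /recip /sqramp ramp_neg ?subr_le0// expr0n addr0 mulVf//.
by have := lo_ge; move=> h; apply: lt0r_neq0; lra.
Qed.

Lemma drecip_far s : lo <= s -> drecip s = - recip s ^+ 2.
Proof. by move=> ls; rewrite /drecip ramp_neg ?subr_le0//; ring. Qed.

Lemma radial0 s : s <= lo \/ hi <= s -> radial s = 0 /\ dradial s = 0.
Proof.
rewrite /radial /dradial /sqramp.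
by case=> h; [rewrite (@ramp_neg _ (s - lo)) ?subr_le0//|
  rewrite (@ramp_neg _ (hi - s)) ?subr_le0//]; split; ring.
Qed.

Lemma radial_ge0 s : 0 <= radial s.
Proof. by apply: mulr_ge0; exact: sqramp_ge0. Qed.

Lemma C1_id : C1 (@id R : R -> R).
Proof. by apply: (@linear_C1 R R idfun) => x; exact: cvg_id. Qed.

Lemma derive_shift (c e s : R) : 'D_(1 : R) (fun t : R => c + e * t) s = e.
Proof. by apply: derive_along => t; rewrite /GRing.scale/=; ring. Qed.

Lemma is_derive_recip s : is_derive s (1 : R) recip (drecip s).
Proof.
have gC : C1 (fun t : R => lo - t) by apply: C1B; [exact: (C1_cst lo)|exact: C1_id].
have [g2C Dg2] := C1_sqramp gC.
have fC : C1 (fun t : R => t + sqramp (lo - t)) by apply: C1D; [exact: C1_id|exact: g2C].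
have Df : 'D_(1 : R) (fun t : R => t + sqramp (lo - t)) s = 1 - 2 * ramp (lo - s).
  rewrite (derive_add _ _ C1_id g2C) derive_id Dg2 (_ : (fun t : R => lo - t) = fun t : R => lo + -1 * t).
    by rewrite derive_shift; ring.
  by apply/funext => t; ring.
pose g (t : R) : R := t + sqramp (lo - t).
have n0 : g s != 0 := lt0r_neq0 (recip_den_gt0 s).
have gd : derivable g s 1 by exact: C1_derivable fC.
have {}Df : 'D_(1 : R) g s = 1 - 2 * ramp (lo - s) := Df.
have E : recip = fun t => (g t)^-1 by [].
apply: DeriveDef; rewrite E.
  exact: (@derivableV _ _ g s 1 n0 gd).
rewrite (@deriveV _ _ g s 1 n0 gd) Df /GRing.scale/= /drecip /recip.
by rewrite exprVn.
Qed.

Lemma recip_continuous : continuous recip.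
Proof.
move=> s; apply: cvgV; first by rewrite lt0r_neq0// recip_den_gt0.
apply: cvgD; first exact: cvg_id.
apply: (@continuous_comp _ _ _ (fun t : R => lo - t) sqramp).
  by apply: cvgB; [exact: cvg_cst|exact: cvg_id].
apply: differentiable_continuous; apply/derivable1_diffP.
by case: (is_derive_sqramp (lo - s)).
Qed.

Lemma drecip_continuous : continuous drecip.
Proof.
rewrite (_ : drecip = fun t => - (recip t * recip t) * (1 - 2 * ramp (lo - t))).
  2: by apply/funext => t; rewrite /drecip expr2.
move=> s; apply: cvgM.
  by apply: cvgN; apply: cvgM; exact: recip_continuous.
apply: cvgB; first exact: cvg_cst.
apply: cvgM; first exact: cvg_cst.
apply: (@continuous_comp _ _ _ (fun t : R => lo - t) ramp); last exact: ramp_continuous.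
by apply: cvgB; [exact: cvg_cst|exact: cvg_id].
Qed.

Definition rsq y : R := dot y y.

Lemma C1_rsq : C1 rsq.
Proof. by apply: C1_sum => i; apply: C1M; exact: C1_rV. Qed.

Lemma derive_rsq j y : 'D_(delta_mx 0 j) rsq y = 2 * y ord0 j.
Proof.
rewrite derive_bigsum => [|i]; last by apply: C1M; exact: C1_rV.
under eq_bigr => i _ do rewrite (derive_mul _ _ (C1_rV i) (C1_rV i)) !derive_coord mxE eqxx/=.
rewrite -[RHS](sum_delta (fun i => 2 * y ord0 i)); apply: eq_bigr => i _.
by ring.
Qed.

Lemma C1_recip : C1 (fun y => recip (rsq y)) /\
  forall j y, 'D_(delta_mx 0 j) (fun y => recip (rsq y)) y = drecip (rsq y) * (2 * y ord0 j).
Proof.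
have [h E] := C1_compR is_derive_recip drecip_continuous C1_rsq.
by split=> // j y; rewrite E derive_rsq.
Qed.

Lemma C1_radial : C1 (fun y => radial (rsq y)) /\
  forall j y, 'D_(delta_mx 0 j) (fun y => radial (rsq y)) y = dradial (rsq y) * (2 * y ord0 j).
Proof.
have fC : C1 (fun y => rsq y - lo) by apply: C1B; [exact: C1_rsq|exact: (C1_cst lo)].
have gC : C1 (fun y => hi - rsq y) by apply: C1B; [exact: (C1_cst hi)|exact: C1_rsq].
have [f2C Df] := C1_sqramp fC; have [g2C Dg] := C1_sqramp gC.
split=> [|j y]; first exact: C1M.
rewrite (derive_mul _ _ f2C g2C) Df Dg.
rewrite (derive_sub _ _ C1_rsq (C1_cst lo)) (derive_sub _ _ (C1_cst hi) C1_rsq).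
rewrite !derive_const derive_rsq /dradial; by ring.
Qed.

Definition sphere_map y : phase R n :=
  (c0 + rho *: y, sphere_proj m (recip (rsq y)) y).

Definition sphere_tau (k : 'I_n + 'I_n * 'I_n) y : R :=
  match k with
  | inl i => rho * y ord0 i
  | inr pq => - (recip (rsq y) * (y ord0 pq.1 * y ord0 pq.2))
  end.

Definition sphere_dir (k : 'I_n + 'I_n * 'I_n) : phase R n :=
  match k with
  | inl i => (delta_mx 0 i, 0)
  | inr pq => (0, delta_mx pq.1 pq.2)
  end.

Lemma C1_sphere_tau k : C1 (sphere_tau k).
Proof.
case: k => [i|[p q]] /=.
  by apply: C1M; [exact: (C1_cst rho)|exact: C1_rV].
apply: C1N; apply: C1M; first exact: C1_recip.1.
by apply: C1M; exact: C1_rV.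
Qed.

Lemma derive_sphere_tau k j y : 'D_(delta_mx 0 j) (sphere_tau k) y =
  match k with
  | inl i => rho * (j == i)%:R
  | inr pq => dproj y (recip (rsq y)) (drecip (rsq y)) pq.1 pq.2 j
  end.
Proof.
have Dc i : 'D_(delta_mx 0 j) (fun y : 'rV[R]_n => y ord0 i) y = (j == i)%:R.
  by rewrite derive_coord mxE eqxx/= eq_sym.
case: k => [i|[p q]].
  rewrite /sphere_tau (derive_mul _ _ (C1_cst rho) (C1_rV i)) Dc.
  by rewrite derive_const mul0r add0r.
have ypq := C1M (@C1_rV R n p) (@C1_rV R n q).
have kpq := C1M C1_recip.1 ypq.
rewrite /sphere_tau (derive_opp _ _ kpq).
rewrite (derive_mul _ _ C1_recip.1 ypq) C1_recip.2.
rewrite (derive_mul _ _ (C1_rV p) (C1_rV q)) !Dc.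
by [].
Qed.

Lemma sphere_map_sum y : sphere_map y =
  (c0, coord_proj m) + \sum_k sphere_tau k y *: sphere_dir k.
Proof.
have fstD (a b : phase R n) : (a + b).1 = a.1 + b.1 by [].
have sndD (a b : phase R n) : (a + b).2 = a.2 + b.2 by [].
have fst_sum (K : finType) (F : K -> phase R n) : (\sum_k F k).1 = \sum_k (F k).1.
  by elim/big_rec2 : _ => // k a b _ <-.
have snd_sum (K : finType) (F : K -> phase R n) : (\sum_k F k).2 = \sum_k (F k).2.
  by elim/big_rec2 : _ => // k a b _ <-.
rewrite [LHS]surjective_pairing [RHS]surjective_pairing fstD sndD fst_sum snd_sum.
rewrite !big_sumType/=; congr (_, _).
  rewrite [X in _ = _ + (_ + X)]big1 => [|k _]; last by rewrite scaler0.
  rewrite addr0 [in LHS](row_sum_delta y) scaler_sumr; congr (_ + _).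
  by apply: eq_bigr => i _; rewrite scalerA.
rewrite [X in _ = _ + (X + _)]big1 => [|k _]; last by rewrite scaler0.
rewrite add0r; congr (_ + _); apply/matrixP => p q.
rewrite !mxE big_ord1 !mxE summxE (bigD1 (p, q))//= !mxE !eqxx mulr1 big1 ?addr0// => -[p' q'].
by rewrite xpair_eqE !mxE (eq_sym p) (eq_sym q) => /negbTE /= ->; rewrite mulr0.
Qed.

Lemma C1_sphere_comp (f : phase R n -> R) : C1 f ->
  C1 (fun y => f (sphere_map y)) /\ forall j y,
  'D_(delta_mx 0 j) (fun y => f (sphere_map y)) y =
    rho * 'D_((delta_mx 0 j, 0) : phase R n) f (sphere_map y) +
    \sum_p \sum_q dproj y (recip (rsq y)) (drecip (rsq y)) p q j *
      'D_((0, delta_mx p q) : phase R n) f (sphere_map y).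
Proof.
move=> fC; have [h E] := C1_comp_combination fC C1_sphere_tau sphere_map_sum.
split=> [|j y]; first exact: h.
rewrite E big_sumType/=; congr (_ + _).
  under eq_bigr => i _ do rewrite (derive_sphere_tau (inl i)) eq_sym -mulrA.
  by rewrite -mulr_sumr sum_delta.
rewrite pair_bigA; apply: eq_bigr => -[p q] _.
by rewrite (derive_sphere_tau (inr (p, q))).
Qed.

Lemma C1_sphere_proj i j : C1 (fun y => sphere_proj m (recip (rsq y)) y i j) /\
  forall l y, 'D_(delta_mx 0 l) (fun y => sphere_proj m (recip (rsq y)) y i j) y =
    dproj y (recip (rsq y)) (drecip (rsq y)) i j l.
Proof.
pose c : R := ((i == j) && (i < m.+1)%N)%:R.
have E : (fun y => sphere_proj m (recip (rsq y)) y i j) =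
    fun y => c + sphere_tau (inr (i, j)) y.
  by apply/funext => y; rewrite sphere_projE.
have tC := C1_sphere_tau (inr (i, j)).
rewrite E; split=> [|l y].
  by apply: C1D; [exact: (C1_cst c)|exact: tC].
by rewrite (derive_add _ _ (C1_cst c) tC) derive_const add0r derive_sphere_tau.
Qed.

(** Component j of the test field transplanted to the shell, projected to the tangent spaces of the
    spheres and weighted by the density, whose support confines it to the shell. *)
Definition sphere_field (f : 'I_n -> phase R n -> R) j y : R :=
  radial (rsq y) * \sum_i sphere_proj m (recip (rsq y)) y i j * f i (sphere_map y).

Lemma C1_sphere_field f j : (forall i, C1 (f i)) -> C1 (sphere_field f j) /\
  forall y, 'D_(delta_mx 0 j) (sphere_field f j) y =
    dradial (rsq y) * (2 * y ord0 j) *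
      \sum_i sphere_proj m (recip (rsq y)) y i j * f i (sphere_map y) +
    radial (rsq y) * \sum_i
      (dproj y (recip (rsq y)) (drecip (rsq y)) i j j * f i (sphere_map y) +
       sphere_proj m (recip (rsq y)) y i j *
       (rho * 'D_((delta_mx 0 j, 0) : phase R n) (f i) (sphere_map y) +
        \sum_p \sum_q dproj y (recip (rsq y)) (drecip (rsq y)) p q j *
          'D_((0, delta_mx p q) : phase R n) (f i) (sphere_map y))).
Proof.
move=> fC.
have pC i := C1_sphere_proj i j; have gC i := C1_sphere_comp (fC i).
have pgC i := C1M (pC i).1 (gC i).1.
have sC : C1 (fun y => \sum_i sphere_proj m (recip (rsq y)) y i j * f i (sphere_map y)).
  by apply: C1_sum => i; exact: pgC.
split=> [|y]; first exact: (C1M C1_radial.1 sC).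
rewrite /sphere_field (derive_mul _ _ C1_radial.1 sC) C1_radial.2; congr (_ + _ * _).
rewrite derive_bigsum => [|i]; last exact: pgC.
apply: eq_bigr => i _.
by rewrite (derive_mul _ _ (pC i).1 (gC i).1) (pC i).2 (gC i).2.
Qed.

End SphereCalculus.

(** * Images of measures with a density *)

Section DensityImage.
Context {R : realType} {n : nat}.
Local Notation rV := (@borel_rV R n).
Local Notation bphase := (borel_phase R n).
Variables (P : {finite_measure set rV -> \bar R}) (h : 'rV[R]_n -> R) (H : R).
Hypothesis hc : continuous h.
Hypothesis h0 : forall y, 0 <= h y.
Hypothesis H0 : 0 < H.
Hypothesis hH : forall y, h y <= H.

(* The density h is realized as the P-measure of the region under its graph. *)
Lemma exists_density_image (T : 'rV[R]_n -> phase R n) :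
  measurable_fun setT (T : rV -> bphase) ->
  exists V : {finite_measure set bphase -> \bar R},
   [/\ forall (A : set bphase) (N : set rV), measurable A -> measurable N ->
         P N = 0%E -> (forall y, A (T y) -> 0 < h y -> N y) -> V A = 0%E,
       forall (A : set rV) (e : R), measurable A -> 0 < e ->
         (forall y, A y -> e <= h y) -> (0 < P A)%E -> (0 < V setT)%E
     & forall (f : phase R n -> R) (M : R), continuous f ->
         (forall y, 0 < h y -> `|f (T y)| <= M) ->
         (\int[V]_z (f z)%:E = \int[P]_y (f (T y) * h y)%:E)%E].
Proof.
move=> mT.
have [lam [_ [lam0 _]]] := exists_interval_measure H0.
have mh : measurable_fun setT (h : rV -> R) by exact: continuous_measurable_rV.
pose D : set (rV * R) := [set z | 0 <= z.2 < h z.1].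
have mD : measurable D.
  have m0 : measurable_fun setT (fun z : rV * R => z.2) by exact: measurable_snd.
  have m1 : measurable_fun setT (fun z : rV * R => h z.1 - z.2).
    by apply: measurable_funB; [exact: (measurableT_comp mh measurable_fst)|exact: measurable_snd].
  rewrite (_ : D = (setT `&` (fun z : rV * R => z.2) @^-1` `[(0 : R), +oo[%classic) `&`
    (setT `&` (fun z : rV * R => h z.1 - z.2) @^-1` `]0, +oo[%classic)).
    apply: measurableI; first exact: (m0 measurableT _ (measurable_itv _)).
    exact: (m1 measurableT _ (measurable_itv _)).
  apply/seteqP; split=> z; rewrite /D /=.
    by move=> /andP[z0 zh]; split; split=> //; rewrite /= in_itv/= andbT ?subr_gt0.
  by move=> [[_ z0] [_ zh]]; move: z0 zh; rewrite /= !in_itv/= !andbT subr_gt0 => -> ->.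
have fin : ((P \x lam)%E D < +oo)%E.
  apply: (@le_lt_trans _ _ ((P \x lam)%E setT)).
    by apply: le_measure; rewrite ?inE.
  rewrite -setXTT product_measure1E//; apply: lte_mul_pinfty => //.
    by rewrite ge0_fin_numE ?measure_ge0//; exact: fin_num_fun_lty.
  exact: fin_num_fun_lty.
have mp : measurable_fun setT (fun z : rV * R => T z.1 : bphase).
  exact: (measurableT_comp mT measurable_fst).
have [V [hV iV]] := exists_image_measure mD mp fin.
exists V; split.
- move=> A N mA mN PN hN; rewrite hV; apply/eqP; rewrite eq_le measure_ge0 andbT.
  have PZ : ((P \x lam)%E (N `*` setT) = 0)%E.
    have -> : (P \x lam)%E (N `*` setT) = (P N * lam setT)%E.
      exact: product_measure1E.
    by rewrite PN mul0e.
  rewrite -PZ; apply: le_measure; rewrite ?inE.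
  + by apply: measurableI => //; rewrite -[X in measurable X]setTI; exact: mp.
  + exact: measurableX.
  + by move=> [y t] /= [Ay /andP[t0 th]]; split=> //; apply: hN => //; exact: le_lt_trans th.
- move=> A e mA e0 Ah PA; rewrite hV preimage_setT setTI.
  pose e' := Num.min e H; have e'0 : 0 < e' by rewrite lt_min e0.
  apply: (@lt_le_trans _ _ ((P \x lam)%E (A `*` `[0%R, e'[%classic))).
    have -> : (P \x lam)%E (A `*` `[0%R, e'[%classic) = (P A * lam `[0%R, e'[%classic)%E.
      exact: product_measure1E.
    have e'H : e' <= H by rewrite /e' ge_min lexx orbT.
    rewrite (lam0 e' (ltW e'0) e'H).
    by apply: mule_gt0 => //; rewrite lte_fin.
  apply: le_measure; rewrite ?inE//; first exact: measurableX.
  move=> [y t] /= [Ay]; rewrite in_itv/= => /andP[t0 te]; rewrite /D /= t0/=.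
  by apply: lt_le_trans te _; apply: le_trans (Ah _ Ay); rewrite ge_min lexx.
- move=> f M cf hM; have mf : measurable_fun setT (f : bphase -> R).
    exact: continuous_measurable_phase.
  have DM z : D z -> `|f (T z.1)| <= M.
    by move=> /andP[t0 th]; apply: hM; exact: le_lt_trans th.
  rewrite (iV f M mf DM); pose g (z : rV * R) : R := f (T z.1).
  have ig : (P \x lam)%E.-integrable D (EFin \o g).
    apply: measurable_bounded_integrable => //.
    + by apply: measurable_funTS; exact: (measurableT_comp mf mp).
    + by exists M; split; [exact: num_real|move=> M' MM' z Dz; exact: le_trans (DM _ Dz) (ltW MM')].
  have ig' : (P \x lam)%E.-integrable setT ((EFin \o g) \_ D) by rewrite -integrable_mkcond.
  rewrite -[LHS]/(\int[(P \x lam)%E]_(z in D) (EFin \o g) z)%E integral_mkcond.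
  rewrite -(integral12_prod_meas1 ig'); apply: eq_integral => y _.
  rewrite /fubini_F (_ : (fun t => _) = (cst (f (T y))%:E) \_ `[0%R, h y[%classic).
    rewrite -integral_mkcond integral_cst; last exact: measurable_itv.
    by rewrite EFinM; congr (_ * _)%E; exact: lam0.
  apply/funext => t; rewrite /patch /=.
  by congr (if _ then _ else _); apply/idP/idP; rewrite !inE /D /= in_itv.
Qed.

End DensityImage.

(** * Curvature and variation of the sphere varifold *)

Section SphereVarifold.
Context {R : realType} {n : nat}.
Variables (m : nat) (c0 : 'rV[R]_n) (rho : R).
Hypothesis mn : (m < n)%N.
Hypothesis rho0 : 0 < rho.
Local Notation bphase := (borel_phase R n).
Local Notation T := (sphere_map m c0 rho).
Local Notation spanS := [set y : 'rV[R]_n | forall i : 'I_n, ~~ (i < m.+1)%N -> y ord0 i = 0].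

Definition sphere_base (z : phase R n) : 'rV[R]_n := rho^-1 *: (z.1 - c0).

(** A curvature assigns a bilinear map to every (x, P), so y is recovered from x and P enters as a
    free matrix; on the image of [sphere_map] the coefficients are [sphere_coef]. Using [recip]
    keeps them continuous at the centre. *)
Definition sphere_bilin (z : phase R n) (u v : 'rV[R]_n) : 'rV[R]_n :=
  - (recip m (rsq (sphere_base z)) / rho) *:
    (dot v (sphere_base z) *: (u *m z.2) + dot (u *m z.2) v *: sphere_base z).

Lemma sphere_bilinP z : bilinear_for *:%R *:%R (sphere_bilin z).
Proof.
split=> [v a u1 u2|u a v1 v2]; rewrite /sphere_bilin.
  rewrite mulmxDl -scalemxAl dotDl dotZl; apply/rowP => i; rewrite !mxE; ring.
rewrite !dotDl !dotDr !dotZl !dotZr; apply/rowP => i; rewrite !mxE; ring.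
Qed.

HB.instance Definition _ z :=
  bilinear_isBilinear.Build R _ _ _ _ _ (sphere_bilin z) (sphere_bilinP z).

Definition sphere_curv : curvature R n := fun z => sphere_bilin z : {bilinear _ -> _ -> _}.

Lemma sphere_curvE i j l z : coef sphere_curv i j l z =
  - (recip m (rsq (sphere_base z)) / rho) *
    (sphere_base z ord0 j * z.2 i l + z.2 i j * sphere_base z ord0 l).
Proof.
have dotE (w : 'rV[R]_n) q : dot w (delta_mx 0 q) = w ord0 q.
  rewrite /dot -[RHS](sum_delta (fun q => w ord0 q)); apply: eq_bigr => p _.
  by rewrite mxE eqxx/= mulrC.
by rewrite /coef /= /sphere_bilin dotC !dotE -rowE !mxE.
Qed.

Lemma sphere_baseK y : sphere_base (T y) = y.
Proof.
by rewrite /sphere_base /= addrAC subrr add0r scalerA mulVf ?scale1r// gt_eqF.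
Qed.

Lemma sphere_curv_map i j l y : coef sphere_curv i j l (T y) =
  sphere_coef m rho y (recip m (rsq y)) i j l.
Proof. by rewrite sphere_curvE sphere_baseK. Qed.

Lemma coef_sphere_curv_continuous i j l : continuous (coef sphere_curv i j l).
Proof.
have bC p : C1 (fun z : phase R n => sphere_base z ord0 p).
  rewrite (_ : (fun z : phase R n => _) = fun z => rho^-1 * (z.1 ord0 p - c0 ord0 p)).
    apply: C1M; first exact: (C1_cst rho^-1).
    by apply: C1B; [exact: C1_fst|exact: (C1_cst (c0 ord0 p))].
  by apply/funext => z; rewrite !mxE.
have rC : C1 (fun z : phase R n => rsq (sphere_base z)).
  by apply: C1_sum => p; exact: (C1M (bC p) (bC p)).
have [kC _] := C1_compR (@is_derive_recip R m) (@drecip_continuous R m) rC.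
apply: C1_continuous.
rewrite (_ : coef _ i j l = fun z => - (recip m (rsq (sphere_base z)) * rho^-1) *
    (sphere_base z ord0 j * z.2 i l + z.2 i j * sphere_base z ord0 l)).
  apply: C1M; first exact: (C1N (C1M kC (C1_cst rho^-1))).
  exact: (C1D (C1M (bC j) (C1_snd i l)) (C1M (C1_snd i j) (bC l))).
by apply/funext => z; exact: sphere_curvE.
Qed.

Definition variation (phi : phase R n -> 'rV[R]_n) (z : phase R n) : R :=
  DP_term sphere_curv phi z + dot (tr_curv sphere_curv z) (phi z) + Dx_term phi z.

Lemma variation_continuous phi : C1 phi -> continuous (variation phi).
Proof.
move=> phiC.
have dC v i : continuous (fun z : phase R n => 'D_v phi z ord0 i).
  by apply: coord_comp_continuous; case: phiC => _; exact.
have pC i := C1_continuous (C1_row i phiC).1.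
have cM (f g : phase R n -> R) : continuous f -> continuous g ->
    continuous (fun z => f z * g z).
  by move=> cf cg z; apply: cvgM; [exact: cf|exact: cg].
have cD (f g : phase R n -> R) : continuous f -> continuous g ->
    continuous (fun z => f z + g z).
  by move=> cf cg z; apply: cvgD; [exact: cf|exact: cg].
apply: (cD (fun z => DP_term _ _ z + dot _ _)); first apply: cD.
- apply: continuous_sumR => i; apply: continuous_sumR => j.
  apply: continuous_sumR => l; apply: cM; first exact: dC.
  exact: coef_sphere_curv_continuous.
- apply: continuous_sumR => i; apply: cM; last exact: pC.
  rewrite (_ : (fun z => _) = fun z => \sum_l coef sphere_curv l l i z).
    by apply: continuous_sumR => l; exact: coef_sphere_curv_continuous.
  by apply/funext => z; rewrite /tr_curv summxE.
- apply: continuous_sumR => i; apply: continuous_sumR => j.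
  apply: cM; first exact: dC.
  by apply: coord_comp_continuous; exact: snd_continuous.
Qed.

(** For |y|^2 <= [lo] both sides vanish with the density; beyond, [recip] is the true reciprocal and
    the algebraic identity [sphere_divergence] applies. *)
Lemma divergence_variation (phi : phase R n -> 'rV[R]_n) y : C1 phi -> spanS y ->
  \sum_(j < n | (j < m.+1)%N)
    'D_(delta_mx 0 j) (sphere_field m c0 rho (fun i (z : phase R n) => phi z ord0 i) j) y =
  rho * (variation phi (T y) * radial m (rsq y)).
Proof.
move=> phiC yS; have fC i := (C1_row i phiC).1.
under eq_bigr => j _ do rewrite (C1_sphere_field m c0 rho j fC).2.
have [ylo|ylo] := leP (rsq y) (lo m).
  have [r0 d0] : radial m (rsq y) = 0 /\ dradial m (rsq y) = 0.
    by apply: radial0; left.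
  by rewrite r0 d0 !mulr0 big1// => j _; rewrite !mul0r addr0.
have k1 : recip m (rsq y) * dot y y = 1 by apply: recip_mul; exact: ltW.
(* The derivative of the density points along y, which P annihilates. *)
rewrite big_split/= [X in X + _](_ : _ = 0); last first.
  under eq_bigr => j _ do rewrite mulr_sumr.
  rewrite big_mkcond/=.
  transitivity (\sum_j \sum_i 2 * dradial m (rsq y) * phi (T y) ord0 i *
      (sphere_proj m (recip m (rsq y)) y i j * y ord0 j)).
    apply: eq_bigr => j _; case: ifPn => [_|/yS y0].
      by apply: eq_bigr => i _; ring.
    by rewrite big1// => i _; rewrite y0 !mulr0.
  rewrite exchange_big big1// => i _; rewrite -mulr_sumr.
  by rewrite (sphere_kill yS k1) mulr0.
rewrite add0r -mulr_sumr mulrCA mulrC mulrA; congr (_ * _).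
have := sphere_divergence mn rho0 yS k1 (drecip_far (ltW ylo))
  (fun i => phi (T y) ord0 i)
  (fun i j => 'D_((delta_mx 0 j, 0) : phase R n) (fun z : phase R n => phi z ord0 i) (T y))
  (fun i p q => 'D_((0, delta_mx p q) : phase R n) (fun z : phase R n => phi z ord0 i) (T y)).
rewrite /= => ->; rewrite [RHS]mulrC /variation; congr (_ * _); congr (_ + _ + _).
- apply: eq_bigr => i _; apply: eq_bigr => j _; apply: eq_bigr => l _.
  by rewrite sphere_curv_map (C1_row i phiC).2.
- apply: eq_bigr => i _; congr (_ * _); rewrite /tr_curv summxE.
  by apply: eq_bigr => l _; rewrite -sphere_curv_map.
- apply: eq_bigr => i _; apply: eq_bigr => j _.
  by rewrite (C1_row i phiC).2.
Qed.

End SphereVarifold.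

(** * Finiteness of kappa *)

Section FiniteKappa.
Context {R : realType} {n : nat}.
Local Notation bphase := (borel_phase R n).
Local Notation rV := (@borel_rV R n).

Lemma integrable_supported (V : {finite_measure set bphase -> \bar R})
    (S : set (phase R n)) (f : phase R n -> R) :
  compact S -> measurable (S : set bphase) -> V (~` S) = 0%E -> continuous f ->
  V.-integrable [set: bphase] (EFin \o f).
Proof.
move=> cS mS VS cf.
have mf : measurable_fun [set: bphase] (f : bphase -> R) by exact: continuous_measurable_phase.
have [M M0 hM] := continuous_compact_bounded cS cf.
have setTDC : setT `\` ~` (S : set bphase) = S by rewrite setDE setCK setTI.
have iS : V.-integrable (S : set bphase) (EFin \o f).
  apply: measurable_bounded_integrable => //.
  - by rewrite -ge0_fin_numE ?measure_ge0//; exact: fin_num_measure.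
  - exact: measurable_funTS.
  - by exists M; split; [exact: num_real|move=> M' MM' x Sx; exact: le_trans (hM x Sx) (ltW MM')].
have := @negligible_integrable _ _ _ V setT (~` (S : set bphase)) (EFin \o f).
rewrite setTDC; move=> -> //; first exact: measurableC.
exact/measurable_EFinP.
Qed.

Section Sphere.
Variables (m : nat) (c0 : 'rV[R]_n) (rho : R).
Hypothesis mn : (m < n)%N.
Hypothesis rho0 : 0 < rho.
Local Notation Hi := (@hi R m).
Local Notation Lo := (@lo R m).
Local Notation T := (sphere_map m c0 rho).
Local Notation s := [seq i : 'I_n <- enum 'I_n | (i < m.+1)%N].
Local Notation B := (@sphere_curv R n m c0 rho).

Lemma hi_ge2 : 2 <= Hi.
Proof. by rewrite /hi -natrM ler_nat mulnS. Qed.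

Lemma hi_lo : Hi = 10 * Lo. Proof. by rewrite /hi /lo; field. Qed.

Lemma radial_le (t : R) : radial m t <= Hi ^+ 2 * Hi ^+ 2.
Proof.
have h2 := hi_ge2; have l0 := @lo_ge R m.
have [[h|h]|[h1 h2']] : (t <= Lo \/ Hi <= t) \/ (Lo < t /\ t < Hi).
- by have [h|h] := leP t Lo; [left; left|have [h'|h'] := leP Hi t; [left; right|right]].
- by have [-> _] := radial0 (or_introl h); rewrite mulr_ge0 ?sqr_ge0.
- by have [-> _] := radial0 (or_intror h); rewrite mulr_ge0 ?sqr_ge0.
have a1 : 0 <= t - Lo by lra.
have a2 : 0 <= Hi - t by lra.
rewrite /radial /sqramp (ramp_pos a1) (ramp_pos a2).
by apply: ler_pM; rewrite ?sqr_ge0// ler_sqr ?nnegrE; lra.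
Qed.

Lemma radial_bounded (f : 'rV[R]_n -> R) : continuous f ->
  exists M, forall y, rsq y <= Hi -> `|f y| <= M.
Proof.
move=> cf; have cr : continuous (@rsq R n) by apply: C1_continuous; exact: C1_rsq.
have cK : compact [set y : 'rV[R]_n | rsq y <= Hi].
  apply: bounded_closed_compact; last first.
    by apply: (@closed_comp _ _ (@rsq R n) [set t | t <= Hi]) => [y _|]; [exact: cr|exact: closed_le].
  exists Hi; split; first exact: num_real.
  move=> N hN y /= hy; apply: le_trans (ltW hN).
  have h2 := hi_ge2; apply: norm_le_dot; first lra.
  by apply: (le_trans hy); rewrite expr2; nra.
have [M _ hM] := continuous_compact_bounded cK cf.
by exists M.
Qed.

Lemma measurable_sphere_map : measurable_fun setT (T : rV -> bphase).
Proof.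
apply: measurable_phase => [i|i j]; apply: continuous_measurable_rV; apply: C1_continuous.
  rewrite (_ : (fun y => _) = fun y : 'rV[R]_n => c0 ord0 i + rho * y ord0 i).
    apply: C1D; first exact: (C1_cst (c0 ord0 i)).
    by apply: C1M; [exact: (C1_cst rho)|exact: C1_rV].
  by apply/funext => y; rewrite /= !mxE.
exact: (C1_sphere_proj m rho i j).1.
Qed.

Lemma sphere_map_continuous : continuous T.
Proof.
move=> y; apply: differentiable_continuous.
rewrite (_ : sphere_map m c0 rho = fun y => (c0, coord_proj m) +
  \sum_(k <- index_enum _) sphere_tau m rho k y *: sphere_dir k).
  exact: (diff_combination _ _ _ y (C1_sphere_tau m rho)).1.
by apply/funext => z; exact: sphere_map_sum.
Qed.

Variable P : {finite_measure set rV -> \bar R}.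
Hypothesis PS : box_spec (L := Hi) s P.

Lemma in_s (i : 'I_n) : (i \in s) = (i < m.+1)%N.
Proof. by rewrite mem_filter mem_enum andbT. Qed.

Lemma variation_integral0 (phi : phase R n -> 'rV[R]_n) : C1 phi ->
  (\int[P]_y (variation m c0 rho phi (T y) * radial m (rsq y))%:E = 0)%E.
Proof.
move=> phiC; have [P0 PD _] := PS.
pose f (i : 'I_n) (z : phase R n) := phi z ord0 i.
have fC i : C1 (f i) := (C1_row i phiC).1.
pose F j := sphere_field m c0 rho f j.
pose DF (j : 'I_n) (y : 'rV[R]_n) : R := 'D_(delta_mx 0 j) (F j) y.
have FC j : C1 (F j) := (C1_sphere_field m c0 rho j fC).1.
have cDF j : continuous (DF j) by case: (FC j) => _; exact.
have DF0 j y : Hi <= rsq y -> DF j y = 0.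
  move=> h; rewrite /DF (C1_sphere_field m c0 rho j fC).2.
  by have [-> ->] := radial0 (or_intror h); rewrite !mul0r addr0.
have bDF j : exists M, forall y, `|DF j y| <= M.
  have [M hM] := radial_bounded (cDF j).
  exists (Num.max M 0) => y; rewrite le_max; have [h|h] := leP (rsq y) Hi.
    by rewrite hM.
  by rewrite (DF0 j y (ltW h)) normr0 lexx orbT.
have mDF j : measurable_fun setT (DF j : rV -> R) by exact: continuous_measurable_rV.
have iDF j : P.-integrable [set: rV] (EFin \o DF j).
  have [M hM] := bDF j.
  apply: measurable_bounded_integrable => //.
  - by rewrite -ge0_fin_numE ?measure_ge0//; exact: fin_num_measure.
  - by exists M; split; [exact: num_real|move=> M' MM' x _; exact: le_trans (hM x) (ltW MM')].
have cvar : continuous (fun y => variation m c0 rho phi (T y) * radial m (rsq y)).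
  have c1 : continuous (fun y => variation m c0 rho phi (T y)).
    move=> y; apply: (@continuous_comp _ _ _ T (variation m c0 rho phi)).
      exact: sphere_map_continuous.
    exact: variation_continuous.
  have c2 : continuous (fun y : 'rV[R]_n => radial m (rsq y)).
    by apply: C1_continuous; exact: (C1_radial m).1.
  by move=> y; exact: (cvgM (c1 y) (c2 y)).
pose G (y : rV) : R := rho^-1 * \sum_(j <- s) DF j y.
have Gs y : G y = rho^-1 * \sum_(j < n | (j < m.+1)%N) DF j y.
  by rewrite /G big_filter big_enum_cond.
transitivity (\int[P]_y (G y)%:E)%E.
  apply: ae_eq_integral => //.
  - by apply/measurable_EFinP; exact: (continuous_measurable_rV cvar).
  - apply/measurable_EFinP; apply: measurable_funM => //.
    by apply: measurable_sum => j; exact: mDF.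
  (* The divergence identity holds on the coordinate subspace, whose complement is P-negligible. *)
  exists (~` [set y : 'rV[R]_n | forall i, i \notin s -> y ord0 i = 0]); split=> //.
    apply: measurableC; apply: measurable_closed_rV.
    exact: (@closed_coords _ _ [pred i | i \notin s] [set x : R | x = 0] (@closed_eq _ 0)).
  move=> y /= hy h; apply: hy => _; congr _%:E; rewrite Gs.
  rewrite (divergence_variation c0 mn rho0 phiC) ?mulKf ?gt_eqF// => i hS.
  by apply: h; rewrite in_s.
have -> : (\int[P]_y (G y)%:E = rho^-1%:E * \int[P]_y (\sum_(j <- s) DF j y)%:E)%E.
  rewrite -integralZl//; last first.
    rewrite (_ : (fun y => _) = fun y => (\sum_(j <- s) (DF j y)%:E)%E).
      by apply: integrable_sum => // j _; exact: iDF.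
    by apply/funext => y; rewrite sumEFin.
rewrite (_ : (\int[P]_y _)%E = 0%E) ?mule0//.
under eq_integral do rewrite -sumEFin.
rewrite integral_sum// big_seq big1// => j js.
have [M hM] := bDF j; apply: (PD j (F j) M) => // y hy.
(* A coordinate of size at least [Hi] gives |y|^2 >= [Hi] squared >= [Hi], so the field is 0 on the
   faces of the cube. *)
have h : Hi <= rsq y.
  apply: le_trans (sqr_coord_le_dot y j); have h2 := hi_ge2.
  by rewrite -(real_normK (num_real (y ord0 j))); nra.
by rewrite /F /sphere_field (radial0 (or_intror h)).1 mul0r.
Qed.

Variable Omega : set 'rV[R]_n.
Hypothesis bO : bounded_set Omega.
Hypothesis ballO : forall y : 'rV[R]_n, rsq y <= Hi -> Omega (c0 + rho *: y).
Variable p : R.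
Hypothesis p1 : 1 <= p.

(** The shell varifold has boundary varifold 0, positive mass and finite L^p curvature, so kappa =
    +oo would contradict [mass_kappa]; its mass need not be computed. *)
Lemma sphere_kappa : (kappa Omega m p < +oo)%E.
Proof.
have [P0 PD P12] := PS; have h2 := hi_ge2; have l0 := @lo_ge R m.
pose S : set (phase R n) := @support R n m Omega.
have cS : compact S by exact: support_compact.
have mS : measurable (S : set bphase) by exact: support_measurable.
have hc : continuous (fun y : 'rV[R]_n => radial m (rsq y)).
  by apply: C1_continuous; exact: (C1_radial m).1.
have H0 : 0 < Hi ^+ 2 * Hi ^+ 2 by rewrite mulr_gt0 ?exprn_gt0//; lra.
have [V [Vnull Vpos Vint]] := exists_density_image P hc (fun y => radial_ge0 m (rsq y))
  H0 (fun y => radial_le (rsq y)) measurable_sphere_map.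
pose N : set 'rV[R]_n := ~` [set y : 'rV[R]_n | forall i, i \notin s -> y ord0 i = 0].
have mNc : measurable (~` N : set rV).
  rewrite /N setCK; apply: measurable_closed_rV.
  exact: (@closed_coords _ _ [pred i | i \notin s] [set x : R | x = 0] (@closed_eq _ 0)).
have mN : measurable (N : set rV) by rewrite -(setCK N); exact: measurableC.
have VS : V (~` (S : set bphase)) = 0%E.
  apply: (Vnull _ N) => // [|y hy r0]; first exact: measurableC.
  move=> yS; apply: hy.
  have [h1 h3] : Lo < rsq y /\ rsq y < Hi.
    split; rewrite ltNge; apply/negP => h.
      by have [E _] := radial0 (or_introl h); rewrite E ltxx in r0.
    by have [E _] := radial0 (or_intror h); rewrite E ltxx in r0.
  split; first by apply: subset_closure; apply: ballO; exact: ltW.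
  apply: (sphere_proj_Grass mn) => [i Hi|]; first by apply: yS; rewrite in_s.
  exact: recip_mul (ltW h1).
have mG : measurable (setT `*` Grass m : set bphase).
  apply: closed_measurable_phase.
  rewrite (_ : _ `*` _ = (fun z : phase R n => z.2) @^-1` Grass m); last first.
    by apply/seteqP; split=> z; [case|split].
  by apply: closed_comp => [z _|]; [exact: snd_continuous|exact: Grass_closed].
have VG : V (~` (setT `*` Grass m : set bphase)) = 0%E.
  apply/eqP; rewrite eq_le measure_ge0 andbT -VS; apply: le_measure; rewrite ?inE.
  - exact: measurableC.
  - exact: measurableC.
  - by move=> z h [h1 h3]; apply: h.
have H : CV_perp Omega m V B mzero.
  split.
  - split=> [|K cK]; first exact: VG.
    rewrite -ge0_fin_numE ?measure_ge0//; apply: fin_num_measure.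
    apply: closed_measurable_phase; apply: compact_closed cK; exact: norm_hausdorff.
  - exact: VS.
  - move=> i j l; apply: (integrable_supported cS mS VS).
    exact: coef_sphere_curv_continuous.
  - by split=> [|K _]; rewrite /mzero/= ?ltry.
  - move=> phi phiC; rewrite integral_measure_zero oppe0.
    have cvar := @variation_continuous R n m c0 rho phi phiC.
    transitivity (\int[V]_z (variation m c0 rho phi z)%:E)%E.
      rewrite [RHS](@negligible_integral _ _ _ V _ (~` (setT `*` Grass m : set bphase)))//.
      + by rewrite setDE setCK setTI.
      + exact: measurableC.
      + exact: (integrable_supported cS mS VS cvar).
    have cc : continuous (fun y => variation m c0 rho phi (T y)).
      move=> y; apply: (@continuous_comp _ _ _ T (variation m c0 rho phi)).
        exact: sphere_map_continuous.
      exact: cvar.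
    have [M hM] := radial_bounded cc.
    rewrite (Vint _ M cvar); first exact: variation_integral0.
    move=> y r0; apply: hM; rewrite leNgt; apply/negP => h.
    by have [E _] := radial0 (or_intror (ltW h)); rewrite E ltxx in r0.
have massV : (0 < mass V)%E.
  pose A := [set y : 'rV[R]_n | forall i, i \in s -> 1 <= y ord0 i <= 2].
  have mA : measurable (A : set rV).
    apply: measurable_closed_rV.
    apply: (@closed_coords _ _ [pred i | i \in s] [set x | 1 <= x <= 2]).
    by rewrite (_ : [set _ | _] = `[1, 2]%classic); [exact: interval_closed|rewrite set_itvE].
  apply: (Vpos (A `&` ~` N) (Lo ^+ 2 * Lo ^+ 2)); first exact: measurableI.
  - by rewrite mulr_gt0 ?exprn_gt0//; lra.
  - move=> y [Ay /contrapT yS].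
    have E : rsq y = \sum_(j < n | (j < m.+1)%N) y ord0 j * y ord0 j.
      rewrite /rsq /dot [RHS]big_mkcond; apply: eq_bigr => j _; case: ifPn => // hj.
      by rewrite yS ?in_s// mul0r.
    have d1 : m.+1%:R <= rsq y.
      rewrite -(@sum_inS R n m mn) E; apply: ler_sum => j hj.
      by have := Ay j; rewrite in_s => /(_ hj) /andP[h3 h4]; nra.
    have d2 : rsq y <= 4 * m.+1%:R.
      rewrite -(@sum_inS R n m mn) E mulr_sumr; apply: ler_sum => j hj.
      by have := Ay j; rewrite in_s => /(_ hj) /andP[h3 h4]; nra.
    (* In units of [Lo]: |y|^2 lies between 2 and 8 while [Hi] is 10, so both squared ramps are at
       least [Lo ^+ 2]. *)
    have e1 : m.+1%:R = 2 * Lo by rewrite /lo; field.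
    have e2 := hi_lo.
    rewrite /radial /sqramp !ramp_pos; try lra.
    by apply: ler_pM; rewrite ?sqr_ge0// ler_sqr ?nnegrE; lra.
  - apply: (lt_le_trans P12).
    rewrite (measureDI P mA mNc) setDE setCK.
    apply: (@le_trans _ _ (0 + P (A `&` ~` N))%E); last by rewrite add0e.
    apply: leeD; last exact: lexx.
    rewrite -P0; apply: le_measure; rewrite ?inE//.
    exact: measurableI.
have LpV : (Lp_norm_pow V p B < +oo)%E.
  rewrite Lp_norm_powE ?gt_eqF ?(lt_le_trans ltr01)//.
  have cN : continuous (norm_curv B).
    move=> z; apply: (@continuous_comp _ _ _ _ (@Num.sqrt R)); last exact: sqrt_continuous.
    apply: continuous_sumR => i; apply: continuous_sumR => j; apply: continuous_sumR => l.
    have cc : continuous (coef B i j l) by exact: coef_sphere_curv_continuous.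
    by move=> {}z; exact: (cvgM (cc z) (cc z)).
  have [M M0 hM] := continuous_compact_bounded cS cN.
  have mN' : measurable_fun [set: bphase] (fun z : bphase => (norm_curv B z `^ p)%:E).
    apply/measurable_EFinP; apply: (measurableT_comp (measurable_powR p)).
    exact: continuous_measurable_phase.
  have mSc : measurable (~` (S : set bphase)) by exact: measurableC.
  have setTDC : setT `\` ~` (S : set bphase) = S by rewrite setDE setCK setTI.
  rewrite (ge0_negligible_integral mSc measurableT mN')//; last first.
    by move=> z _; rewrite lee_fin powR_ge0.
  rewrite setTDC; apply: (@le_lt_trans _ _ (\int[V]_(z in (S : set bphase)) (M `^ p)%:E)%E).
    apply: ge0_le_integral => //.
    - by move=> z _; rewrite lee_fin powR_ge0.
    - exact: measurable_funTS.
    - move=> z Sz; rewrite lee_fin ge0_ler_powR ?nnegrE ?sqrtr_ge0//.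
        exact: le_trans p1.
      exact: le_trans (ler_norm _) (hM z Sz).
  rewrite integral_cst//; apply: lte_mul_pinfty; rewrite ?lee_fin ?powR_ge0//.
  by rewrite -ge0_fin_numE ?measure_ge0//; exact: fin_num_measure.
rewrite ltNge leye_eq; apply/negP => /eqP kE.
have := mass_kappa bO p1 H; rewrite kE gt0_muley// => h.
by have := le_lt_trans h LpV; rewrite ltxx.
Qed.

End Sphere.

Lemma kappa_lt_pinfty (Omega : set 'rV[R]_n) (m : nat) (p : R) :
  open Omega -> Omega !=set0 -> bounded_set Omega -> (m < n)%N -> 1 <= p ->
  (kappa Omega m p < +oo)%E.
Proof.
move=> oO [c0 Oc0] bO mn p1.
have /nbhs_normP[r /= r0 hr] : nbhs c0 Omega by exact: open_nbhs_nbhs.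
(* |y|^2 <= [hi] <= [hi] squared bounds the norm of y by [hi], so rho y has norm at most r / 2. *)
have h2 := @hi_ge2 m; pose rho := r / (2 * @hi R m).
have rho0 : 0 < rho by rewrite divr_gt0//; lra.
have [|P PS] := @exists_box_measure R n (@hi R m) h2 [seq i : 'I_n <- enum 'I_n | (i < m.+1)%N].
  by rewrite filter_uniq// enum_uniq.
apply: (sphere_kappa (c0 := c0) mn rho0 PS bO _ p1) => // y hy; apply: hr.
rewrite /ball_/= opprD addrA subrr add0r normrN normrZ gtr0_norm//.
have ny : `|y| <= @hi R m.
  apply: norm_le_dot; first lra.
  by apply: (le_trans hy); rewrite expr2; nra.
apply: (@le_lt_trans _ _ (rho * @hi R m)); first by rewrite ler_pM2l.
have hn : @hi R m != 0 by apply: lt0r_neq0; lra.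
have -> : rho * @hi R m = r / 2 by rewrite /rho; field; rewrite ?hn.
by lra.
Qed.

End FiniteKappa.

Theorem theorem4 (R : realType) (n m : nat) (Omega : set 'rV[R]_n) :
  (1 <= m <= n - 1)%N ->
  bounded_C2_domain Omega ->
  ~ (exists Delta : set 'rV[R]_n, orthogonal_slice Omega m Delta) ->
  forall p : R, 1 <= p ->
    [/\ (0%:E < kappa Omega m p)%E,
        forall (V : {measure set (borel_phase R n) -> \bar R})
               (B : curvature R n)
               (Gamma : {measure set (borel_phase R n) -> \bar R}),
          CV_perp Omega m V B Gamma ->
          (mass V <= (kappa Omega m p)^-1 * Lp_norm_pow V p B)%E
      & exists C : R,
          forall (V : {measure set (borel_phase R n) -> \bar R})
                 (B : curvature R n)
                 (Gamma : {measure set (borel_phase R n) -> \bar R}),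
          CV_perp Omega m V B Gamma ->
          (mass Gamma <= C%:E * Lp_norm_pow V p B)%E].
Proof.
move=> /andP[m0 mn1] [oO On _ bO cO] noslice p p1.
have mn : (m < n)%N.
  (* The subtraction is truncated: m >= 1 guarantees n > 0, hence n - 1 < n. *)
  by rewrite (leq_ltn_trans mn1)// ltn_subrL (leq_trans m0 (leq_trans mn1 (leq_subr _ _))).
have kfin : (kappa Omega m p < +oo)%E by exact: kappa_lt_pinfty.
split.
- exact: kappa_gt0.
- by move=> V B Gamma; exact: mass_le.
- exact: mass_boundary_le.
Qed.
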